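(* Let $2\le d\le 8$, $\alpha\ge\frac d4+\frac12$, $\nu>0$, and $\theta:=1-\frac{d}{4\alpha}$. There is a constant $C_{\alpha,\nu}>0$, depending only on $\alpha$, $\nu$ (and $d$), such that the following holds. Let $\mu>0$, $h>0$, let $I_h$ be a linear interpolant satisfying $\|I_h(\mathbf g)-\mathbf g\|_{V^s}^2\le c_{0,\alpha}h^2\|\mathbf g\|_{V^{s+\alpha}}^2$ for every $s\ge0$ and every $\mathbf g\in V^{s+\alpha}$, and let $\mathbf f\in H$ be time-independent. Let $t_0\ge0$ and $\mathbf u_0,\mathbf v_0\in V^{2\alpha}$. Let $\mathbf u$ be a classical solution on $[0,\infty)$ of $$\mathbf u_t+B(\mathbf u,\mathbf u)+\nu A^\alpha\mathbf u=\mathbf f,\qquad \mathbf u(0)=\mathbf u_0,$$ and let $\mathbf v$ be a classical solution, defined on $[t_0,\infty)$, of $$\mathbf v_t+B(\mathbf v,\mathbf v)+\nu A^\alpha\mathbf v=\mathbf f+\mu P_\sigma I_h(\mathbf u-\mathbf v),\qquad \mathbf v(t_0)=\mathbf v_0.$$ Suppose that $$\mu>2C_{\alpha,\nu}\sup_{t\ge t_0}\|\mathbf u(t)\|_{V}^{1/\theta}\qquad\text{and}\qquad \mu h^2c_{0,\alpha}\le\nu.$$ Then $\|\mathbf u(t)-\mathbf v(t)\|_{L^2}$ decays to $0$ exponentially fast in time, i.e. there are constants $M,\lambda>0$ with $\|\mathbf u(t)-\mathbf v(t)\|_{L^2}\le Me^{-\lambda(t-t_0)}$ for all $t\ge t_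0$.
   Context: The domain is the torus $\Omega=\mathbb T^d=\mathbb R^d/\mathbb Z^d=[0,1]^d$. Let $\mathcal V$ be the set of $d$-dimensional vector-valued trigonometric polynomials $\varphi$ on $\Omega$ with $\nabla\cdot\varphi=0$ and $\int_\Omega\varphi\,d\mathbf x=0$. $H$ is the closure of $\mathcal V$ in $L^2(\Omega)^d$, with the $L^2$ norm. $P_\sigma$ is the Leray–Helmholtz projector (orthogonal projection of $L^2(\Omega)^d$ onto $H$). The fractional Laplacian is the Fourier multiplier $(-\Delta)^s\mathbf g(\mathbf x)=\sum_{\mathbf k\in\mathbb Z^d}(2\pi|\mathbf k|)^{2s}\widehat{\mathbf g}_{\mathbf k}e^{2\pi i\mathbf k\cdot\mathbf x}$, and $A^s:=P_\sigma(-\Delta)^s$. For $s\ge0$, $V^s$ is the closure of $\mathcal V$ in the norm $\|\mathbf g\|_{V^s}=\|(-\Delta)^{s/2}\mathbf g\|_{L^2}$ (which equals $\|A^{s/2}\mathbf g\|_{L^2}$ on $\mathcal V$); $V^0=H$, and $V=V^1$ with $\|\mathbf g\|_V=\|\nabla\mathbf g\|_{L^2}$. $B(\mathbf a,\mathbf b):=P_\sigma((\mathbf a\cdot\nabla)\mathbf b)$, extended by continuity from $\mathcal V$. $I_h$ is a linear operator on $V^\alpha$ with values in $L^2(\Omega)^d$, with associated length scale $h>0$; $c_{0,\alpha}>0$ is a constant, and in the bound on $I_h$ the norm on the left is $\|(-\Delta)^{s/2}(I_h(\mathbf g)-\mathbf g)\|_{L^2}$. A classical solution $\mathbf u$ on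 $[0,\infty)$ belongs to $C([0,T];V^{2\alpha})\cap L^2(0,T;V^{3\alpha})$ for every $T>0$; a classical solution $\mathbf v$ on $[t_0,\infty)$ belongs to $L^\infty(t_0,T;V^{2\alpha})\cap L^2(t_0,T;V^{3\alpha})$ for every $T>t_0$, is weakly continuous in time with values in $H$, and satisfies its equation and initial condition. *)

(* Defs.v *)
From HB Require Import structures.
From mathcomp Require Import all_boot all_order all_algebra.
From mathcomp Require Import all_classical all_reals all_analysis.
From mathcomp.real_closed Require Import complex.

Set Implicit Arguments.
Unset Strict Implicit.
Unset Printing Implicit Defensive.

Import Order.TTheory GRing.Theory Num.Theory.
Import numFieldNormedType.Exports.

Local Open Scope classical_set_scope.
Local Open Scope ring_scope.

(* The torus T^d = R^d/Z^d is represented by d.-tuple R carrying the Lebesgue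
   measure of [0,1]^d.  Functions on T^d are functions on d.-tuple R up to
   almost-everywhere equality for that measure, so their values outside
   [0,1]^d are irrelevant. *)
Section torus_measure.
Context (R : realType).

Definition tcons n (p : measurableTypeR R * n.-tuple R) : n.+1.-tuple R :=
  [the n.+1.-tuple R of p.1 :: p.2].

Lemma measurable_tcons n : measurable_fun setT (@tcons n).
Proof. exact: measurable_cons. Qed.

HB.instance Definition _ n :=
  isMeasurableFun.Build _ _ _ _ (@tcons n) (@measurable_tcons n).

(* Lebesgue measure on [0,1]^d, as the d-fold product of the uniform
   probability on [0,1], i.e. of Lebesgue measure restricted to [0,1]. *)
Fixpoint torus_measure (d : nat) : probability (d.-tuple R) R :=
  match d with
  | 0%N => dirac ([tuple] : 0.-tuple R)
  | n.+1 => distribution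
      (uniform_prob (@ltr01 R) \x torus_measure n)%E (@tcons n)
  end.

End torus_measure.

Section fields.
Context (R : realType) (d : nat).

(* g i is the i-th component of the vector field g *)
Definition field := 'I_d -> d.-tuple R -> R.

Implicit Types (g f a b phi psi : field) (k : 'rV[int]_d) (s : R).

Let mu : {measure set (d.-tuple R) -> \bar R} := torus_measure R d.

Definition aeq f g : Prop := forall i, {ae mu, forall x, f i x = g i x}.

Definition L2 g : Prop := forall i, g i \in Lfun mu 2%:E.

Definition inner f g : R :=
  (\int[mu]_x (\sum_(i < d) f i x * g i x))%R.

Definition L2norm g : \bar R :=
  poweR (\int[mu]_x (\sum_(i < d) g i x ^+ 2)%:E)%E 2^-1.

Definition kdot k (x : d.-tuple R) : R := \sum_(i < d) (k 0 i)%:~R * tnth x i.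

Definition kabs k : R := Num.sqrt (\sum_(i < d) (k 0 i)%:~R ^+ 2).

Definition cexp k (x : d.-tuple R) : R[i] :=
  Complex (cos (2 * pi * kdot k x)) (sin (2 * pi * kdot k x)).

(* the integral of g i x * e^{-2 pi i k.x}, by real and imaginary parts *)
Definition fourier g k (i : 'I_d) : R[i] :=
  Complex (\int[mu]_x (g i x * cos (2 * pi * kdot k x)))%R
        (- \int[mu]_x (g i x * sin (2 * pi * kdot k x)))%R.

(* (real-valued) vector trigonometric polynomials *)
Definition trigpoly g : Prop :=
  exists (ks : seq 'rV[int]_d) (c : 'rV[int]_d -> 'I_d -> R[i]),
    forall i x, Complex (g i x) 0 = \sum_(k <- ks) c k i * cexp k x.

Definition subst_coord (x : d.-tuple R) (j : 'I_d) (r : R) : d.-tuple R :=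
  [tuple if i == j then r else tnth x i | i < d].

Definition partial (j : 'I_d) (h : d.-tuple R -> R) (x : d.-tuple R) : R :=
  derive1 (fun r : R => h (subst_coord x j r)) (tnth x j).

Definition divergence g (x : d.-tuple R) : R := \sum_(i < d) partial i (g i) x.

(* (a . nabla) b *)
Definition advection a b : field :=
  fun i x => \sum_(j < d) a j x * partial j (b i) x.

(* the class of test fields, script V *)
Definition testV g : Prop :=
  [/\ trigpoly g,
      forall x, divergence g x = 0
    & forall i, (\int[mu]_x g i x)%R = 0].

Definition H g : Prop :=
  L2 g /\ forall e : R, 0 < e ->
    exists phi, testV phi /\ (L2norm (g - phi)%R < e%:E)%E.

(* P_sigma, defined up to aeq.  All operators below that are defined by
   [xget] are determined up to aeq on their domain. *)
Definition leray g : field :=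
  xget 0 [set p | H p /\ forall phi, H phi -> inner (g - p) phi = 0].

(* All L^2 representatives of (-Delta)^s g, for g in L^2 and s >= 0; the set
   is empty when the Fourier multiplier does not produce an L^2 field.
   Since 0 `^ 0 = 1, the case s = 0 gives g itself, including its mean. *)
Definition fraclap_repr s g : set field :=
  [set F | [/\ L2 g, L2 F & forall k i,
    fourier F k i = Complex ((2 * pi * kabs k) `^ (2 * s)) 0 * fourier g k i]].

Definition fraclap s g : field := xget 0 (fraclap_repr s g).

(* A^s *)
Definition stokes s g : field := leray (fraclap s g).

(* ||(-Delta)^(s/2) g||_{L^2}; the infimum is over a set of a.e. equal fields,
   and equals +oo when (-Delta)^(s/2) g is not in L^2. *)
Definition Vnorm s g : \bar R := ereal_inf (L2norm @` fraclap_repr (s / 2) g).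

(* V^s.  The homogeneous norm does not see the mean, so the closure is taken
   inside H; on mean-zero fields the V^s-norm controls the L^2-norm. *)
Definition V s g : Prop :=
  H g /\ forall e : R, 0 < e ->
    exists phi, testV phi /\ (Vnorm s (g - phi)%R < e%:E)%E.

(* B(a,b) for a, b in V^s : the limit in H of P_sigma((phi . nabla) psi) as
   phi -> a and psi -> b in the V^s-norm with phi, psi in testV. *)
Definition B s a b : field :=
  xget 0 [set c | H c /\ forall e : R, 0 < e -> exists2 del : R, 0 < del &
    forall phi psi, testV phi -> testV psi ->
      (Vnorm s (phi - a)%R < del%:E)%E -> (Vnorm s (psi - b)%R < del%:E)%E ->
      (L2norm (leray (advection phi psi) - c)%R < e%:E)%E].

(* I_h is only constrained on V^alpha, where it is linear with values in L^2. *)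
Definition interpolant (alpha c0 h : R) (Ih : field -> field) : Prop :=
  [/\ forall g, V alpha g -> L2 (Ih g),
      forall (r : R) g f, V alpha g -> V alpha f ->
        aeq (Ih (fun i x => r * g i x + f i x))
            (fun i x => r * Ih g i x + Ih f i x)
    & forall s g, 0 <= s -> V (s + alpha) g ->
        (Vnorm s (Ih g - g)%R ^+ 2 <= (c0 * h ^+ 2)%:E * Vnorm (s + alpha)%R g ^+ 2)%E].

Implicit Types (z w : R -> field) (t T : R).

Local Notation leb := (@lebesgue_measure R).

Definition V_simple s z : Prop :=
  exists (n : nat) (E : 'I_n -> set R) (c : 'I_n -> field),
    [/\ forall j, measurable (E j), forall j, V s (c j)
      & forall t i x, z t i x = \sum_(j < n) \1_(E j) t * c j i x].

(* strong (Bochner) measurability on (t0, T) with values in V^s *)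
Definition V_measurable s (t0 : R) T z : Prop :=
  exists zn : nat -> R -> field, (forall n, V_simple s (zn n)) /\
    {ae leb, forall t, t0 < t < T ->
      Vnorm s (zn n t - z t)%R @[n --> \oo] --> 0%E}.

Definition in_C s (t0 : R) T z : Prop :=
  forall t, t0 <= t <= T -> V s (z t) /\
    Vnorm s (z r - z t)%R @[r --> within `[t0, T] (nbhs t)] --> 0%E.

Definition in_L2 s (t0 : R) T z : Prop :=
  [/\ V_measurable s t0 T z,
      {ae leb, forall t, t0 < t < T -> V s (z t)}
    & (\int[leb]_(t in `]t0, T[) (Vnorm s (z t) ^+ 2) < +oo)%E].

Definition in_Loo s (t0 : R) T z : Prop :=
  [/\ V_measurable s t0 T z,
      {ae leb, forall t, t0 < t < T -> V s (z t)}
    & exists M : R, {ae leb, forall t, t0 < t < T -> (Vnorm s (z t) <= M%:E)%E}].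

Definition weakly_continuous (t0 : R) z : Prop :=
  (forall t, t0 <= t -> H (z t)) /\
  forall phi, H phi ->
    {within `[t0, +oo[, continuous (fun t => inner (z t) phi)}.

(* w is the time derivative z_t on [t0, oo): z(t) = z(t0) + int_t0^t w, the
   integral being taken weakly, i.e. against test fields. *)
Definition time_derivative (t0 : R) z w : Prop :=
  forall phi, testV phi -> forall t, t0 <= t ->
    leb.-integrable `[t0, t] (fun r => (inner (w r) phi)%:E) /\
    inner (z t) phi =
      inner (z t0) phi + (\int[leb]_(r in `[t0, t]) inner (w r) phi)%R.

(* z_t + B(z,z) + nu A^alpha z = F for a.e. t > t0, and z(t0) = z0 *)
Definition solves (alpha nu t0 : R) (z0 : field) (F z : R -> field) : Prop :=
  aeq (z t0) z0 /\
  exists w, time_derivative t0 z w /\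
    {ae leb, forall t, t0 < t ->
      aeq (fun i x => w t i x + B (2 * alpha) (z t) (z t) i x
                      + nu * stokes alpha (z t) i x) (F t)}.

Definition classical_u (alpha nu : R) f (u0 : field) (u : R -> field) : Prop :=
  (forall T, 0 < T -> in_C (2 * alpha) 0 T u /\ in_L2 (3 * alpha) 0 T u) /\
  solves alpha nu 0 u0 (fun=> f) u.

Definition classical_v (alpha nu muc t0 : R) (Ih : field -> field) f
    (v0 : field) (u v : R -> field) : Prop :=
  [/\ forall T, t0 < T ->
        in_Loo (2 * alpha) t0 T v /\ in_L2 (3 * alpha) t0 T v,
      weakly_continuous t0 v
    & solves alpha nu t0 v0
        (fun t i x => f i x + muc * leray (Ih (u t - v t)) i x) v].

End fields.

(* Main.v *)
(* Writing w = u - v, the energy method gives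
     (1/2) d/dt |w|^2 + nu |w|_{V^alpha}^2 =
       - <B(u,u) - B(v,v), w> - mu <P I_h w, w>,
   and <B(u,u) - B(v,v), w> = <B(w,u), w>, since <B(v,w), w> = 0.  With
   W_k = 1 + (2 pi |k| / N)^(2 alpha), expanding w in Fourier series and
   applying Cauchy-Schwarz and Bessel to the resulting double sum gives
     |<B(w,u), w>| <= c (sum_k W_k^(-2))^(1/2) |u|_V
                        (|w|^2 + N^(-2 alpha) |w|_{V^alpha}^2),
   where the lattice sum is O(N^d) because 4 alpha > d; this replaces the
   Sobolev and interpolation inequalities.  Choosing N so that the last term
   is absorbed by the dissipation leaves C |u|_V^(1/theta) |w|^2.  (When |u|_V
   is too small for N >= 1, N = 1 works, as |w| <= |w|_{V^alpha}.)  Since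
   |I_h w - w| <= sqrt(c0) h |w|_{V^alpha} and mu h^2 c0 <= nu, the feedback term
   leaves a damping mu/2, which beats C sup |u|_V^(1/theta).

   Finally, u and v are bounded in V^(2 alpha) on bounded time intervals, so w
   is Lipschitz in time with values in H, and the decay follows from
     |w(t)|^2 (1 + 2 lambda (t - s)) <= |w(s)|^2 + O((t - s)^2)
   without differentiating |w|^2. *)

Require Import Defs.
From HB Require Import structures.
From mathcomp Require Import all_boot all_order all_algebra.
From mathcomp Require Import all_classical all_reals all_analysis.
From mathcomp Require Import measurable_realfun zify ring lra.
From mathcomp.real_closed Require Import complex.

Set Implicit Arguments.
Unset Strict Implicit.
Unset Printing Implicit Defensive.

Import Order.TTheory GRing.Theory Num.Theory.
Import numFieldNormedType.Exports.

Local Open Scope classical_set_scope.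
Local Open Scope ring_scope.

(** * The space L2 of a probability space *)

(** [B] and [leray] are chosen representatives of limits and projections, so identities for them are
    used only after pairing with a test field. Estimates are proved for trigonometric polynomials,
    where products, derivatives and integrals are finite sums, and are carried over by truncation.
    The delicate point is the cancellation of [<B(v,w), w>]: it is applied to truncated fields, so
    [u], [v] and [u - v] must be cut at one common set of frequencies, on which truncation is
    linear. Approximation statements therefore hold for all frequency sets beyond some threshold,
    not just for one.

    Since [k] and [-k] are both kept, coefficient families carry a parity constraint and partial
    sums run over symmetric sets. Norms are controlled by finite sums in both directions: Bessel
    bounds the sums of a given field, and Riesz-Fischer builds a field from bounded sums.

    In time, each equation holds almost everywhere, its derivative is known only against test
    fields, and [v] is bounded in [V^(2 alpha)] only almost everywhere. Duality turns this into a
    Lipschitz estimate valid at all times, which is what the finite steps of the decay argument rest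
    on. *)

Section L2_space.
Context d (T : measurableType d) (R : realType) (P : probability T R).
Implicit Types f g h : T -> R.

Definition ip f g : R := (\int[P]_x (f x * g x))%R.

Lemma Lfun2_measurable f : f \in Lfun P 2%:E -> measurable_fun setT f.
Proof. by rewrite inE => /andP[]; rewrite inE. Qed.

Lemma Lfun2_ext f g : f =1 g -> f \in Lfun P 2%:E -> g \in Lfun P 2%:E.
Proof. by move=> /funext ->. Qed.

Lemma Lfun2P f : measurable_fun setT f ->
  P.-integrable setT (EFin \o (fun x => f x ^+ 2)) -> f \in Lfun P 2%:E.
Proof.
move=> mf /integrableP[_ fi]; rewrite inE; apply/andP; split; rewrite inE//=.
rewrite /finite_norm unlock /Lnorm /= poweR_lty//.
apply: le_lt_trans fi; rewrite le_eqVlt; apply/orP; left; apply/eqP.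
by apply: eq_integral => x _ /=; rewrite powR_mulrn// normrX.
Qed.

Lemma Lfun2_intM f g : f \in Lfun P 2%:E -> g \in Lfun P 2%:E ->
  P.-integrable setT (EFin \o (fun x => f x * g x)).
Proof. by move=> f2 g2; apply/Lfun1_integrable; exact: Lfun2_mul_Lfun1. Qed.

Lemma Lfun2_lin (a : R) f g : f \in Lfun P 2%:E -> g \in Lfun P 2%:E ->
  (fun x => a * f x + g x) \in Lfun P 2%:E.
Proof.
have h : (1 <= 2%:E :> \bar R)%E by rewrite lee_fin ler1n.
have [_ H] := Lfun_submod_closed P h.
by move=> f2 g2; exact: (H a f g f2 g2).
Qed.

Lemma Lfun2_cst0 : (fun=> 0) \in Lfun P 2%:E.
Proof. exact: Lfun_cst. Qed.

Lemma Lfun2Z (a : R) f : f \in Lfun P 2%:E -> (fun x => a * f x) \in Lfun P 2%:E.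
Proof.
move=> f2; have := Lfun2_lin a f2 Lfun2_cst0.
by apply: Lfun2_ext => x; rewrite addr0.
Qed.

Lemma Lfun2D f g : f \in Lfun P 2%:E -> g \in Lfun P 2%:E ->
  (fun x => f x + g x) \in Lfun P 2%:E.
Proof.
move=> f2 g2; have := Lfun2_lin 1 f2 g2.
by apply: Lfun2_ext => x; rewrite mul1r.
Qed.

Lemma Lfun2B f g : f \in Lfun P 2%:E -> g \in Lfun P 2%:E ->
  (fun x => f x - g x) \in Lfun P 2%:E.
Proof.
move=> f2 g2; have := Lfun2_lin (-1) g2 f2.
by apply: Lfun2_ext => x; rewrite mulN1r addrC.
Qed.

Lemma Lfun2_sum (I : Type) (s : seq I) (F : I -> T -> R) :
  (forall i, F i \in Lfun P 2%:E) ->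
  (fun x => \sum_(i <- s) F i x) \in Lfun P 2%:E.
Proof.
move=> F2; elim: s => [|i s ih].
  by under eq_fun do rewrite big_nil; exact: Lfun2_cst0.
by under eq_fun do rewrite big_cons; exact: Lfun2D.
Qed.

Lemma bounded_Lfun2M f g (M : R) : measurable_fun setT f ->
  (forall x, `|f x| <= M) -> g \in Lfun P 2%:E ->
  (fun x => f x * g x) \in Lfun P 2%:E.
Proof.
move=> mf fM g2; apply: Lfun2P.
  by apply: measurable_funM => //; exact: Lfun2_measurable.
apply: (@le_integrable _ _ _ P _ measurableT _ (EFin \o (fun x => M ^+ 2 * g x ^+ 2))).
- apply/measurable_EFinP; apply: measurable_funX; apply: measurable_funM => //.
  exact: Lfun2_measurable.
- move=> x _ /=; rewrite lee_fin -exprMn !normrX !normrM.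
  rewrite ler_pXn2r ?nnegrE ?mulr_ge0// ler_wpM2r//.
  exact: le_trans (fM x) (ler_norm _).
- have := integrableZl measurableT (M ^+ 2) (Lfun2_integrable_sqr g2).
  by apply: eq_integrable => // x _ /=; rewrite EFinM.
Qed.

Lemma bounded_Lfun2 f (M : R) : measurable_fun setT f ->
  (forall x, `|f x| <= M) -> f \in Lfun P 2%:E.
Proof.
move=> mf fM; have := bounded_Lfun2M mf fM (Lfun_cst P 1 2).
by apply: Lfun2_ext => x; rewrite mulr1.
Qed.

Lemma ipC f g : ip f g = ip g f.
Proof. by apply: eq_Rintegral => x _; rewrite mulrC. Qed.

Lemma ip_linl (a : R) f g h : f \in Lfun P 2%:E -> g \in Lfun P 2%:E ->
  h \in Lfun P 2%:E -> ip (fun x => a * f x + g x) h = a * ip f h + ip g h.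
Proof.
move=> f2 g2 h2; rewrite /ip.
under eq_Rintegral do rewrite mulrDl -mulrA.
rewrite RintegralD//; last 2 first.
- have := integrableZl measurableT a (Lfun2_intM f2 h2).
  by apply: eq_integrable => // x _ /=; rewrite EFinM.
- exact: Lfun2_intM.
by rewrite RintegralZl//; exact: Lfun2_intM.
Qed.

Lemma ip0l h : ip (fun=> 0) h = 0.
Proof.
rewrite /ip; under eq_Rintegral do rewrite mul0r.
by rewrite Rintegral_cst// mul0r.
Qed.

Lemma ipZl (a : R) f h : f \in Lfun P 2%:E -> h \in Lfun P 2%:E ->
  ip (fun x => a * f x) h = a * ip f h.
Proof.
move=> f2 h2; have := ip_linl a f2 Lfun2_cst0 h2.
by rewrite ip0l addr0 => <-; congr ip; apply/funext => x; rewrite addr0.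
Qed.

Lemma ipDl f g h : f \in Lfun P 2%:E -> g \in Lfun P 2%:E ->
  h \in Lfun P 2%:E -> ip (fun x => f x + g x) h = ip f h + ip g h.
Proof.
move=> f2 g2 h2; have := ip_linl 1 f2 g2 h2.
by rewrite mul1r => <-; congr ip; apply/funext => x; rewrite mul1r.
Qed.

Lemma ipBl f g h : f \in Lfun P 2%:E -> g \in Lfun P 2%:E ->
  h \in Lfun P 2%:E -> ip (fun x => f x - g x) h = ip f h - ip g h.
Proof.
move=> f2 g2 h2; have := ip_linl (-1) g2 f2 h2.
rewrite mulN1r addrC => <-; congr ip; apply/funext => x.
by rewrite mulN1r addrC.
Qed.

Lemma ip_suml (I : Type) (s : seq I) (F : I -> T -> R) h :
  (forall i, F i \in Lfun P 2%:E) -> h \in Lfun P 2%:E ->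
  ip (fun x => \sum_(i <- s) F i x) h = \sum_(i <- s) ip (F i) h.
Proof.
move=> F2 h2; elim: s => [|i s ih].
  by under eq_fun do rewrite big_nil; rewrite ip0l big_nil.
under eq_fun do rewrite big_cons.
by rewrite big_cons ipDl ?ih//; exact: Lfun2_sum.
Qed.

Lemma ip_sumr (I : Type) (s : seq I) (F : I -> T -> R) h :
  (forall i, F i \in Lfun P 2%:E) -> h \in Lfun P 2%:E ->
  ip h (fun x => \sum_(i <- s) F i x) = \sum_(i <- s) ip h (F i).
Proof.
by move=> F2 h2; rewrite ipC ip_suml//; apply: eq_bigr => i _; rewrite ipC.
Qed.

Lemma ip_ge0 f : 0 <= ip f f.
Proof. by apply: Rintegral_ge0 => x _; rewrite -expr2 sqr_ge0. Qed.

Lemma ip_integral f : f \in Lfun P 2%:E ->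
  (\int[P]_x (f x ^+ 2)%:E)%E = (ip f f)%:E.
Proof.
move=> f2; rewrite /ip /Rintegral fineK; last first.
  by apply: integrable_fin_num => //; exact: Lfun2_intM.
by apply: eq_integral => x _; rewrite expr2.
Qed.

End L2_space.

(** * Almost-everywhere equal integrands and completeness of L2 *)

Section L2_limits.
Context d (T : measurableType d) (R : realType) (P : probability T R).

Import HBNNSimple.

(* The library's [ae_eq_integral] asks both functions to be measurable; this
   version, which only needs the definition of the integral as a supremum
   over simple functions, does not. *)
Lemma ge0_ae_le_integral (f g : T -> \bar R) :
  (forall x, 0 <= f x)%E -> (forall x, 0 <= g x)%E ->
  {ae P, forall x, f x = g x} -> (\int[P]_x f x <= \int[P]_x g x)%E.
Proof.
move=> f0 g0 [N [mN N0 fgN]]; rewrite ge0_integralTE// [leRHS]ge0_integralTE//.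
apply: ge_ereal_sup => _ [h /= hf <-]; apply: ereal_sup_ubound => /=.
have mC : measurable (~` N) by exact: measurableC.
(* A simple function below [f], cut to the complement of the null set, lies below [g] and keeps its
   integral. *)
exists (proj_nnsfun h mC).
  move=> x; rewrite /= mindicE; case: (boolP (x \in ~` N)) => xN.
    rewrite mulr1; have -> : g x = f x; last exact: hf.
    by apply: contrapT => fgx; move: xN; rewrite inE; apply; apply: fgN => /= /esym.
  by rewrite mulr0.
rewrite -[LHS]integralT_nnsfun -[RHS]integralT_nnsfun.
apply: ge0_ae_eq_integral => //; try exact/measurable_EFinP.
- by move=> x _; rewrite lee_fin fun_ge0.
- by move=> x _; rewrite lee_fin fun_ge0.
- exists N; split => // x /= /not_implyP[_] h1.
  apply: contrapT => xN; apply: h1; rewrite /= mindicE mem_set ?mulr1//.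
Qed.

Lemma ae_eq_Rintegral (f g : T -> R) :
  {ae P, forall x, f x = g x} -> (\int[P]_x f x = \int[P]_x g x)%R.
Proof.
move=> fg; rewrite /Rintegral; congr fine.
have gf : {ae P, forall x, g x = f x} by apply: filterS fg => x ->.
rewrite integralE [RHS]integralE; congr (_ - _)%E; apply/eqP;
  rewrite eq_le; apply/andP; split; apply: ge0_ae_le_integral => //.
- by apply: filterS fg => x /= e; rewrite !funeposE e.
- by apply: filterS gf => x /= e; rewrite !funeposE e.
- by apply: filterS fg => x /= e; rewrite !funenegE e.
- by apply: filterS gf => x /= e; rewrite !funenegE e.
Qed.

(** Young's inequality [|f| <= (f^2 / c + c) / 2] holds pointwise, and on a probability space its
    right-hand side integrates to at most [c]. *)
Lemma integral_le_of_sqr (f : T -> R) (c : R) : f \in Lfun P 2%:E -> 0 < c ->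
  ip P f f <= c ^+ 2 -> (\int[P]_x `|f x|%:E <= c%:E)%E.
Proof.
move=> f2 c0 fc; have mf := Lfun2_measurable f2.
apply: (@le_trans _ _ (\int[P]_x (2^-1 * (c^-1 * f x ^+ 2 + c))%:E)%E).
  apply: ge0_le_integral => //.
  - by apply/measurable_EFinP; exact: measurableT_comp.
  - apply/measurable_EFinP; apply: measurable_funM => //.
    by apply: measurable_funD => //; apply: measurable_funM => //; exact: measurable_funX.
  - move=> x _; rewrite lee_fin -subr_ge0.
    have -> : 2^-1 * (c^-1 * f x ^+ 2 + c) - `|f x| = 2^-1 * c^-1 * (`|f x| - c) ^+ 2.
      by rewrite sqrrB real_normK ?num_real//; field; rewrite gt_eqF.
    by rewrite mulr_ge0 ?sqr_ge0// mulr_ge0 ?invr_ge0 ?ltW.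
have i2 := Lfun2_integrable_sqr f2.
have e1 : (\int[P]_x (2^-1 * (c^-1 * f x ^+ 2 + c))%:E)%E
   = (2^-1 * (c^-1 * ip P f f + c))%:E.
  under eq_integral do rewrite mulrDr EFinD mulrA [X in (X + _)%E]EFinM.
  rewrite integralD//; last 2 first.
  - exact: integrableZl.
  - exact: finite_measure_integrable_cst.
  rewrite integralZl// integral_cst// ip_integral// [X in (_ + _ * X)%E]probability_setT mule1.
  by rewrite -EFinM -EFinD; congr EFin; ring.
rewrite e1 lee_fin.
have : c^-1 * ip P f f <= c.
  by rewrite ler_pdivrMl// -expr2.
move=> h; lra.
Qed.

(** The series of the [|f n.+1 - f n|] has integral at most the sum of the [2^-n], that is 2, so it
    is finite almost everywhere; there the telescoping series converges absolutely. *)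
Lemma fast_cauchy_ae_cvg (f : nat -> T -> R) :
  (forall n, f n \in Lfun P 2%:E) ->
  (forall n, ip P (fun x => f n.+1 x - f n x) (fun x => f n.+1 x - f n x)
               <= ((2^-1 : R) ^+ n) ^+ 2) ->
  exists A : set T, [/\ measurable A, P (~` A) = 0%E
    & forall x, A x -> cvgn (fun n => f n x)].
Proof.
move=> f2 fc; pose D n x := `|f n.+1 x - f n x|.
have mD n : measurable_fun setT (D n).
  apply: measurableT_comp => //; apply: measurable_funB; exact: Lfun2_measurable.
have D0 n x : 0 <= D n x by exact: normr_ge0.
pose S x := (\sum_(n <oo) (D n x)%:E)%E.
have S0 x : (0 <= S x)%E by apply: nneseries_ge0 => n _ _; rewrite lee_fin D0.
have mS : measurable_fun setT S.
  by apply: ge0_emeasurable_sum => n *; rewrite ?lee_fin ?D0//; exact/measurable_EFinP.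
have iS : P.-integrable setT S.
  apply/integrableP; split => //.
  under eq_integral do rewrite gee0_abs//.
  rewrite integral_nneseries//; last first.
  - by move=> n x _; rewrite lee_fin D0.
  - by move=> n; exact/measurable_EFinP.
  apply: (@le_lt_trans _ _ (\sum_(n <oo) ((2^-1 : R) ^+ n)%:E)%E).
    apply: lee_nneseries => n *; first by apply: integral_ge0 => x _; rewrite lee_fin D0.
    apply: (@integral_le_of_sqr (fun x => f n.+1 x - f n x)) => //; first exact: Lfun2B.
  apply: (@le_lt_trans _ _ 2%:E); last exact: ltry.
  apply: lime_le; first by apply: is_cvg_nneseries => n _ _; rewrite lee_fin exprn_ge0.
  apply: nearW => n /=; rewrite sumEFin lee_fin big_mkord.
  elim: n => [|n ih]; first by rewrite big_ord0.
  rewrite big_ord_recl expr0.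
  under eq_bigr do rewrite lift0 exprS.
  by rewrite -mulr_sumr; lra.
exists [set x | S x \is a fin_num]; split.
- have -> : [set x | S x \is a fin_num] = S @^-1` [set y | y \is a fin_num] by [].
  rewrite -[X in measurable X]setTI; apply: mS => //.
  rewrite (_ : [set y : \bar R | y \is a fin_num] = ~` ([set -oo%E] `|` [set +oo%E])).
    by apply: measurableC; apply: measurableU; exact: emeasurable_set1.
  apply/seteqP; split => y /=; first by move=> yf [] e; rewrite e in yf.
  by case: y => [r| |] //= h; exfalso; apply: h; [right|left].
- have [N [mN N0 sN]] := integrable_ae measurableT iS.
  apply: (@subset_measure0 _ _ _ P _ N) => //.
    apply: measurableC.
    have -> : [set x | S x \is a fin_num] = S @^-1` [set y | y \is a fin_num] by [].
    rewrite -[X in measurable X]setTI; apply: mS => //.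
    rewrite (_ : [set y : \bar R | y \is a fin_num] = ~` ([set -oo%E] `|` [set +oo%E])).
      by apply: measurableC; apply: measurableU; exact: emeasurable_set1.
    apply/seteqP; split => y /=; first by move=> yf [] e; rewrite e in yf.
    by case: y => [r| |] //= h; exfalso; apply: h; [right|left].
  by move=> x xS; apply: sN => /= h; apply: xS; exact: h.
- move=> x /= Sx.
  have cn : cvgn (series (fun n => f n.+1 x - f n x)).
    apply: normed_cvg; apply: nondecreasing_is_cvgn.
      by apply: nondecreasing_series => n _ _; exact: normr_ge0.
    exists (fine (S x)) => _ [n _ <-]; rewrite -lee_fin fineK//.
    rewrite /normed_series_of /series /= -sumEFin; apply: nneseries_lim_ge => k _ _.
    by rewrite lee_fin D0.
  have -> : (fun n => f n x) = (fun n => f 0%N x + series (fun n => f n.+1 x - f n x) n).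
    by apply/funext => n; rewrite /series /= telescope_sumr// addrC subrK.
  by apply: is_cvgD => //; exact: is_cvg_cst.
Qed.

Lemma L2_complete (f : nat -> T -> R) :
  (forall n, f n \in Lfun P 2%:E) ->
  (forall e, 0 < e -> exists N : nat, forall n m, (N <= n)%N -> (N <= m)%N ->
    ip P (fun x => f n x - f m x) (fun x => f n x - f m x) <= e) ->
  exists2 g, g \in Lfun P 2%:E & forall e, 0 < e -> exists N : nat,
    forall n, (N <= n)%N -> ip P (fun x => f n x - g x) (fun x => f n x - g x) <= e.
Proof.
move=> f2 fC.
have q0 k : 0 < ((2^-1 : R) ^+ k) ^+ 2 by rewrite !exprn_gt0.
have [N NP] := choice (fun k => fC _ (q0 k)).
(* An index that dominates both [k] and every [N j] with [j <= k], without assuming [N] monotone. *)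
pose phi k := (k + \sum_(j < k.+1) N j)%N.
have Nphi k j : (j <= k)%N -> (N j <= phi k)%N.
  move=> jk; rewrite /phi (bigD1 (inord j)) //= inordK//.
  by rewrite addnCA leq_addr.
pose fs k := f (phi k).
have fsC k : ip P (fun x => fs k.+1 x - fs k x) (fun x => fs k.+1 x - fs k x)
    <= ((2^-1 : R) ^+ k) ^+ 2 by apply: NP; exact: Nphi.
have [A [mA PA cA]] := fast_cauchy_ae_cvg (fun k => f2 (phi k)) fsC.
(* Setting the subsequence to zero off the convergence set makes it converge everywhere, so that its
   limit is measurable. *)
pose h k x := fs k x * \1_A x.
pose g x := limn (fun k => h k x).
have hg x : h ^~ x @ \oo --> g x.
  rewrite /g; have [Ax|nAx] := pselect (A x).
    have -> : h ^~ x = fs ^~ x by apply/funext => k; rewrite /h indicE mem_set// mulr1.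
    exact: cA.
  have -> : h ^~ x = cst 0 by apply/funext => k; rewrite /h indicE memNset// mulr0.
  by rewrite lim_cst//; exact: cvg_cst.
have mh k : measurable_fun setT (h k).
  by apply: measurable_funM; [exact: Lfun2_measurable (f2 _) | exact: measurable_indic].
have mg : measurable_fun setT g by apply: (@measurable_fun_cvg _ _ _ _ h).
(* Fatou along the subsequence transfers the Cauchy bound from [f n - fs (k + M)] to [f n - g]; the
   shift by [M] puts every index of the subsequence in the Cauchy range. *)
have key e : 0 < e -> exists M : nat, forall n, (M <= n)%N ->
    (\int[P]_x ((f n x - g x) ^+ 2)%:E <= e%:E)%E.
  move=> e0; have [M MP] := fC _ e0; exists M => n Mn.
  pose F k x := ((f n x - h (k + M)%N x) ^+ 2)%:E.
  have mF k : measurable_fun setT (F k).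
    apply/measurable_EFinP/measurable_funX/measurable_funB => //.
    exact: Lfun2_measurable.
  have -> : (\int[P]_x ((f n x - g x) ^+ 2)%:E = \int[P]_x limn_einf (F ^~ x))%E.
    apply: eq_integral => x _; apply/esym.
    have cF : F ^~ x @ \oo --> ((f n x - g x) ^+ 2)%:E.
      apply: cvg_EFin; first by apply: nearW.
      have hM : (fun k => f n x - h (k + M)%N x) @ \oo --> f n x - g x.
        apply: cvgB; first exact: cvg_cst.
        by have := hg x; rewrite -(cvg_shiftn M).
      rewrite expr2; exact: (cvgM hM hM).
    by have [-> _] := cvg_limn_einf_sup cF.
  apply: (le_trans (fatou _ measurableT mF _)) => //.
    by move=> k x _; rewrite lee_fin sqr_ge0.
  rewrite limn_einf_lim; apply: lime_le; first exact: is_cvg_einfs.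
  apply: nearW => k; apply: (@le_trans _ _ (\int[P]_x F k x)%E).
    by apply: ereal_inf_lbound; exists k => /=.
  have -> : (\int[P]_x F k x = \int[P]_x ((f n x - fs (k + M)%N x) ^+ 2)%:E)%E.
    apply: ge0_ae_eq_integral => //.
    - apply/measurable_EFinP/measurable_funX/measurable_funB; exact: (Lfun2_measurable (f2 _)).
    - by move=> x _; rewrite lee_fin sqr_ge0.
    - by move=> x _; rewrite lee_fin sqr_ge0.
    exists (~` A); split => //; first exact: measurableC.
    move=> x /= /not_implyP[_] h1 Ax; apply: h1.
    by rewrite /F /h indicE mem_set// mulr1.
  rewrite (ip_integral (Lfun2B (f2 n) (f2 (phi (k + M)%N)))) lee_fin; apply: MP => //.
  by rewrite /phi -addnA addnCA leq_addr.
have g2 : g \in Lfun P 2%:E.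
  have [M MP] := key 1 ltr01.
  have d2 : (fun x => f M x - g x) \in Lfun P 2%:E.
    apply: Lfun2P; first by apply: measurable_funB => //; exact: Lfun2_measurable.
    apply/integrableP; split.
      apply/measurable_EFinP/measurable_funX/measurable_funB => //.
      exact: Lfun2_measurable.
    under eq_integral do rewrite gee0_abs ?lee_fin ?sqr_ge0//.
    by apply: le_lt_trans (MP M (leqnn M)) _; exact: ltry.
  by apply: Lfun2_ext (Lfun2B (f2 M) d2) => x; rewrite subKr.
exists g => // e e0; have [M MP] := key e e0; exists M => n Mn.
by have := MP n Mn; rewrite (ip_integral (Lfun2B (f2 n) g2)) lee_fin.
Qed.

End L2_limits.

(** * Fourier series on the torus *)

Section uniform01.
Context (R : realType).
Let U : probability (measurableTypeR R) R := uniform_prob (@ltr01 R).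

Lemma cos_2pi_nat (n : nat) : cos (2 * pi * n%:R) = 1 :> R.
Proof.
have -> : 2 * pi * n%:R = 0 + pi *+ 2 *+ n :> R by rewrite add0r mulr_natr mulr_natl.
by rewrite (periodicn (@cosD2pi R)) cos0.
Qed.

Lemma sin_2pi_nat (n : nat) : sin (2 * pi * n%:R) = 0 :> R.
Proof.
have -> : 2 * pi * n%:R = 0 + pi *+ 2 *+ n :> R by rewrite add0r mulr_natr mulr_natl.
by rewrite (periodicn (@sinD2pi R)) sin0.
Qed.

Lemma cos_2pi_int (m : int) : cos (2 * pi * m%:~R) = 1 :> R.
Proof. by case: (intP m) => [|n|n]; rewrite ?mulr0 ?cos0 ?mulrNz ?mulrN ?cosN ?cos_2pi_nat. Qed.

Lemma sin_2pi_int (m : int) : sin (2 * pi * m%:~R) = 0 :> R.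
Proof. by case: (intP m) => [|n|n]; rewrite ?mulr0 ?sin0 ?mulrNz ?mulrN ?sinN ?sin_2pi_nat ?oppr0. Qed.

Lemma Rintegral_uniform01 (f F : R -> R) : (forall x, `|f x| <= 1) ->
  continuous f -> (forall x : R, is_derive x 1 F (f x)) ->
  (\int[U]_x f x)%R = F 1 - F 0.
Proof.
move=> f1 cf dF.
have mf : measurable_fun setT f by exact: continuous_measurable_fun.
have i1 : U.-integrable setT (EFin \o f).
  apply: (@le_integrable _ _ _ U _ measurableT _ (EFin \o cst 1)).
  - exact/measurable_EFinP.
  - by move=> x _ /=; rewrite lee_fin normr1.
  - exact: finite_measure_integrable_cst.
(* The integral formula for the uniform law is applied to nonnegative integrands: [f] is shifted by
   1, and the shift is subtracted at the end. *)
have g0 x : 0 <= f x + 1 by have := f1 x; rewrite ler_norml => /andP[]; lra.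
have : (\int[U]_x (f x + 1)%:E)%E = (F 1 - F 0 + 1)%:E.
  rewrite integral_uniform; last 2 first.
  - by apply/measurable_EFinP; exact: measurable_funD.
  - by move=> x; rewrite lee_fin.
  rewrite subr0 invr1 mul1e.
  have dG (x : R) : is_derive x 1 (fun y => F y + y) (f x + 1).
    by apply: is_deriveD.
  have cG : continuous (fun y : R => F y + y).
    by move=> x; apply/differentiable_continuous/derivable1_diffP; case: (dG x).
  rewrite (@continuous_FTC2 _ _ (fun y => F y + y)) ?ltr01//.
  - by rewrite -EFinB; congr (_%:E); ring.
  - apply: continuous_subspaceT => x; apply: cvgD; [exact: cf|exact: cvg_cst].
  - split.
    + by move=> x _; case: (dG x).
    + exact/cvg_at_right_filter/cG.
    + exact/cvg_at_left_filter/cG.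
  - by move=> x _; rewrite derive1E; exact: (@derive_val _ _ _ _ _ _ _ (dG x)).
rewrite /Rintegral; under [X in X = _ -> _]eq_integral do rewrite EFinD.
rewrite integralD//; last exact: finite_measure_integrable_cst.
rewrite integral_cst// [X in (_ + _ * X)%E]probability_setT mule1.
have /fineK <- : (\int[U]_x (f x)%:E)%E \is a fin_num by exact: integrable_fin_num.
by rewrite -EFinD => -[] e; apply: (addIr 1).
Qed.

Lemma is_derive_sin_scale (c x : R) :
  is_derive x 1 (fun y : R => sin (c * y)) (c * cos (c * x)).
Proof.
have dl : is_derive x 1 (fun y : R => c * y) c.
  by apply: is_derive_eq; rewrite /GRing.scale /= mulr1.
by have := @is_derive1_comp _ (@sin R) (fun y => c * y) x _ _ (is_derive_sin _) dl; rewrite mulrC.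
Qed.

Lemma is_derive_cos_scale (c x : R) :
  is_derive x 1 (fun y : R => cos (c * y)) (- (c * sin (c * x))).
Proof.
have dl : is_derive x 1 (fun y : R => c * y) c.
  by apply: is_derive_eq; rewrite /GRing.scale /= mulr1.
by have := @is_derive1_comp _ (@cos R) (fun y => c * y) x _ _ (is_derive_cos _) dl;
  rewrite mulNr mulrC.
Qed.

Lemma Rintegral_cos_uniform (m : int) :
  (\int[U]_x cos (2 * pi * (m%:~R * x)))%R = (m == 0)%:R.
Proof.
have [->|m0] := eqVneq m 0.
  apply: etrans; [apply: (@Rintegral_uniform01 _ id)|].
  - by move=> x; exact: cos_max.
  - under eq_fun do rewrite mul0r mulr0 cos0.
    by move=> x; exact: cvg_cst.
  - by move=> x; rewrite mul0r mulr0 cos0; exact: is_derive_id.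
  - by rewrite subr0.
have p0 : 2 * pi * m%:~R != 0 :> R by rewrite !mulf_neq0 ?intr_eq0 ?(gt_eqF (pi_gt0 R)).
apply: etrans; [apply: (@Rintegral_uniform01 _ (fun x => (2 * pi * m%:~R)^-1 * sin (2 * pi * m%:~R * x)))|].
- by move=> x; exact: cos_max.
- move=> x; apply: (@continuous_comp _ _ _ (fun y : R => 2 * pi * (m%:~R * y)) (@cos R));
    last exact: continuous_cos.
  by apply: cvgM; [exact: cvg_cst|apply: cvgM; [exact: cvg_cst|exact: cvg_id]].
- move=> x; have h := is_derive_sin_scale (2 * pi * m%:~R) x.
  by apply: is_derive_eq; rewrite /GRing.scale /= mulrA mulVf// mul1r mulrA.
- by rewrite /= mulr0 sin0 mulr1 sin_2pi_int !mulr0 subrr.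
Qed.

Lemma Rintegral_sin_uniform (m : int) :
  (\int[U]_x sin (2 * pi * (m%:~R * x)))%R = 0.
Proof.
have [->|m0] := eqVneq m 0.
  apply: etrans; [apply: (@Rintegral_uniform01 _ (cst 0))|].
  - by move=> x; exact: sin_max.
  - under eq_fun do rewrite mul0r mulr0 sin0.
    by move=> x; exact: cvg_cst.
  - by move=> x; rewrite mul0r mulr0 sin0; exact: is_derive_cst.
  - by rewrite subr0.
have p0 : 2 * pi * m%:~R != 0 :> R by rewrite !mulf_neq0 ?intr_eq0 ?(gt_eqF (pi_gt0 R)).
apply: etrans; [apply: (@Rintegral_uniform01 _ (fun x => - (2 * pi * m%:~R)^-1 * cos (2 * pi * m%:~R * x)))|].
- by move=> x; exact: sin_max.
- move=> x; apply: (@continuous_comp _ _ _ (fun y : R => 2 * pi * (m%:~R * y)) (@sin R));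
    last exact: continuous_sin.
  by apply: cvgM; [exact: cvg_cst|apply: cvgM; [exact: cvg_cst|exact: cvg_id]].
- move=> x; have h := is_derive_cos_scale (2 * pi * m%:~R) x.
  by apply: is_derive_eq; rewrite /GRing.scale /= mulrNN mulrA mulVf// mul1r mulrA.
- by rewrite /= mulr0 cos0 mulr1 cos_2pi_int subrr.
Qed.

End uniform01.

(** * Orthogonality relations of the trigonometric modes *)

Section torus_trig.
Context (R : realType).

(* The functions [cs (k, true)] = cos(2 pi k.x) and [cs (k, false)] =
   sin(2 pi k.x), over all frequencies k, form a tight frame rather than an
   orthonormal system: k and -k give the same function up to the sign [par]. *)
Definition mode d := ('rV[int]_d * bool)%type.

Definition cs d (p : mode d) (x : d.-tuple R) : R :=
  if p.2 then cos (2 * pi * kdot p.1 x) else sin (2 * pi * kdot p.1 x).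

Definition par (b : bool) : R := if b then 1 else -1.

Definition mopp d (p : mode d) : mode d := (- p.1, p.2).

Lemma kdotD d (k l : 'rV[int]_d) (x : d.-tuple R) : kdot (k + l) x = kdot k x + kdot l x.
Proof.
by rewrite /kdot -big_split; apply: eq_bigr => i _; rewrite mxE intrD mulrDl.
Qed.

Lemma kdotN d (k : 'rV[int]_d) (x : d.-tuple R) : kdot (- k) x = - kdot k x.
Proof.
by rewrite /kdot -sumrN; apply: eq_bigr => i _; rewrite mxE mulrNz mulNr.
Qed.

Lemma measurable_kdot d (k : 'rV[int]_d) : measurable_fun setT (@kdot R d k).
Proof.
apply: measurable_sum => i; apply: measurable_funM => //.
exact: measurable_tnth.
Qed.

Lemma measurable_cs d (p : mode d) : measurable_fun setT (cs p).
Proof.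
have m2 : measurable_fun setT (fun x => 2 * pi * @kdot R d p.1 x).
  by apply: measurable_funM => //; exact: measurable_kdot.
rewrite /cs; case: p.2.
- by apply: measurableT_comp m2; exact: continuous_measurable_fun (@continuous_cos R).
- by apply: measurableT_comp m2; exact: continuous_measurable_fun (@continuous_sin R).
Qed.

Lemma cs_le1 d (p : mode d) x : `|cs p x| <= 1.
Proof. by rewrite /cs; case: p.2; [exact: cos_max|exact: sin_max]. Qed.

Lemma Lfun2_cs d (p : mode d) : cs p \in Lfun (torus_measure R d) 2%:E.
Proof. by apply: bounded_Lfun2 (@cs_le1 _ p); exact: measurable_cs. Qed.

Lemma cs_opp d (p : mode d) x : cs (mopp p) x = par p.2 * cs p x.
Proof.
by rewrite /cs /par /=; case: p.2; rewrite kdotN mulrN ?cosN ?sinN ?mul1r ?mulN1r.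
Qed.

(** The four product-to-sum formulas at once: two modes of the same type multiply to cosines, two of
    different types to sines. *)
Lemma csM d (p q : mode d) x : cs p x * cs q x = 2^-1 *
  ((if p.2 || q.2 then 1 else -1) * cs (p.1 + q.1, p.2 == q.2) x
 + (if p.2 && ~~ q.2 then -1 else 1) * cs (p.1 - q.1, p.2 == q.2) x).
Proof.
have eD : 2 * pi * kdot (p.1 + q.1) x = 2 * pi * kdot p.1 x + 2 * pi * kdot q.1 x.
  by rewrite kdotD mulrDr.
have eB : 2 * pi * kdot (p.1 - q.1) x = 2 * pi * kdot p.1 x - 2 * pi * kdot q.1 x.
  by rewrite kdotD kdotN mulrBr.
by rewrite /cs /= eD eB; case: p.2; case: q.2 => /=; rewrite ?cosD ?sinD ?cosN ?sinN; field.
Qed.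

Lemma Rintegral_torusS d (f : d.+1.-tuple R -> R) (M : R) :
  measurable_fun setT f -> (forall x, `|f x| <= M) ->
  (\int[torus_measure R d.+1]_x f x)%R =
  (\int[uniform_prob (@ltr01 R)]_a
     (\int[torus_measure R d]_y f (tcons (a, y))))%R.
Proof.
move=> mf fM; rewrite /Rintegral.
have mfc : measurable_fun setT (f \o @tcons R d) by exact: measurableT_comp.
pose PP : probability _ R := (uniform_prob (@ltr01 R) \x torus_measure R d)%E.
have ic : PP.-integrable setT (EFin \o (f \o @tcons R d)).
  apply: (@le_integrable _ _ _ _ _ measurableT _ (EFin \o cst M)).
  - exact/measurable_EFinP.
  - by move=> x _ /=; rewrite lee_fin; apply: le_trans (fM _) (ler_norm _).
  - exact: (finite_measure_integrable_cst PP).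
rewrite [torus_measure R d.+1]/= integral_distribution//; last exact/measurable_EFinP.
rewrite -(integral12_prod_meas1 ic); congr fine.
apply: eq_integral => a _; rewrite fineK//.
have mfa : measurable_fun setT (fun y : d.-tuple R => f (tcons (a, y))).
  exact: (measurableT_comp mfc (pair1_measurable a)).
apply: integrable_fin_num => //.
apply: (@le_integrable _ _ _ _ _ measurableT _ (EFin \o cst M)).
- exact/measurable_EFinP.
- by move=> x _ /=; rewrite lee_fin; apply: le_trans (fM _) (ler_norm _).
- exact: finite_measure_integrable_cst.
Qed.

Lemma Rintegral_cs d (p : mode d) :
  (\int[torus_measure R d]_x cs p x)%R = (p == (0, true))%:R.
Proof.
(* Cosines and sines go through the induction on the dimension together, since the addition formulas
   mix them when the first coordinate is integrated out. *)
suff H k : (\int[torus_measure R d]_x cs (k, true) x)%R = (k == 0)%:R /\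
           (\int[torus_measure R d]_x cs (k, false) x)%R = 0.
  by case: p => k []; rewrite xpair_eqE ?andbT ?andbF; case: (H k).
elim: d k {p} => [|d IH] k.
  have -> : k = 0 by apply/matrixP => i [].
  rewrite eqxx /cs /=.
  under eq_Rintegral do rewrite /kdot big_ord0 mulr0 cos0.
  under [X in _ /\ X = _]eq_Rintegral do rewrite /kdot big_ord0 mulr0 sin0.
  rewrite !Rintegral_cst// mul0r mul1r; split => //.
  exact: (congr1 fine (@probability_setT _ _ R (torus_measure R 0))).

pose m := k 0 ord0; pose k' : 'rV[int]_d := \row_i k 0 (lift ord0 i).
have ke (a : R) (y : d.-tuple R) :
    kdot k (tcons (a, y)) = m%:~R * a + kdot k' y.
  rewrite /kdot big_ord_recl; congr (_ + _).
  by apply: eq_bigr => i _; rewrite mxE tnthS.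
have k0 : (k == 0) = (m == 0) && (k' == 0).
  apply/eqP/andP => [k00|[/eqP m0 /eqP k'0]].
    by split; apply/eqP; [rewrite /m k00 mxE | apply/rowP => i; rewrite !mxE k00 mxE].
  apply/rowP => i; rewrite mxE; case: (unliftP ord0 i) => [j|] ->; last exact: m0.
  by move/rowP/(_ j): k'0; rewrite !mxE.
have [IHc IHs] := IH k'.
have L2c (p : mode d) : (torus_measure R d).-integrable setT (EFin \o cs p).
  by apply/Lfun1_integrable; apply: Lfun_subset12; [exact: fin_num_measure|exact: Lfun2_cs].
have U2 (m' : int) : (uniform_prob (@ltr01 R)).-integrable setT
    (EFin \o (fun a : R => cos (2 * pi * (m'%:~R * a)))).
  apply: (@le_integrable _ _ _ _ _ measurableT _ (EFin \o cst 1)).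
  - apply/measurable_EFinP; apply: measurableT_comp.
      exact: continuous_measurable_fun (@continuous_cos R).
    by do 2 apply: measurable_funM => //.
  - by move=> x _ /=; rewrite lee_fin normr1 cos_max.
  - exact: finite_measure_integrable_cst.
have U2s (m' : int) : (uniform_prob (@ltr01 R)).-integrable setT
    (EFin \o (fun a : R => sin (2 * pi * (m'%:~R * a)))).
  apply: (@le_integrable _ _ _ _ _ measurableT _ (EFin \o cst 1)).
  - apply/measurable_EFinP; apply: measurableT_comp.
      exact: continuous_measurable_fun (@continuous_sin R).
    by do 2 apply: measurable_funM => //.
  - by move=> x _ /=; rewrite lee_fin normr1 sin_max.
  - exact: finite_measure_integrable_cst.
split.
- rewrite (Rintegral_torusS (measurable_cs _) (@cs_le1 _ _)).
  transitivity (\int[uniform_prob (@ltr01 R)]_a (cos (2 * pi * (m%:~R * a)) * (k' == 0)%:R))%R.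
    apply: eq_Rintegral => a _.
    under eq_Rintegral => y _ do rewrite /cs /= ke mulrDr cosD.
    rewrite RintegralB//; [|exact: integrableZl (L2c (k', true))|exact: integrableZl (L2c (k', false))].
    rewrite (RintegralZl _ _ (L2c (k', true)))// (RintegralZl _ _ (L2c (k', false)))//.
    by rewrite [X in _ - _ * X]IHs [X in _ * X]IHc mulr0 subr0.
  by rewrite RintegralZr// Rintegral_cos_uniform k0 -natrM mulnb.
- rewrite (Rintegral_torusS (measurable_cs _) (@cs_le1 _ _)).
  transitivity (\int[uniform_prob (@ltr01 R)]_a (sin (2 * pi * (m%:~R * a)) * (k' == 0)%:R))%R.
    apply: eq_Rintegral => a _.
    under eq_Rintegral => y _ do rewrite /cs /= ke mulrDr sinD.
    rewrite RintegralD//; [|exact: integrableZl (L2c (k', true))|exact: integrableZl (L2c (k', false))].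
    rewrite (RintegralZl _ _ (L2c (k', true)))// (RintegralZl _ _ (L2c (k', false)))//.
    by rewrite [X in _ + _ * X]IHs [X in _ * X]IHc mulr0 addr0.
  by rewrite RintegralZr// Rintegral_sin_uniform mul0r.
Qed.

Lemma ip_cs d (p q : mode d) : ip (torus_measure R d) (cs p) (cs q) =
  (p.2 == q.2)%:R * (2^-1 * ((p.1 == q.1)%:R + par p.2 * (p.1 == - q.1)%:R)).
Proof.
have L1c (r : mode d) : (torus_measure R d).-integrable setT (EFin \o cs r).
  by apply/Lfun1_integrable; apply: Lfun_subset12; [exact: fin_num_measure|exact: Lfun2_cs].
rewrite /ip; under eq_Rintegral do rewrite csM mulrDr !mulrA.
rewrite RintegralD//; [|exact: integrableZl (L1c _)|exact: integrableZl (L1c _)].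
rewrite (RintegralZl _ _ (L1c _))// (RintegralZl _ _ (L1c _))//.
rewrite !Rintegral_cs !xpair_eqE addr_eq0 subr_eq0 /par eqb_id.
by case: p.2; case: q.2; rewrite /= ?andbF ?andbT /=; field.
Qed.

Lemma mode_eq_opp d (p q : mode d) : (p.2 == q.2) && (p.1 == - q.1) = (p == mopp q).
Proof. by case: p q => k b [l c]; rewrite /mopp xpair_eqE andbC. Qed.

End torus_trig.

(** The minimum over [t] is at [- b / c]. If [c = 0], an affine function bounded below is constant:
    the witness used would give it the value [-1]. All Cauchy-Schwarz inequalities below come from
    this. *)
Lemma quadratic_discriminant (R : realFieldType) (a b c : R) : 0 <= c ->
  (forall t, 0 <= a + 2 * t * b + t ^+ 2 * c) -> b ^+ 2 <= a * c.
Proof.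
rewrite le0r => /predU1P[->|c0] h.
  rewrite mulr0; have [->|b0] := eqVneq b 0; first by rewrite expr0n.
  have := h (- (a + 1) / (2 * b)); rewrite mulr0 addr0.
  rewrite (_ : _ + _ = -1); last by field.
  by rewrite lerNr oppr0 ler10.
have := h (- b / c).
rewrite (_ : _ + _ = (a * c - b ^+ 2) / c); last by field; rewrite gt_eqF.
by rewrite pmulr_lge0 ?invr_gt0// subr_ge0.
Qed.

Lemma ler_sum_uniq_subset (R : numDomainType) (I : eqType) (s t : seq I) (F : I -> R) :
  uniq s -> uniq t -> {subset s <= t} -> (forall i, 0 <= F i) ->
  \sum_(i <- s) F i <= \sum_(i <- t) F i.
Proof.
move=> us ut st F0; rewrite [leRHS](bigID (mem s)) /=.
have -> : \sum_(i <- t | mem s i) F i = \sum_(i <- s) F i.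
  rewrite -big_filter; apply/perm_big/uniq_perm => //; first exact: filter_uniq.
  by move=> i; rewrite mem_filter andb_idr//; exact: st.
by rewrite lerDl sumr_ge0.
Qed.

Lemma sum_uniq_subset (V : nmodType) (I : eqType) (s t : seq I) (F : I -> V) :
  uniq s -> uniq t -> {subset s <= t} -> (forall i, i \notin s -> F i = 0) ->
  \sum_(i <- t) F i = \sum_(i <- s) F i.
Proof.
move=> us ut st F0; rewrite (bigID (mem s)) /= [X in _ + X]big1 ?addr0//.
rewrite -big_filter; apply/perm_big/uniq_perm => //; first exact: filter_uniq.
by move=> i; rewrite mem_filter andb_idr//; exact: st.
Qed.

Lemma sum_delta_uniq (R : pzRingType) (I : eqType) (s : seq I) (F : I -> R) (j : I) :
  uniq s -> \sum_(i <- s) F i * (i == j)%:R = (j \in s)%:R * F j.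
Proof.
move=> us; have [js|js] := boolP (j \in s).
  rewrite (bigD1_seq j)//= eqxx mulr1 mul1r big1 ?addr0// => i /negPf ->.
  by rewrite mulr0.
rewrite mul0r big_seq big1// => i is_; case: eqP => [e|_]; last by rewrite mulr0.
by move: js; rewrite -e is_.
Qed.

(** * Bessel's inequality and the Riesz-Fischer theorem for the frame [cs] *)

Section frame.
Context (R : realType) (d : nat).
Let mu : probability (d.-tuple R) R := torus_measure R d.
Implicit Types (f g : d.-tuple R -> R) (a : mode d -> R) (p q : mode d) (ps : seq (mode d)).

Lemma ip_CS f g : f \in Lfun mu 2%:E -> g \in Lfun mu 2%:E ->
  ip mu f g ^+ 2 <= ip mu f f * ip mu g g.
Proof.
move=> f2 g2; apply: quadratic_discriminant => [|t]; first exact: ip_ge0.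
have := ip_ge0 mu (fun x => t * g x + f x).
have h2 := Lfun2_lin t g2 f2.
rewrite ip_linl// ![ip mu _ (fun x => t * g x + f x)]ipC !ip_linl// (ipC mu g f).
by congr (_ <= _); ring.
Qed.

Lemma parK b : par R b * par R b = 1.
Proof. by case: b; rewrite /par ?mulrNN mulr1. Qed.

Lemma moppK : involutive (@mopp d).
Proof. by case=> k b; rewrite /mopp opprK. Qed.

Definition hat f p : R := ip mu f (cs p).

Lemma hat_opp f p : f \in Lfun mu 2%:E -> hat f (mopp p) = par R p.2 * hat f p.
Proof.
move=> f2; rewrite /hat ![ip mu f _]ipC -ipZl//; last exact: Lfun2_cs.
by congr ip; apply/funext => x; rewrite cs_opp.
Qed.

Lemma hat_lin (c : R) f g p : f \in Lfun mu 2%:E -> g \in Lfun mu 2%:E ->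
  hat (fun x => c * f x + g x) p = c * hat f p + hat g p.
Proof. by move=> f2 g2; rewrite /hat ip_linl//; exact: Lfun2_cs. Qed.

Lemma hatB f g p : f \in Lfun mu 2%:E -> g \in Lfun mu 2%:E ->
  hat (fun x => f x - g x) p = hat f p - hat g p.
Proof. by move=> f2 g2; rewrite /hat ipBl//; exact: Lfun2_cs. Qed.

Lemma hatD f g p : f \in Lfun mu 2%:E -> g \in Lfun mu 2%:E ->
  hat (fun x => f x + g x) p = hat f p + hat g p.
Proof. by move=> f2 g2; rewrite /hat ipDl//; exact: Lfun2_cs. Qed.

Definition tpoly ps a (x : d.-tuple R) : R := \sum_(p <- ps) a p * cs p x.

Lemma Lfun2_tpoly ps a : tpoly ps a \in Lfun mu 2%:E.
Proof. by apply: Lfun2_sum => p; apply: Lfun2Z; exact: Lfun2_cs. Qed.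

(** On a set of modes stable under [k -> -k], the redundant frame behaves like an orthonormal basis,
    provided the coefficients satisfy [parity]; see [hat_tpoly]. *)
Definition msym ps := uniq ps /\ forall p, p \in ps -> mopp p \in ps.

Definition kfull (ks : seq 'rV[int]_d) : seq (mode d) :=
  [seq (k, b) | k <- ks, b <- [:: true; false]].

Definition ksym (ks : seq 'rV[int]_d) := uniq ks /\ forall k, k \in ks -> - k \in ks.

Definition kclose ps := undup (map fst ps ++ map (fun p => - p.1) ps).

Definition mclose ps := kfull (kclose ps).

Lemma mem_kfull ks p : (p \in kfull ks) = (p.1 \in ks).
Proof.
case: p => k b; apply/allpairsP/idP => [[[k' b'] /= [h _ [-> _]]]//|h].
by exists (k, b); split => //=; case: b {h}.
Qed.

Lemma kfull_sym ks : ksym ks -> msym (kfull ks).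
Proof.
move=> [us ss]; split.
  by apply: allpairs_uniq => // -[? ?] [? ?] _ _ [-> ->].
by move=> p; rewrite !mem_kfull; exact: ss.
Qed.

Lemma big_kfull ks (F : mode d -> R) :
  \sum_(p <- kfull ks) F p = \sum_(k <- ks) (F (k, true) + F (k, false)).
Proof.
rewrite /kfull big_allpairs_dep; apply: eq_bigr => k _.
by rewrite big_cons big_seq1.
Qed.

Lemma kclose_sym ps : ksym (kclose ps).
Proof.
split; first exact: undup_uniq.
move=> k; rewrite !mem_undup !mem_cat => /orP[/mapP[p pp ->]|/mapP[p pp ->]].
  by apply/orP; right; apply/mapP; exists p.
by rewrite opprK; apply/orP; left; apply/mapP; exists p.
Qed.

Lemma mclose_sym ps : msym (mclose ps).
Proof. exact/kfull_sym/kclose_sym. Qed.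

Lemma sub_mclose ps : {subset ps <= mclose ps}.
Proof. by move=> p h; rewrite mem_kfull mem_undup mem_cat map_f. Qed.

Lemma mclose_mono ps qs : {subset ps <= qs} -> {subset mclose ps <= mclose qs}.
Proof.
move=> h p; rewrite !mem_kfull !mem_undup !mem_cat.
by move=> /orP[] /mapP[q /h qs' e]; apply/orP; [left|right]; apply/mapP; exists q.
Qed.

Lemma ip_tpoly f ps a : f \in Lfun mu 2%:E ->
  ip mu f (tpoly ps a) = \sum_(p <- ps) a p * hat f p.
Proof.
move=> f2; rewrite /tpoly ip_sumr//; last by move=> p; apply: Lfun2Z; exact: Lfun2_cs.
by apply: eq_bigr => p _; rewrite ipC ipZl ?(ipC mu (cs p))//; exact: Lfun2_cs.
Qed.

(** The constraint that redundancy imposes on coefficients: every family [hat f] satisfies it, and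
    [riesz_fischer] realizes any square-summable family that does. *)
Definition parity a := forall p, a (mopp p) = par R p.2 * a p.

(** By [ip_cs], the mode [q] picks up half of its coefficient from itself and half from its
    opposite; parity makes the two halves equal. For [k = 0] both halves come from the same mode. *)
Lemma hat_tpoly ps a q : msym ps -> parity a ->
  hat (tpoly ps a) q = (q \in ps)%:R * a q.
Proof.
move=> [us ss] pa; rewrite /hat ipC ip_tpoly; last exact: Lfun2_cs.
have mq : (mopp q \in ps) = (q \in ps).
  by apply/idP/idP => /ss; rewrite ?moppK.
transitivity (2^-1 * \sum_(p <- ps) a p * (p == q)%:R +
              2^-1 * \sum_(p <- ps) (a p * par R p.2) * (p == mopp q)%:R).
  rewrite !mulr_sumr -big_split /=; apply: eq_bigr => p _.
  rewrite /hat ip_cs -mode_eq_opp.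
  have -> : (p == q) = (q.2 == p.2) && (q.1 == p.1).
    by case: p q {mq} => k b [l c]; rewrite xpair_eqE andbC eq_sym [l == _]eq_sym.
  have -> : (p.2 == q.2) && (p.1 == - q.1) = (q.2 == p.2) && (q.1 == - p.1).
    by congr (_ && _); [exact: eq_sym | rewrite eq_sym eqr_oppLR].
  case: eqP => [->|_] /=; last by ring.
  by ring.
rewrite !sum_delta_uniq// mq /= pa mulrAC parK mul1r.
by field.
Qed.

Lemma tpoly_norm ps a : msym ps -> parity a ->
  ip mu (tpoly ps a) (tpoly ps a) = \sum_(p <- ps) a p ^+ 2.
Proof.
move=> ss pa; rewrite ip_tpoly; last exact: Lfun2_tpoly.
by rewrite !big_seq; apply: eq_bigr => p pp; rewrite hat_tpoly// pp mul1r expr2.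
Qed.

Lemma hat_parity f : f \in Lfun mu 2%:E -> parity (hat f).
Proof. by move=> f2 p; exact: hat_opp. Qed.

(** Pythagoras: the Fourier sum over a symmetric set is an orthogonal projection of [f]. *)
Lemma parseval_defect f ps : f \in Lfun mu 2%:E -> msym ps ->
  ip mu (fun x => tpoly ps (hat f) x - f x) (fun x => tpoly ps (hat f) x - f x) =
  ip mu f f - \sum_(p <- ps) hat f p ^+ 2.
Proof.
move=> f2 ss; have t2 := Lfun2_tpoly ps (hat f).
have d2 := Lfun2B t2 f2.
rewrite ipBl// ![ip mu _ (fun x => tpoly _ _ x - _)]ipC !ipBl//.
rewrite (ipC mu (tpoly _ _) f) (ip_tpoly _ _ f2) tpoly_norm//; last exact: hat_parity.
under [X in _ - X - _]eq_bigr do rewrite -expr2.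
under [X in _ - (X - _)]eq_bigr do rewrite -expr2.
by ring.
Qed.

(** Passing to the symmetric closure only adds nonnegative terms, and there the defect is the square
    of a norm. *)
Lemma bessel f ps : f \in Lfun mu 2%:E -> uniq ps ->
  \sum_(p <- ps) hat f p ^+ 2 <= ip mu f f.
Proof.
move=> f2 us; apply: (@le_trans _ _ (\sum_(p <- mclose ps) hat f p ^+ 2)).
  by apply: ler_sum_uniq_subset => //; [case: (mclose_sym ps)|exact: sub_mclose|move=> p; exact: sqr_ge0].
have := ip_ge0 mu (fun x => tpoly (mclose ps) (hat f) x - f x).
by rewrite (parseval_defect f2 (mclose_sym ps)) subr_ge0.
Qed.

(** Modes are countable: closing the first [n] codes under opposites gives an increasing sequence of
    symmetric finite sets that reaches every mode. *)
Definition exhaust (n : nat) := mclose (pmap (@unpickle (mode d)) (iota 0 n)).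

Lemma exhaust_sym n : msym (exhaust n). Proof. exact: mclose_sym. Qed.

Lemma exhaust_sub m n : (m <= n)%N -> {subset exhaust m <= exhaust n}.
Proof.
move=> mn; apply: mclose_mono => q.
rewrite !mem_pmap => /mapP[j]; rewrite mem_iota => /andP[_ jm] ->.
by apply: map_f; rewrite mem_iota add0n; apply: leq_trans jm mn.
Qed.

Lemma exhaust_mem p n : (pickle p < n)%N -> p \in exhaust n.
Proof.
move=> pn; apply: sub_mclose; rewrite mem_pmap -[Some p]pickleK.
by apply: map_f; rewrite mem_iota.
Qed.

Lemma riesz_fischer a (M : R) : parity a ->
  (forall ps, uniq ps -> \sum_(p <- ps) a p ^+ 2 <= M) ->
  exists g, [/\ g \in Lfun mu 2%:E, forall p, hat g p = a p
    & forall e, 0 < e -> exists N : nat, forall n, (N <= n)%N ->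
      ip mu (fun x => tpoly (exhaust n) a x - g x)
            (fun x => tpoly (exhaust n) a x - g x) <= e].
Proof.
move=> pa aM; pose s n := \sum_(p <- exhaust n) a p ^+ 2.
have t2 n := Lfun2_tpoly (exhaust n) a.
have eu n := proj1 (exhaust_sym n).
have sm m n : (m <= n)%N -> s m <= s n.
  move=> mn; apply: ler_sum_uniq_subset => //; first exact: exhaust_sub.
  by move=> p; exact: sqr_ge0.
(* Differences of partial sums have squared norm [s n - s m], so convergence of the bounded monotone
   sequence [s] makes them Cauchy in L2. *)
have nT m n : (m <= n)%N ->
    ip mu (fun x => tpoly (exhaust n) a x - tpoly (exhaust m) a x)
          (fun x => tpoly (exhaust n) a x - tpoly (exhaust m) a x) = s n - s m.
  move=> mn; have d2 := Lfun2B (t2 n) (t2 m).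
  have cr : ip mu (tpoly (exhaust n) a) (tpoly (exhaust m) a) = s m.
    rewrite ip_tpoly// /s !big_seq; apply: eq_bigr => p pp.
    by rewrite hat_tpoly ?(exhaust_sub mn)// ?mul1r ?expr2//; exact: exhaust_sym.
  rewrite ipBl// ![ip mu _ (fun x => tpoly _ _ x - _)]ipC !ipBl//.
  rewrite (ipC mu (tpoly (exhaust m) a) (tpoly (exhaust n) a)) cr !tpoly_norm//;
    try exact: exhaust_sym.
  by rewrite -/(s m) -/(s n); ring.
have cs_ : cvgn s.
  apply: nondecreasing_is_cvgn; first by move=> m n; exact: sm.
  by exists M => _ [n _ <-]; exact: aM.
have sC e : 0 < e -> exists N : nat, forall n m, (N <= n)%N -> (N <= m)%N -> `|s n - s m| <= e.
  move=> e0; move/cvgrPdist_le : cs_ => /(_ (e / 2) (divr_gt0 e0 (ltr0Sn _ 1))) [N _ NP].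
  exists N => n m Nn Nm; have h1 := NP _ Nn; have h2 := NP _ Nm.
  rewrite (splitr e) (le_trans _ (lerD h2 h1))//.
  rewrite (_ : s n - s m = (limn s - s m) - (limn s - s n)); last by ring.
  exact: ler_normB.
have [g g2 gP] : exists2 g, g \in Lfun mu 2%:E & forall e, 0 < e -> exists N : nat,
    forall n, (N <= n)%N -> ip mu (fun x => tpoly (exhaust n) a x - g x)
      (fun x => tpoly (exhaust n) a x - g x) <= e.
  apply: L2_complete => // e e0; have [N NP] := sC e e0; exists N => n m Nn Nm.
  case: (leqP m n) => [mn|/ltnW nm].
    by rewrite nT//; apply: le_trans (NP _ _ Nn Nm); exact: ler_norm.
  apply: le_trans (NP _ _ Nm Nn); apply: le_trans (ler_norm _); rewrite -nT// le_eqVlt.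
  by apply/orP; left; apply/eqP; apply: eq_Rintegral => x _; ring.
(* Coefficients are continuous for the L2 norm because [cs p] has norm at most 1, and those of the
   partial sums are eventually exactly [a p]. *)
have hg p : hat g p = a p.
  apply/eqP; rewrite -subr_eq0 -normr_le0; apply/ler_addgt0Pr => e e0; rewrite add0r distrC.
  have [N NP] := gP (e ^+ 2) (exprn_gt0 _ e0).
  pose n := maxn N (pickle p).+1.
  have pn : p \in exhaust n by apply: exhaust_mem; exact: leq_maxr.
  have d2 := Lfun2B (t2 n) g2.
  have <- : hat (fun x => tpoly (exhaust n) a x - g x) p = a p - hat g p.
    by rewrite hatB// hat_tpoly ?pn ?mul1r//; exact: exhaust_sym.
  rewrite -(@ler_pXn2r _ 2) ?nnegrE ?(ltW e0)// real_normK ?num_real//.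
  have c1 : ip mu (cs p) (cs p) <= 1.
    rewrite ip_cs !eqxx mul1r /par; case: p.2; case: eqP => _ /=; lra.
  apply: le_trans (ip_CS d2 (Lfun2_cs R p)) _.
  apply: le_trans (ler_wpM2l (ip_ge0 _ _) c1) _.
  by rewrite mulr1; apply: NP; exact: leq_maxl.
by exists g.
Qed.

End frame.

(** * Lattice sums *)

Section lattice_sum.
Context (R : realType).

(* The integral test in discrete form: the right-hand side is the integral of
   (1 + y / N)^(-b) over [x, x+1]. *)
Lemma powR_telescope (b N x : R) : 1 < b -> 0 < N -> 0 <= x ->
  (1 + (x + 1) / N) `^ (- b) <=
  N / (b - 1) * ((1 + x / N) `^ (1 - b) - (1 + (x + 1) / N) `^ (1 - b)).
Proof.
move=> b1 N0 x0.
set u := 1 + x / N; set v := 1 + (x + 1) / N.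
have u0 : 0 < u by rewrite /u ltr_pwDl// divr_ge0// ltW.
have vu : v = u + N^-1 by rewrite /u /v mulrDl addrA mul1r.
have v0 : 0 < v by rewrite vu addr_gt0// invr_gt0.
have e1 : v `^ (- b) = v `^ (1 - b) / v.
  by rewrite powRD ?(gt_eqF v0) ?implybT// powRr1 ?ltW// powRN mulrAC mulfV ?gt_eqF// mul1r.
have e2 : u `^ (1 - b) = v `^ (1 - b) * expR ((b - 1) * (ln v - ln u)).
  rewrite /powR !gt_eqF// -expRD; congr expR; ring.
rewrite e1 e2 -[X in _ * (_ - X)]mulr1 -mulrBr mulrCA.
apply: ler_wpM2l; first exact: powR_ge0.
(* Tangent-line bounds do the work of the integral: [expR y >= 1 + y] here, and
   [ln (u / v) <= u / v - 1] next, bound the difference of powers below by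
   [v ^ (1 - b) * (b - 1) / (N * v)]. *)
have h : 1 + (b - 1) * (ln v - ln u) <= expR ((b - 1) * (ln v - ln u)) by exact: expR_ge1Dx.
have h2 : ln v - ln u >= N^-1 / v.
  rewrite -lerN2 opprB -ln_div ?posrE//.
  apply: (@le_trans _ _ (u / v - 1)).
    have := @le_ln1Dx _ (u / v - 1); have -> : 1 + (u / v - 1) = u / v by ring.
    apply.
    by rewrite ltrBrDr addNr divr_gt0.
  rewrite le_eqVlt; apply/orP; left; apply/eqP.
  have -> : u = v - N^-1 by rewrite vu addrK.
  by field; rewrite !gt_eqF.
have b10 : 0 < b - 1 by rewrite subr_gt0.
rewrite -ler_pdivrMl ?divr_gt0//.
apply: (@le_trans _ _ ((b - 1) * (N^-1 / v))).
  rewrite le_eqVlt; apply/orP; left; apply/eqP; field.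
  by rewrite !gt_eqF.
apply: (@le_trans _ _ ((b - 1) * (ln v - ln u))); first by rewrite ler_pM2l.
lra.
Qed.

Lemma sum_powR_le (b N : R) (n : nat) : 1 < b -> 0 < N ->
  \sum_(j < n) (1 + j.+1%:R / N) `^ (- b) <= N / (b - 1).
Proof.
move=> b1 N0; have c0 : 0 <= N / (b - 1) by rewrite divr_ge0 ?ltW// subr_gt0.
apply: (@le_trans _ _ (N / (b - 1) * (1 - (1 + n%:R / N) `^ (1 - b)))).
  elim: n => [|n ih]; first by rewrite big_ord0 mul0r addr0 powR1 subrr mulr0.
  rewrite big_ord_recr /=; apply: (le_trans (lerD ih _)).
    by rewrite -natr1; apply: powR_telescope.
  by rewrite -natr1 -mulrDr; apply: ler_wpM2l => //; lra.
rewrite -[leRHS]mulr1 ler_wpM2l// lerBlDr lerDl; exact: powR_ge0.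
Qed.

Lemma sum_powR_box (b N : R) (n : nat) : 1 < b -> 0 < N ->
  \sum_(j < n + n.+1) (1 + `|j%:Z - n%:Z|%:~R / N) `^ (- b) <= 1 + 2 * (N / (b - 1)).
Proof.
move=> b1 N0; rewrite big_split_ord /= big_ord_recl /=.
have e1 : \sum_(i < n) (1 + `|i%:Z - n%:Z|%:~R / N) `^ (- b) =
          \sum_(j < n) (1 + j.+1%:R / N) `^ (- b).
  rewrite (reindex_inj rev_ord_inj); apply: eq_bigr => i _ /=.
  congr ((1 + _ / N) `^ _); rewrite -[RHS]/(i.+1%:Z%:~R); congr (_%:~R).
  by have := ltn_ord i; lia.
have e2 : \sum_(i < n) (1 + `|(n + bump 0 i)%:Z - n%:Z|%:~R / N) `^ (- b) =
          \sum_(j < n) (1 + j.+1%:R / N) `^ (- b).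
  apply: eq_bigr => i _; congr ((1 + _ / N) `^ _).
  by rewrite -[RHS]/(i.+1%:Z%:~R); congr (_%:~R); rewrite /bump; lia.
rewrite e1 e2 addn0 subrr normr0 mul0r addr0 powR1.
have := sum_powR_le n b1 N0; lra.
Qed.

End lattice_sum.

Section torus_lattice_sum.
Context (R : realType) (d : nat).
Implicit Types (k : 'rV[int]_d).

(** The symbol of [(-Delta)^(1/2)] at the frequency [k]. *)
Definition kap k : R := 2 * pi * kabs R k.

Lemma kap_ge0 k : 0 <= kap k.
Proof. by rewrite !mulr_ge0 ?pi_ge0// /kabs sqrtr_ge0. Qed.

Lemma kap_ge k i : `|k 0 i|%:~R <= kap k.
Proof.
have h : `|k 0 i|%:~R <= kabs R k.
  rewrite /kabs -[leLHS]ger0_norm ?ler0z// -sqrtr_sqr ler_wsqrtr//.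
  rewrite intr_norm real_normK ?num_real//.
  by rewrite (bigD1 i)//= lerDl sumr_ge0// => j _; exact: sqr_ge0.
apply: le_trans h _; rewrite ler_peMl ?sqrtr_ge0//.
by have := pi_ge2 R; lra.
Qed.

Definition wt (alpha N : R) k : R := 1 + (kap k / N) `^ (2 * alpha).

Lemma wt_ge1 alpha N k : 1 <= wt alpha N k.
Proof. by rewrite /wt lerDl powR_ge0. Qed.

Lemma powR_1D_le (x s : R) : 0 <= x -> 0 <= s ->
  (1 + x) `^ s <= 2 `^ s * (1 + x `^ s).
Proof.
move=> x0 s0; have [x1|x1] := leP x 1.
  apply: (@le_trans _ _ (2 `^ s)).
    by rewrite ge0_ler_powR ?nnegrE//; lra.
  by rewrite ler_peMr ?powR_ge0// lerDl powR_ge0.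
apply: (@le_trans _ _ ((2 * x) `^ s)).
  by rewrite ge0_ler_powR ?nnegrE//; lra.
rewrite powRM//; apply: ler_wpM2l; first exact: powR_ge0.
by rewrite lerDr.
Qed.

Lemma powR_prod (I : finType) (x s : R) : 0 <= x -> (0 < #|I|)%N ->
  x `^ s = \prod_(i : I) x `^ (s / #|I|%:R).
Proof.
move=> x0 I0; rewrite prodr_const -powR_mulrn ?powR_ge0// -powRrM.
by rewrite mulfVK// pnatr_eq0 -lt0n.
Qed.

(** The power [(1 + kap k / N) ^ (4 alpha)] is split into [d] equal factors, and in the [i]-th one
    [kap k] is bounded below by [|k_i|]. The lattice sum thereby factors into one-dimensional sums
    with exponent [4 alpha / d]. *)
Lemma wt_inv_le alpha N k : (0 < d)%N -> 0 < alpha -> 0 < N ->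
  (wt alpha N k) ^- 2 <= 2 `^ (4 * alpha) *
    \prod_(i < d) (1 + `|k 0 i|%:~R / N) `^ (- (4 * alpha / d%:R)).
Proof.
move=> d0 a0 N0; set x := kap k / N.
have x0 : 0 <= x by rewrite divr_ge0 ?kap_ge0 ?ltW.
have w0 : 0 < wt alpha N k by apply: lt_le_trans (wt_ge1 _ _ _).
have h1 : (1 + x) `^ (4 * alpha) <= 2 `^ (4 * alpha) * wt alpha N k ^+ 2.
  have e : 4 * alpha = 2 * alpha * 2%:R by ring.
  rewrite e !(powRrM _ (2 * alpha) 2%:R) !powR_mulrn ?powR_ge0// -exprMn.
  rewrite ler_pXn2r ?nnegrE ?mulr_ge0 ?powR_ge0 ?(ltW w0)//.
  by rewrite /wt -/x; apply: powR_1D_le => //; rewrite mulr_ge0 ?ltW.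
have h2 : (1 + x) `^ (4 * alpha) >= \prod_(i < d) (1 + `|k 0 i|%:~R / N) `^ (4 * alpha / d%:R).
  rewrite (@powR_prod 'I_d) ?card_ord ?addr_ge0//.
  apply: ler_prod => i _; rewrite powR_ge0 ge0_ler_powR ?nnegrE ?addr_ge0//.
  - by rewrite divr_ge0 ?ler0n// mulr_ge0 ?ltW.
  - by rewrite divr_ge0 ?ler0z ?(ltW N0).
  - by rewrite lerD2l ler_pM2r ?invr_gt0// kap_ge.
have p0 : 0 < \prod_(i < d) (1 + `|k 0 i|%:~R / N) `^ (4 * alpha / d%:R).
  by apply: prodr_gt0 => i _; apply: powR_gt0; rewrite ltr_pwDl// divr_ge0 ?ler0z ?(ltW N0).
under eq_bigr do rewrite powRN.
rewrite prodfV ler_pdivlMr// mulrC ler_pdivrMr ?exprn_gt0//.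
exact: le_trans h2 h1.
Qed.

(** The frequencies are enclosed in the box of side [2n + 1] centred at 0, over which a sum of
    products is a product of sums. *)
Lemma sum_prod_box (n : nat) (g : int -> R) (ks : seq 'rV[int]_d) : uniq ks ->
  (forall k i, k \in ks -> `|k 0 i| <= n%:Z) -> (forall m, 0 <= g m) ->
  \sum_(k <- ks) \prod_(i < d) g (k 0 i) <=
  (\sum_(j < n + n.+1) g (j%:Z - n%:Z)) ^+ d.
Proof.
move=> us kn g0.
pose row (f : {ffun 'I_d -> 'I_(n + n.+1)}) : 'rV[int]_d := \row_i ((f i)%:Z - n%:Z).
have irow : injective row.
  move=> f g' /rowP fg; apply/ffunP => i; apply/val_inj; have := fg i; rewrite !mxE /=; lia.
apply: (@le_trans _ _ (\sum_(k <- map row (enum {ffun 'I_d -> 'I_(n + n.+1)})) \prod_(i < d) g (k 0 i))).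
  apply: ler_sum_uniq_subset => //.
  - by rewrite map_inj_uniq ?enum_uniq.
  - move=> k /kn kk; apply/mapP.
    have lt i : (`|(k 0 i + n%:Z)%R|%N < n + n.+1)%N by move: (k 0 i : int) (kk i) => m; lia.
    exists [ffun i => Ordinal (lt i)]; first by rewrite mem_enum.
    by apply/rowP => i; rewrite !mxE ffunE /=; move: (k 0 i : int) (kk i) => m; lia.
  - by move=> k; apply: prodr_ge0.
rewrite big_map big_enum /= -[X in _ <= X ^+ _]big_enum.
rewrite le_eqVlt; apply/orP; left; apply/eqP.
transitivity (\sum_(f : {ffun 'I_d -> 'I_(n + n.+1)}) \prod_(i < d) g ((f i)%:Z - n%:Z)).
  by apply: eq_bigr => f _; apply: eq_bigr => i _; rewrite mxE.
rewrite -(bigA_distr_bigA (fun (i : 'I_d) (j : 'I_(n + n.+1)) => g (j%:Z - n%:Z))).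
by rewrite prodr_const card_ord big_enum.
Qed.

Lemma lattice_sum alpha : (0 < d)%N -> d%:R < 4 * alpha ->
  exists2 S : R, 0 < S & forall N, 1 <= N -> forall ps : seq (mode d), uniq ps ->
    \sum_(p <- ps) (wt alpha N p.1) ^- 2 <= S * N ^+ d.
Proof.
move=> d0 da; pose b := 4 * alpha / d%:R.
have dR : 0 < d%:R :> R by rewrite ltr0n.
have b1 : 1 < b by rewrite /b ltr_pdivlMr// mul1r.
have a0 : 0 < alpha by lra.
(* With [N >= 1], the one-dimensional bound [1 + 2 * N / (b - 1)] is at most [c * N]: the term at
   frequency 0 is absorbed. *)
pose c := 1 + 2 / (b - 1).
have c0 : 0 < c by rewrite /c addr_gt0// divr_gt0// subr_gt0.
have p40 : 0 < 2 `^ (4 * alpha) :> R by rewrite powR_gt0.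
have H N ks : 1 <= N -> uniq ks ->
    \sum_(k <- ks) (wt alpha N k) ^- 2 <= 2 `^ (4 * alpha) * (c * N) ^+ d.
  move=> N1 us; have N0 : 0 < N by apply: lt_le_trans N1.
  have [n nP] : exists n : nat, forall k i, k \in ks -> `|k 0 i| <= n%:Z.
    exists (\max_(k <- ks) \max_(i < d) `|(k 0 i)%R|%N)%N => k i kk.
    have h1 := leq_bigmax_seq (F := fun k => (\max_(i < d) `|(k 0 i)%R|%N)%N) _ kk isT.
    have h2 := @leq_bigmax _ (fun i => `|(k 0 i)%R|%N) i.
    by rewrite -abszE lez_nat; exact: leq_trans h2 h1.
  pose g (m : int) : R := (1 + `|m|%:~R / N) `^ (- b).
  have g0 m : 0 <= g m by exact: powR_ge0.
  apply: (@le_trans _ _ (\sum_(k <- ks) 2 `^ (4 * alpha) * \prod_(i < d) g (k 0 i))).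
    by apply: ler_sum => k _; exact: wt_inv_le.
  rewrite -mulr_sumr ler_pM2l//; apply: le_trans (sum_prod_box us nP g0) _.
  apply: lerXn2r; rewrite ?nnegrE ?sumr_ge0//.
  - by rewrite mulr_ge0 ?ltW.
  - apply: le_trans (sum_powR_box n b1 N0) _.
    rewrite (_ : c * N = N + 2 * (N / (b - 1))); last by rewrite /c; ring.
    by rewrite lerD2r.
(* The leading factor 2 counts the cosine and the sine mode of each frequency. *)
exists (2 * (2 `^ (4 * alpha) * c ^+ d)); first by rewrite !mulr_gt0 ?exprn_gt0.
move=> N N1 ps us; rewrite (bigID (fun p : mode d => p.2)) /=.
rewrite -mulrA mulr2n mulrDl mul1r -mulrA -exprMn.
have Hb (P : pred (mode d)) : (forall p q, P p -> P q -> p.2 = q.2) ->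
    \sum_(p <- ps | P p) (wt alpha N p.1) ^- 2 <= 2 `^ (4 * alpha) * (c * N) ^+ d.
  move=> Pp; rewrite -big_filter -(big_map fst predT (fun k => (wt alpha N k) ^- 2)).
  apply: H => //; rewrite map_inj_in_uniq ?filter_uniq// => p q.
  rewrite !mem_filter => /andP[p1 _] /andP[q1 _] e.
  by have := Pp _ _ p1 q1; case: p q e {p1 q1} => ? ? [? ?] /= -> ->.
apply: lerD; apply: Hb; first by move=> p q -> ->.
by move=> p q /negbTE -> /negbTE ->.
Qed.

End torus_lattice_sum.

(** * Square-integrable vector fields and the Leray projector *)

HB.lock Definition nrm (R : realType) (d : nat) (g : field R d) : R :=
  Num.sqrt (inner g g).

Section field_space.
Context (R : realType) (d : nat).
Let mu : probability (d.-tuple R) R := torus_measure R d.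
Implicit Types (f g h : field R d) (a : 'I_d -> mode d -> R) (p q : mode d) (ps : seq (mode d)).

Lemma innerE f g : L2 f -> L2 g -> inner f g = \sum_(i < d) ip mu (f i) (g i).
Proof.
move=> f2 g2; rewrite /inner /Rintegral.
under eq_integral do rewrite -sumEFin.
rewrite integral_sum//; last by move=> i; exact: (@Lfun2_intM _ _ _ mu).
rewrite -sum_fine// => i _; apply: integrable_fin_num => //.
exact: (@Lfun2_intM _ _ _ mu).
Qed.

Lemma L2_0 : L2 (0 : field R d).
Proof. by move=> i; exact: (Lfun2_cst0 mu). Qed.

Lemma L2_lin (c : R) f g : L2 f -> L2 g -> L2 (c *: f + g).
Proof. by move=> f2 g2 i; exact: (@Lfun2_lin _ _ _ mu c _ _ (f2 i) (g2 i)). Qed.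

Lemma L2D f g : L2 f -> L2 g -> L2 (f + g).
Proof. by move=> f2 g2; rewrite -[f]scale1r; exact: L2_lin. Qed.

Lemma L2Z (c : R) f : L2 f -> L2 (c *: f).
Proof. by move=> f2; rewrite -[_ *: _]addr0; apply: L2_lin => //; exact: L2_0. Qed.

Lemma L2N f : L2 f -> L2 (- f).
Proof. by move=> f2; rewrite -scaleN1r; exact: L2Z. Qed.

Lemma L2B f g : L2 f -> L2 g -> L2 (f - g).
Proof. by move=> f2 g2; apply: L2D => //; exact: L2N. Qed.

Lemma innerC f g : inner f g = inner g f.
Proof. by apply: eq_Rintegral => x _; apply: eq_bigr => i _; rewrite mulrC. Qed.

Lemma inner_lin (c : R) f g h : L2 f -> L2 g -> L2 h ->
  inner (c *: f + g) h = c * inner f h + inner g h.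
Proof.
move=> f2 g2 h2; rewrite !innerE//; last exact: L2_lin.
rewrite mulr_sumr -big_split; apply: eq_bigr => i _.
exact: ip_linl (f2 i) (g2 i) (h2 i).
Qed.

Lemma inner0l h : inner 0 h = 0.
Proof.
transitivity (\int[mu]_(x in setT) (0 : R))%R; last by rewrite Rintegral_cst// mul0r.
by apply: eq_Rintegral => x _; rewrite big1// => i _; rewrite mul0r.
Qed.

Lemma innerDl f g h : L2 f -> L2 g -> L2 h -> inner (f + g) h = inner f h + inner g h.
Proof. by move=> f2 g2 h2; rewrite -{1}[f]scale1r inner_lin// mul1r. Qed.

Lemma innerZl (c : R) f h : L2 f -> L2 h -> inner (c *: f) h = c * inner f h.
Proof.
by move=> f2 h2; rewrite -[_ *: _]addr0 inner_lin//; [rewrite inner0l addr0|exact: L2_0].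
Qed.

Lemma innerBl f g h : L2 f -> L2 g -> L2 h -> inner (f - g) h = inner f h - inner g h.
Proof.
move=> f2 g2 h2; rewrite innerDl//; last exact: L2N.
by rewrite -scaleN1r innerZl// mulN1r.
Qed.

Lemma innerDr f g h : L2 f -> L2 g -> L2 h -> inner h (f + g) = inner h f + inner h g.
Proof. by move=> *; rewrite innerC innerDl// !(innerC h). Qed.

Lemma innerZr (c : R) f h : L2 f -> L2 h -> inner h (c *: f) = c * inner h f.
Proof. by move=> *; rewrite innerC innerZl// (innerC h). Qed.

Lemma innerBr f g h : L2 f -> L2 g -> L2 h -> inner h (f - g) = inner h f - inner h g.
Proof. by move=> *; rewrite innerC innerBl// !(innerC h). Qed.

Lemma inner_ge0 f : 0 <= inner f f.
Proof.
by apply: Rintegral_ge0 => x _; apply: sumr_ge0 => i _; rewrite -expr2 sqr_ge0.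
Qed.

Lemma nrm_ge0 f : 0 <= nrm f. Proof. by rewrite nrm.unlock sqrtr_ge0. Qed.

Lemma sqr_nrm f : nrm f ^+ 2 = inner f f.
Proof. by rewrite nrm.unlock sqr_sqrtr// inner_ge0. Qed.

Lemma L2normE g : L2 g -> L2norm g = (nrm g)%:E.
Proof.
move=> g2; rewrite /L2norm.
have -> : (\int[torus_measure R d]_x (\sum_(i < d) g i x ^+ 2)%:E)%E = (inner g g)%:E.
  rewrite /inner /Rintegral fineK.
    by apply: eq_integral => x _; congr EFin; apply: eq_bigr => i _; rewrite expr2.
  apply: integrable_fin_num => //.
  have : mu.-integrable setT (fun x => \sum_(i < d) (g i x * g i x)%:E)%E.
    by apply: integrable_sum => // i _; exact: (@Lfun2_intM _ _ _ mu).
  by apply: eq_integrable => // x _; rewrite sumEFin.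
by rewrite poweR_EFin powR12_sqrt ?inner_ge0// nrm.unlock.
Qed.

Lemma inner_CS2 f g : L2 f -> L2 g -> inner f g ^+ 2 <= inner f f * inner g g.
Proof.
move=> f2 g2; apply: quadratic_discriminant => [|t]; first exact: inner_ge0.
have := inner_ge0 (t *: g + f); have h2 := L2_lin t g2 f2.
rewrite inner_lin// !(innerC _ (t *: g + f)) !inner_lin// (innerC g f).
by congr (_ <= _); ring.
Qed.

Lemma inner_CS f g : L2 f -> L2 g -> `|inner f g| <= nrm f * nrm g.
Proof.
move=> f2 g2; rewrite -(@ler_pXn2r _ 2) ?nnegrE ?mulr_ge0 ?nrm_ge0//.
by rewrite real_normK ?num_real// exprMn !sqr_nrm inner_CS2.
Qed.

Lemma nrmD f g : L2 f -> L2 g -> nrm (f + g) <= nrm f + nrm g.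
Proof.
move=> f2 g2; rewrite -(@ler_pXn2r _ 2) ?nnegrE ?addr_ge0 ?nrm_ge0//.
rewrite sqr_nrm innerDl// ?innerDr//; try exact: L2D.
rewrite sqrrD !sqr_nrm (innerC g f).
have := le_trans (ler_norm _) (inner_CS f2 g2); lra.
Qed.

Lemma nrmZ (c : R) f : L2 f -> nrm (c *: f) = `|c| * nrm f.
Proof.
move=> f2; rewrite nrm.unlock innerZl// ?innerZr//; last exact: L2Z.
by rewrite mulrA -expr2 sqrtrM ?sqr_ge0// sqrtr_sqr.
Qed.

Lemma nrmN f : L2 f -> nrm (- f) = nrm f.
Proof. by move=> f2; rewrite -scaleN1r nrmZ// normrN1 mul1r. Qed.

Lemma nrmB f g : L2 f -> L2 g -> nrm (f - g) <= nrm f + nrm g.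
Proof. by move=> f2 g2; rewrite -(nrmN g2); apply: nrmD => //; exact: L2N. Qed.

Lemma nrmBC f g : L2 f -> L2 g -> nrm (f - g) = nrm (g - f).
Proof. by move=> f2 g2; rewrite -opprB nrmN//; exact: L2B. Qed.

Lemma nrm_triangle f g h : L2 f -> L2 g -> L2 h -> nrm (f - h) <= nrm (f - g) + nrm (g - h).
Proof. by move=> f2 g2 h2; rewrite -(subrKA g); apply: nrmD; exact: L2B. Qed.

(** Needed for time derivatives: of these fields only their almost-everywhere equality with the
    other terms of the equation is known. *)
Lemma inner_aeq f g h : aeq f g -> inner f h = inner g h.
Proof.
move=> fg; apply: (@ae_eq_Rintegral _ _ _ mu).
have : {ae mu, forall x, forall i, f i x = g i x}.
  have H : \forall x \near almost_everywhere mu, forall i, i \in enum 'I_d -> f i x = g i x.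
    elim: (enum 'I_d) => [|j s ih]; first by apply: nearW.
    move: (fg j) ih; apply: filterS2 => x e1 e2 i.
    by rewrite inE => /orP[/eqP ->//|]; exact: e2.
  by apply: filterS H => x e i; apply: e; rewrite mem_enum.
by apply: filterS => x e; apply: eq_bigr => i _; rewrite e.
Qed.

Lemma field_complete (f : nat -> field R d) : (forall n, L2 (f n)) ->
  (forall e, 0 < e -> exists N : nat, forall n m, (N <= n)%N -> (N <= m)%N ->
    nrm (f n - f m) <= e) ->
  exists2 g, L2 g & forall e, 0 < e -> exists N : nat,
    forall n, (N <= n)%N -> nrm (f n - g) <= e.
Proof.
move=> f2 fC.
have ip_le (u : field R d) i : L2 u -> ip mu (u i) (u i) <= nrm u ^+ 2.
  move=> u2; rewrite sqr_nrm innerE// (bigD1 i)//= lerDl sumr_ge0// => j _.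
  exact: ip_ge0.
have H i : exists g : d.-tuple R -> R, g \in Lfun mu 2%:E /\ forall e, 0 < e ->
    exists N : nat, forall n, (N <= n)%N ->
      ip mu (fun x => f n i x - g x) (fun x => f n i x - g x) <= e.
  have [||g g2 gP] := @L2_complete _ _ _ mu (fun n => f n i).
  - by move=> n; exact: f2.
  - move=> e e0; have [N NP] := fC (Num.sqrt e) ltac:(by rewrite sqrtr_gt0).
    exists N => n m Nn Nm; apply: (le_trans (ip_le _ i (L2B (f2 n) (f2 m)))).
    by rewrite -[leRHS]sqr_sqrtr ?(ltW e0)// lerXn2r ?nnegrE ?nrm_ge0 ?sqrtr_ge0// NP.
  - by exists g.
have [g gP] := choice H.
have g2 : L2 g by move=> i; have [] := gP i.
exists g => // e e0; have [d0|d0] := posnP d.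
  exists 0%N => n _; rewrite nrm.unlock innerE; try exact: L2B.
  rewrite big1 ?sqrtr0 ?(ltW e0)// => i _; exfalso; by have := ltn_ord i;
    rewrite [X in (_ < X)%N]d0.
have e0' : 0 < e ^+ 2 / d%:R by rewrite divr_gt0 ?exprn_gt0 ?ltr0n.
have /choice[N NP] i := (gP i).2 _ e0'.
exists (\max_(i < d) N i)%N => n Nn.
rewrite -(@ler_pXn2r _ 2) ?nnegrE ?nrm_ge0 ?(ltW e0)// sqr_nrm innerE; try exact: L2B.
apply: (@le_trans _ _ (\sum_(i < d) e ^+ 2 / d%:R)).
  by apply: ler_sum => i _; apply: NP; apply: leq_trans Nn; exact: leq_bigmax.
by rewrite sumr_const card_ord -[leLHS]mulr_natr mulfVK// pnatr_eq0 -lt0n.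
Qed.

End field_space.

(** * Fourier coefficients of vector fields and the homogeneous norms *)

Section Vnorm.
Context (R : realType) (d : nat).
Let mu : probability (d.-tuple R) R := torus_measure R d.
Implicit Types (f g h : field R d) (a : 'I_d -> mode d -> R) (p q : mode d) (ps : seq (mode d)).

Definition tfield ps a : field R d := fun i x => tpoly ps (a i) x.

Lemma L2_tfield ps a : L2 (tfield ps a).
Proof. by move=> i; exact: (Lfun2_tpoly ps (a i)). Qed.

Definition fhat g i p : R := hat (g i) p.

Lemma fhat_lin (c : R) f g i p : L2 f -> L2 g ->
  fhat (c *: f + g) i p = c * fhat f i p + fhat g i p.
Proof. by move=> f2 g2; exact: (hat_lin c p (f2 i) (g2 i)). Qed.

Lemma fhatB f g i p : L2 f -> L2 g -> fhat (f - g) i p = fhat f i p - fhat g i p.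
Proof. by move=> f2 g2; exact: (hatB p (f2 i) (g2 i)). Qed.

Lemma fhatD f g i p : L2 f -> L2 g -> fhat (f + g) i p = fhat f i p + fhat g i p.
Proof. by move=> f2 g2; exact: (hatD p (f2 i) (g2 i)). Qed.

Lemma fhat_parity g i : L2 g -> parity (fhat g i).
Proof. by move=> g2; exact: (hat_parity (g2 i)). Qed.

Lemma inner_tfield g ps a : L2 g ->
  inner g (tfield ps a) = \sum_(p <- ps) \sum_(i < d) a i p * fhat g i p.
Proof.
move=> g2; rewrite innerE//; last exact: L2_tfield.
rewrite exchange_big /=; apply: eq_bigr => i _; exact: (ip_tpoly _ _ (g2 i)).
Qed.

Lemma fhat_tfield ps a i p : msym ps -> parity (a i) ->
  fhat (tfield ps a) i p = (p \in ps)%:R * a i p.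
Proof. by move=> ss pa; exact: hat_tpoly. Qed.

Lemma field_bessel g ps : L2 g -> uniq ps ->
  \sum_(p <- ps) \sum_(i < d) fhat g i p ^+ 2 <= inner g g.
Proof.
move=> g2 us; rewrite exchange_big innerE//=; apply: ler_sum => i _.
exact: (bessel (g2 i)).
Qed.

(** The approximation by finite sums is part of the conclusion because membership in [H] is later
    checked through it. *)
Lemma field_riesz_fischer a (M : R) : (forall i, parity (a i)) ->
  (forall ps, uniq ps -> \sum_(p <- ps) \sum_(i < d) a i p ^+ 2 <= M) ->
  exists g, [/\ L2 g, forall i p, fhat g i p = a i p, inner g g <= M
    & forall e : R, 0 < e -> exists n : nat, nrm (tfield (exhaust d n) a - g) <= e].
Proof.
move=> pa aM.
have H i : exists g : d.-tuple R -> R, [/\ g \in Lfun mu 2%:E, forall p, hat g p = a i p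
    & forall e : R, 0 < e -> exists N : nat, forall n, (N <= n)%N ->
      ip mu (fun x => tpoly (exhaust d n) (a i) x - g x)
            (fun x => tpoly (exhaust d n) (a i) x - g x) <= e].
  apply: (@riesz_fischer _ _ (a i) M) => // ps us.
  apply: le_trans (aM ps us); apply: ler_sum => p _.
  by rewrite (bigD1 i)//= lerDl sumr_ge0// => j _; exact: sqr_ge0.
have [g gP] := choice H.
have g2 : L2 g by move=> i; have [] := gP i.
have hg i p : fhat g i p = a i p by have [_ h _] := gP i; exact: h.
have key e : 0 < e -> exists n : nat,
    inner (tfield (exhaust d n) a - g) (tfield (exhaust d n) a - g) <= e * d%:R.
  move=> e0; have /choice[N NP] i := let: And3 _ _ h := gP i in h _ e0.
  exists (\max_(i < d) N i)%N.
  rewrite innerE; try (apply: L2B => //; exact: L2_tfield).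
  apply: (@le_trans _ _ (\sum_(i < d) e)); last by rewrite sumr_const card_ord -[leLHS]mulr_natr lexx.
  by apply: ler_sum => i _; apply: NP; exact: leq_bigmax.
exists g; split => //.
- apply/ler_addgt0Pr => e e0.
  (* Dividing by [d + 1] keeps the denominator positive also when [d = 0]. *)
  have d1 : 0 < d%:R + 1 :> R by rewrite ltr_wpDl.
  have [n nP] := key _ (divr_gt0 e0 d1).
  apply: (@le_trans _ _ (\sum_(p <- exhaust d n) \sum_(i < d) a i p ^+ 2 + e)); last first.
    by rewrite lerD2r; apply: aM; have [] := exhaust_sym d n.
  rewrite -lerBlDl; apply: le_trans (_ : e / (d%:R + 1) * d%:R <= _); last first.
    by rewrite mulrAC ler_pdivrMr// ler_pM2l// lerDl.
  apply: le_trans nP; rewrite le_eqVlt; apply/orP; left; apply/eqP.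
  rewrite !innerE//; try (apply: L2B => //; exact: L2_tfield).
  rewrite exchange_big /= -sumrB; apply: eq_bigr => i _; apply/esym.
  have := parseval_defect (g2 i) (exhaust_sym d n).
  by have -> : hat (g i) = a i by apply/funext => p; exact: hg.
- move=> e e0; have d1 : 0 < d%:R + 1 :> R by rewrite ltr_wpDl.
  have [n nP] := key _ (divr_gt0 (exprn_gt0 2 e0) d1); exists n.
  rewrite -(@ler_pXn2r _ 2) ?nnegrE ?nrm_ge0 ?(ltW e0)// sqr_nrm.
  apply: le_trans nP _; rewrite mulrAC ler_pdivrMr// ler_pM2l ?exprn_gt0//.
  by rewrite lerDl.
Qed.

Lemma kap_opp (k : 'rV[int]_d) : kap R (- k) = kap R k.
Proof.
by rewrite /kap /kabs; congr (_ * Num.sqrt _); apply: eq_bigr => i _; rewrite mxE mulrNz sqrrN.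
Qed.

(** The multiplier is real, so it acts separately on the real and imaginary parts of a complex
    coefficient, which are the cosine and, up to sign, the sine coefficients. *)
Lemma fraclap_reprP s g F : fraclap_repr (s / 2) g F <->
  [/\ L2 g, L2 F & forall i p, fhat F i p = kap R p.1 `^ s * fhat g i p].
Proof.
have e : 2 * (s / 2) = s by field.
rewrite /fraclap_repr /= e; split => -[g2 F2 h]; split => //.
- move=> i [k b]; have := h k i; rewrite /fourier -/(kap R k) => -[].
  rewrite !mul0r subr0 addr0 mulrN => h1 /oppr_inj h2.
  by case: b; [exact: h1|exact: h2].
- move=> k i; have h1 := h i (k, true); have h2 := h i (k, false).
  move: h1 h2; rewrite /fhat /hat /ip /cs /= => h1 h2.
  rewrite /fourier h1 h2; apply/eqP; rewrite eq_complex /= -/(kap R k).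
  by rewrite !mul0r subr0 addr0 mulrN !eqxx.
Qed.

Definition wsum s ps g : R :=
  \sum_(p <- ps) \sum_(i < d) (kap R p.1 `^ s * fhat g i p) ^+ 2.

(** From left to right, Bessel is applied to a nearly optimal representative; from right to left,
    Riesz-Fischer builds one from the weighted coefficients. This replaces the infimum in [Vnorm] by
    finite sums. *)
Lemma Vnorm_le s g (M : R) : L2 g -> 0 <= M ->
  (Vnorm s g <= M%:E)%E <-> forall ps, uniq ps -> wsum s ps g <= M ^+ 2.
Proof.
move=> g2 M0; split => [h ps us|h].
  apply/ler_addgt0Pr => e e0.
  (* Chosen so that [(M + eta)^2 <= M^2 + e]: indeed [2 * M * eta + eta^2 <= eta * (2 * M + 1)] once
     [eta <= 1]. *)
  pose eta := Num.min 1 (e / (2 * M + 1)).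
  have M1 : 0 < 2 * M + 1 by lra.
  have eta0 : 0 < eta by rewrite lt_min ltr01 divr_gt0.
  have : (Vnorm s g < (M + eta)%:E)%E by apply: le_lt_trans h _; rewrite lte_fin ltrDl.
  move=> /ereal_inf_lt[_ [F /fraclap_reprP[_ F2 Fh] <-]]; rewrite L2normE// lte_fin => nF.
  apply: (@le_trans _ _ (nrm F ^+ 2)).
    rewrite sqr_nrm; apply: le_trans (field_bessel F2 us).
    by apply: ler_sum => p _; apply: ler_sum => i _; rewrite Fh.
  apply: (@le_trans _ _ ((M + eta) ^+ 2)).
    by rewrite lerXn2r ?nnegrE ?nrm_ge0 ?(ltW nF)// addr_ge0// ltW.
  rewrite sqrrD -addrA lerD2l.
  have e1 : eta <= 1 by rewrite ge_min lexx.
  have e2 : eta * (2 * M + 1) <= e by rewrite -ler_pdivlMr// ge_min lexx orbT.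
  apply: le_trans e2; rewrite -subr_ge0 (_ : _ - _ = eta * (1 - eta)); last by ring.
  by rewrite mulr_ge0 ?subr_ge0// ltW.
have [F [F2 Fh FM _]] := @field_riesz_fischer (fun i p => kap R p.1 `^ s * fhat g i p) (M ^+ 2)
  ltac:(by move=> i p; rewrite kap_opp fhat_parity// mulrCA) h.
apply: ge_ereal_inf; exists (L2norm F).
  by exists F => //; apply/fraclap_reprP.
by rewrite L2normE// lee_fin -(@ler_pXn2r _ 2) ?nnegrE ?nrm_ge0// sqr_nrm.
Qed.

End Vnorm.

(** * Trigonometric polynomials, their derivatives and the test fields *)

Section trigonometric_fields.
Context (R : realType) (d : nat).
Let mu : probability (d.-tuple R) R := torus_measure R d.
Implicit Types (f : d.-tuple R -> R) (a : mode d -> R) (p q : mode d)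
  (ps : seq (mode d)) (ks : seq 'rV[int]_d) (k : 'rV[int]_d).

Lemma ip_cs_delta p q : ip mu (cs p) (cs q) =
  2^-1 * ((q == p)%:R + par R p.2 * (q == mopp p)%:R).
Proof.
rewrite ip_cs -mode_eq_opp.
have -> : (q == p) = (p.2 == q.2) && (p.1 == q.1).
  by case: p q => k b [l c]; rewrite xpair_eqE andbC eq_sym [l == _]eq_sym.
have -> : (q.2 == p.2) && (q.1 == - p.1) = (p.2 == q.2) && (p.1 == - q.1).
  by congr (_ && _); [exact: eq_sym | rewrite eq_sym eqr_oppLR].
by case: eqP => _ /=; ring.
Qed.

(** Taking the coefficients to be those of [f] itself removes the ambiguity of a redundant
    expansion. Equality is pointwise, so that the sum can be differentiated. *)
Definition istrig ks f := f = tpoly (kfull ks) (hat f).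

Lemma istrig_L2 ks f : istrig ks f -> f \in Lfun mu 2%:E.
Proof. by move=> ->; exact: Lfun2_tpoly. Qed.

Lemma istrig_lin ks (c : R) f g : istrig ks f -> istrig ks g ->
  istrig ks (fun x => c * f x + g x).
Proof.
move=> tf tg; apply/funext => x; rewrite {1}tf {1}tg /tpoly mulr_sumr -big_split.
apply: eq_bigr => p _ /=.
by rewrite hat_lin; [ring|exact: istrig_L2 tf|exact: istrig_L2 tg].
Qed.

Lemma istrig_cs ks p : ksym ks -> p.1 \in ks -> istrig ks (cs p).
Proof.
move=> ss pk; have [us ms] := kfull_sym ss.
apply/funext => x; rewrite /tpoly.
transitivity (2^-1 * \sum_(q <- kfull ks) cs q x * (q == p)%:R +
              2^-1 * \sum_(q <- kfull ks) (par R p.2 * cs q x) * (q == mopp p)%:R).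
  rewrite !sum_delta_uniq// !mem_kfull /= pk (proj2 ss)// !mul1r cs_opp mulrA parK mul1r.
  by field.
rewrite !mulr_sumr -big_split /=; apply: eq_bigr => q _.
by rewrite /hat ip_cs_delta; ring.
Qed.

Lemma istrig_sub ks ks' f : ksym ks -> ksym ks' -> {subset ks <= ks'} ->
  istrig ks f -> istrig ks' f.
Proof.
move=> ss ss' sub tf; rewrite /istrig {1}tf; apply/funext => x.
have [us _] := kfull_sym ss; have [us' _] := kfull_sym ss'.
apply/esym/sum_uniq_subset => //.
  by move=> p; rewrite !mem_kfull; exact: sub.
move=> p pn; rewrite {1}tf hat_tpoly ?(negPf pn) ?mul0r//; first exact: kfull_sym.
exact/hat_parity/(istrig_L2 tf).
Qed.

Lemma hat_istrig ks f p : ksym ks -> istrig ks f -> p.1 \notin ks -> hat f p = 0.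
Proof.
move=> ss tf pn; rewrite {1}tf hat_tpoly; first by rewrite mem_kfull (negPf pn) mul0r.
  exact: kfull_sym.
exact/hat_parity/(istrig_L2 tf).
Qed.

Lemma istrig_tpoly ks a : ksym ks -> parity a -> istrig ks (tpoly (kfull ks) a).
Proof.
move=> ss pa; apply/funext => x; apply: eq_big_seq => p pp.
by rewrite hat_tpoly ?pp ?mul1r//; exact: kfull_sym.
Qed.

Lemma istrig_sum (I : eqType) (s : seq I) ks (F : I -> d.-tuple R -> R) :
  (forall i, i \in s -> istrig ks (F i)) -> istrig ks (fun x => \sum_(i <- s) F i x).
Proof.
elim: s => [|i s ih] tF.
  apply/funext => x; rewrite big_nil /tpoly big1// => p _.
  by under eq_fun do rewrite big_nil; rewrite /hat ip0l mul0r.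
have tFs j : j \in s -> istrig ks (F j) by move=> js; apply: tF; rewrite inE js orbT.
have := istrig_lin 1 (tF i (mem_head _ _)) (ih tFs).
by congr istrig; apply/funext => x; rewrite big_cons mul1r.
Qed.

Lemma Re_sum (I : Type) (s : seq I) (F : I -> R[i]) :
  complex.Re (\sum_(i <- s) F i) = \sum_(i <- s) complex.Re (F i).
Proof.
elim: s => [|i s ih]; first by rewrite !big_nil.
by rewrite !big_cons -ih; case: (F i) => ? ?; case: (\sum_(_ <- _) _).
Qed.

Lemma Im_sum (I : Type) (s : seq I) (F : I -> R[i]) :
  complex.Im (\sum_(i <- s) F i) = \sum_(i <- s) complex.Im (F i).
Proof.
elim: s => [|i s ih]; first by rewrite !big_nil.
by rewrite !big_cons -ih; case: (F i) => ? ?; case: (\sum_(_ <- _) _).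
Qed.

Lemma trigpolyP (g : field R d) : trigpoly g ->
  exists ks, ksym ks /\ forall i, istrig ks (g i).
Proof.
move=> [ks0 [c gE]]; exists (kclose (kfull ks0)); split; first exact: kclose_sym.
move=> i; have sub k : k \in ks0 -> k \in kclose (kfull ks0).
  move=> kk; have : (k, true) \in mclose (kfull ks0) by apply: sub_mclose; rewrite mem_kfull.
  by rewrite mem_kfull.
have -> : g i = fun x => \sum_(k <- ks0) (complex.Re (c k i) * cs (k, true) x +
    (- complex.Im (c k i) * cs (k, false) x + 0)).
  apply/funext => x; have := congr1 (@complex.Re R) (gE i x); rewrite /= Re_sum => ->.
  by apply: eq_bigr => k _; case: (c k i) => u v; rewrite /cs /cexp /= addr0 mulNr.
apply: istrig_sum => k /sub kk; have ss := kclose_sym (kfull ks0).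
apply: istrig_lin; first exact: istrig_cs.
apply: istrig_lin; first exact: istrig_cs.
have := istrig_sum (s := [::]) (ks := kclose (kfull ks0)) (F := fun _ : nat => cs (k, true)).
by under eq_fun do rewrite big_nil; apply.
Qed.

Lemma Rintegral_hat (f : d.-tuple R -> R) :
  (\int[mu]_x f x)%R = hat f (0, true).
Proof.
apply: eq_Rintegral => x _; rewrite /cs /= (_ : kdot 0 x = 0) ?mulr0 ?cos0 ?mulr1//.
by rewrite /kdot big1// => i _; rewrite mxE mul0r.
Qed.

Lemma kdot_subst k (x : d.-tuple R) j r :
  kdot k (subst_coord x j r) = (k 0 j)%:~R * r + \sum_(i < d | i != j) (k 0 i)%:~R * tnth x i.
Proof.
rewrite /kdot (bigD1 j)//= tnth_mktuple eqxx; congr (_ + _).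
by apply: eq_bigr => i /negPf ij; rewrite tnth_mktuple ij.
Qed.

Lemma subst_coord_id (x : d.-tuple R) j : subst_coord x j (tnth x j) = x.
Proof. by apply: eq_from_tnth => i; rewrite tnth_mktuple; case: eqP => [->|]. Qed.

Lemma is_derive_cs (j : 'I_d) p (x : d.-tuple R) (r : R) :
  is_derive r 1 (fun r => cs p (subst_coord x j r))
    (- par R p.2 * (2 * pi * (p.1 0 j)%:~R) * cs (p.1, ~~ p.2) (subst_coord x j r)).
Proof.
pose c := 2 * pi * (p.1 0 j)%:~R : R.
pose e := 2 * pi * \sum_(i < d | i != j) (p.1 0 i)%:~R * tnth x i.
have kE s : 2 * pi * kdot p.1 (subst_coord x j s) = c * s + e.
  by rewrite kdot_subst /c /e mulrDr !mulrA.
have dl : is_derive r 1 (fun y : R => c * y + e) c.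
  by apply: is_derive_eq; rewrite /GRing.scale /= mulr1 addr0.
rewrite /cs /par; case: p.2 => /=.
- have -> : (fun r => cos (2 * pi * kdot p.1 (subst_coord x j r))) =
      (fun r => cos (c * r + e)) by apply/funext => s; rewrite kE.
  have := @is_derive1_comp _ (@cos R) (fun y => c * y + e) r _ _ (is_derive_cos _) dl.
  by rewrite kE -/c mulN1r mulNr mulNr mulrC.
- have -> : (fun r => sin (2 * pi * kdot p.1 (subst_coord x j r))) =
      (fun r => sin (c * r + e)) by apply/funext => s; rewrite kE.
  have := @is_derive1_comp _ (@sin R) (fun y => c * y + e) r _ _ (is_derive_sin _) dl.
  by rewrite kE -/c opprK mul1r mulrC.
Qed.

Lemma is_derive_tpoly (j : 'I_d) ps a (x : d.-tuple R) (r : R) :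
  is_derive r 1 (fun r => tpoly ps a (subst_coord x j r))
    (\sum_(p <- ps) a p * (- par R p.2 * (2 * pi * (p.1 0 j)%:~R) *
       cs (p.1, ~~ p.2) (subst_coord x j r))).
Proof.
elim: ps => [|p ps ih].
  rewrite big_nil (_ : (fun _ => _) = cst 0); first exact: is_derive_cst.
  by apply/funext => s; rewrite /tpoly big_nil.
rewrite big_cons (_ : (fun _ => _) = (fun r => a p * cs p (subst_coord x j r)) \+
    (fun r => tpoly ps a (subst_coord x j r))); last first.
  by apply/funext => s; rewrite /tpoly big_cons.
have dc := is_derive_cs j p x r.
by apply: is_derive_eq.
Qed.

(** The action of the [j]-th partial derivative on coefficients: cosine and sine coefficients are
    exchanged, with a sign. *)
Definition dcoef (j : 'I_d) a p : R :=
  par R p.2 * (2 * pi * (p.1 0 j)%:~R) * a (p.1, ~~ p.2).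

Lemma par_negb b : par R (~~ b) = - par R b.
Proof. by case: b; rewrite /par ?opprK. Qed.

Lemma dcoef_parity j a : parity a -> parity (dcoef j a).
Proof.
move=> pa p; rewrite /dcoef /= mxE mulrNz.
have := pa (p.1, ~~ p.2); rewrite /mopp /= => ->; rewrite par_negb; ring.
Qed.

Lemma partial_tpoly j ks a :
  partial j (tpoly (kfull ks) a) = tpoly (kfull ks) (dcoef j a).
Proof.
apply/funext => x; rewrite /partial derive1E.
have -> := @derive_val _ _ _ _ _ _ _ (is_derive_tpoly j (kfull ks) a x (tnth x j)).
rewrite subst_coord_id /tpoly !big_kfull; apply: eq_bigr => k _.
by rewrite /dcoef /= /par; ring.
Qed.

Lemma partial_istrig j ks f : istrig ks f ->
  partial j f = tpoly (kfull ks) (dcoef j (hat f)).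
Proof. by move=> tf; rewrite {1}tf partial_tpoly. Qed.

Lemma hat_partial j ks f p : ksym ks -> istrig ks f ->
  hat (partial j f) p = dcoef j (hat f) p.
Proof.
move=> ss tf; rewrite (partial_istrig j tf) hat_tpoly; last 2 first.
- exact: kfull_sym.
- exact/dcoef_parity/hat_parity/(istrig_L2 tf).
rewrite mem_kfull; have [pk|pk] := boolP (p.1 \in ks); first by rewrite mul1r.
by rewrite mul0r /dcoef (hat_istrig ss tf) ?mulr0.
Qed.

Definition solenoidal (a : 'I_d -> mode d -> R) :=
  forall p, \sum_(j < d) (p.1 0 j)%:~R * a j p = 0.

Lemma testV_hat (g : field R d) : testV g -> exists ks, [/\ ksym ks,
  forall i, istrig ks (g i), solenoidal (fhat g) & forall i b, fhat g i (0, b) = 0].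
Proof.
move=> [/trigpolyP[ks [ss tg]] dg mg]; exists ks; split => //.
- move=> p; have p0 : 2 * pi != 0 :> R by rewrite mulf_neq0 ?(gt_eqF (pi_gt0 R)).
  (* Since differentiation exchanges cosine and sine, the constraint at [p] is read off the
     divergence at the mode of the other type. *)
  have : hat (fun x => \sum_(j < d) partial j (g j) x) (p.1, ~~ p.2) = 0.
    by under eq_fun do rewrite -/(divergence g _) dg; rewrite /hat ip0l.
  have L2p j : partial j (g j) \in Lfun mu 2%:E.
    by rewrite (partial_istrig j (tg j)); exact: Lfun2_tpoly.
  rewrite /hat ip_suml//; last exact: Lfun2_cs.
  have -> : \sum_(j < d) ip mu (partial j (g j)) (cs (p.1, ~~ p.2)) =
      par R (~~ p.2) * (2 * pi) * \sum_(j < d) (p.1 0 j)%:~R * fhat g j p.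
    rewrite mulr_sumr; apply: eq_bigr => j _.
    rewrite -/(hat (partial j (g j)) _) (hat_partial _ _ ss (tg j)) /dcoef /= negbK.
    by rewrite -surjective_pairing /fhat; ring.
  have q0 : par R (~~ p.2) * (2 * pi) != 0.
    by rewrite mulf_neq0// /par; case: ifP => _; rewrite ?oppr_eq0 oner_eq0.
  by move=> /eqP; rewrite mulf_eq0 (negPf q0) => /eqP.
- move=> i []; first by rewrite /fhat -Rintegral_hat.
  rewrite /fhat /hat (_ : cs (0, false) = (fun=> 0)) ?(ipC _ (g i)) ?ip0l//.
  apply/funext => x; rewrite /cs /= (_ : kdot 0 x = 0) ?mulr0 ?sin0//.
  by rewrite /kdot big1// => j _; rewrite mxE mul0r.
Qed.

Lemma cs_complex k (x : d.-tuple R) : cexp k x = Complex (cs (k, true) x) (cs (k, false) x).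
Proof. by []. Qed.

Lemma trigpoly_tfield ks (a : 'I_d -> mode d -> R) : ksym ks ->
  (forall i, parity (a i)) -> trigpoly (tfield (kfull ks) a).
Proof.
move=> ss pa; exists ks, (fun k i => Complex (a i (k, true)) (- a i (k, false))) => i x.
apply/eqP; rewrite eq_complex /= Re_sum Im_sum; apply/andP; split; apply/eqP.
  rewrite /tfield /tpoly big_kfull; apply: eq_bigr => k _.
  by rewrite cs_complex /= mulNr opprK.
(* [S] is the imaginary part of the complex sum with coefficients [a_cos - i a_sin]. By parity it
   changes sign under [k -> -k], which permutes [ks], hence it vanishes. *)
pose S := \sum_(k <- ks) (a i (k, true) * cs (k, false) x - a i (k, false) * cs (k, true) x).
have SE : S = - S.
  have pk : perm_eq ks (map -%R ks).
    apply: uniq_perm; [exact: (proj1 ss)|by rewrite map_inj_uniq ?(proj1 ss)//; exact: oppr_inj|].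
    move=> k; apply/idP/mapP => [kk|[l ll ->]]; last exact: (proj2 ss).
    by exists (- k); rewrite ?opprK//; exact: (proj2 ss).
  rewrite {1}/S (perm_big _ pk) big_map /S -sumrN; apply: eq_bigr => k _.
  have := cs_opp (k, true) x; have := cs_opp (k, false) x.
  have := pa i (k, true); have := pa i (k, false).
  by rewrite /mopp /par /= => -> -> -> ->; ring.
have S0 : S = 0 by lra.
by rewrite -{1}S0 /S; apply: eq_bigr => k _; rewrite cs_complex /=; ring.
Qed.

Lemma testV_tfield ks (a : 'I_d -> mode d -> R) : ksym ks ->
  (forall i, parity (a i)) -> solenoidal a -> (forall i b, a i (0, b) = 0) ->
  testV (tfield (kfull ks) a).
Proof.
move=> ss pa sa a0; split.
- exact: trigpoly_tfield.
- move=> x; rewrite /divergence.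
  under eq_bigr do rewrite /tfield partial_tpoly /tpoly.
  rewrite exchange_big /= big_kfull big1// => k _.
  have h b := sa (k, b); have h1 := h true; have h2 := h false.
  rewrite (_ : \sum_(i < d) _ = 2 * pi * cs (k, true) x * \sum_(j < d) (k 0 j)%:~R * a j (k, false)).
    rewrite h2 mulr0 add0r.
    rewrite (_ : \sum_(i < d) _ = - (2 * pi * cs (k, false) x * \sum_(j < d) (k 0 j)%:~R * a j (k, true))).
      by rewrite h1 mulr0 oppr0.
    by rewrite mulr_sumr -sumrN; apply: eq_bigr => i _; rewrite /dcoef /par /=; ring.
  by rewrite mulr_sumr; apply: eq_bigr => i _; rewrite /dcoef /par /=; ring.
- move=> i; rewrite Rintegral_hat hat_tpoly ?a0 ?mulr0//; exact: kfull_sym.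
Qed.

Lemma testV_L2 (g : field R d) : testV g -> L2 g.
Proof. by move=> /testV_hat[ks [_ tg _ _]] i; exact: istrig_L2 (tg i). Qed.

Lemma istrig_field ks (g : field R d) : (forall i, istrig ks (g i)) ->
  g = tfield (kfull ks) (fhat g).
Proof. by move=> tg; apply/funext => i; exact: tg. Qed.

Lemma kunion_sym ks ks' : ksym ks -> ksym ks' -> ksym (undup (ks ++ ks')).
Proof.
move=> [u1 s1] [u2 s2]; split; first exact: undup_uniq.
by move=> k; rewrite !mem_undup !mem_cat => /orP[/s1 ->//|/s2 ->]; rewrite orbT.
Qed.

Lemma testV_lin (c : R) (f g : field R d) : testV f -> testV g -> testV (c *: f + g).
Proof.
move=> vf vg; have f2 := testV_L2 vf; have g2 := testV_L2 vg.
have [ks1 [s1 t1 v1 z1]] := testV_hat vf; have [ks2 [s2 t2 v2 z2]] := testV_hat vg.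
have ss := kunion_sym s1 s2; set ks := undup _ in ss.
have t i : istrig ks ((c *: f + g) i).
  apply: istrig_lin.
    by apply: istrig_sub (t1 i) => // k kk; rewrite mem_undup mem_cat kk.
  by apply: istrig_sub (t2 i) => // k kk; rewrite mem_undup mem_cat kk orbT.
rewrite (istrig_field t); apply: testV_tfield => //.
- by move=> i; apply: fhat_parity; exact: L2_lin.
- move=> p; under eq_bigr do rewrite fhat_lin// mulrDr mulrCA.
  by rewrite big_split /= -mulr_sumr v1 v2 mulr0 addr0.
- by move=> i b; rewrite fhat_lin// z1 z2 mulr0 addr0.
Qed.

Lemma testV_0 : testV (0 : field R d).
Proof.
have := @testV_tfield [::] (fun _ _ => 0).
rewrite (_ : tfield _ _ = 0); last by apply/funext => i; apply/funext => x;
  rewrite /tfield /tpoly big_nil.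
apply=> //; first by move=> i p; rewrite mulr0.
by move=> p; rewrite big1// => j _; rewrite mulr0.
Qed.

End trigonometric_fields.

(** * The space [H] and Fourier truncation *)

Section solenoidal_space.
Context (R : realType) (d : nat).
Let mu : probability (d.-tuple R) R := torus_measure R d.
Implicit Types (f g h phi u v w : field R d) (p q : mode d)
  (ps : seq (mode d)) (ks : seq 'rV[int]_d) (k : 'rV[int]_d).

Lemma H_L2 g : H g -> L2 g. Proof. by case. Qed.

Lemma H_approx g (e : R) : H g -> 0 < e -> exists phi, testV phi /\ nrm (g - phi) < e.
Proof.
move=> [g2 gP] e0; have [phi [vp h]] := gP e e0; exists phi; split => //.
by move: h; rewrite L2normE ?lte_fin//; apply: L2B => //; exact: testV_L2.
Qed.

Lemma nrm0 : nrm (0 : field R d) = 0.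
Proof. by rewrite nrm.unlock inner0l sqrtr0. Qed.

Lemma testV_H phi : testV phi -> H phi.
Proof.
move=> vp; split; first exact: testV_L2.
by move=> e e0; exists phi; split => //; rewrite subrr L2normE ?nrm0 ?lte_fin//; exact: L2_0.
Qed.

Lemma H_closed g : L2 g -> (forall e : R, 0 < e -> exists h, H h /\ nrm (g - h) <= e) -> H g.
Proof.
move=> g2 gP; split => // e e0; have e4 : 0 < e / 4 by rewrite divr_gt0.
have [h [Hh hP]] := gP _ e4; have [phi [vp pP]] := H_approx Hh e4.
exists phi; split => //; have p2 := testV_L2 vp; have h2 := H_L2 Hh.
rewrite L2normE ?lte_fin; last exact: L2B.
have := nrm_triangle g2 h2 p2; lra.
Qed.

Lemma H_lin (c : R) f g : H f -> H g -> H (c *: f + g).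
Proof.
move=> Hf Hg; have f2 := H_L2 Hf; have g2 := H_L2 Hg.
apply: H_closed; first exact: L2_lin.
move=> e e0; have e4 : 0 < e / 2 by rewrite divr_gt0.
have c0 : 0 < `|c| + 1 by rewrite ltr_wpDl.
have [phi [vp pP]] := H_approx Hf (divr_gt0 e4 c0).
have [psi [vs sP]] := H_approx Hg e4.
exists (c *: phi + psi); split; first exact/testV_H/testV_lin.
have p2 := testV_L2 vp; have s2 := testV_L2 vs.
rewrite (_ : _ - _ = c *: (f - phi) + (g - psi)); last by rewrite scalerBr addrACA opprD.
apply: (le_trans (nrmD (L2Z c (L2B f2 p2)) (L2B g2 s2))).
rewrite nrmZ; last exact: L2B.
have : `|c| * nrm (f - phi) <= e / 2.
  apply: (@le_trans _ _ ((`|c| + 1) * nrm (f - phi))).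
    by rewrite ler_wpM2r ?nrm_ge0// lerDl.
  by rewrite mulrC -ler_pdivlMr// ltW.
lra.
Qed.

Lemma H_0 : H (0 : field R d). Proof. exact/testV_H/testV_0. Qed.

Lemma HZ (c : R) f : H f -> H (c *: f).
Proof. by move=> Hf; rewrite -[_ *: _]addr0; apply: H_lin => //; exact: H_0. Qed.

Lemma HD f g : H f -> H g -> H (f + g).
Proof. by move=> *; rewrite -[f]scale1r; exact: H_lin. Qed.

Lemma HB f g : H f -> H g -> H (f - g).
Proof. by move=> *; apply: HD => //; rewrite -scaleN1r; exact: HZ. Qed.

Lemma inner_le_of_testV g h (M : R) : L2 g -> H h -> 0 <= M ->
  (forall phi, testV phi -> inner g phi <= M * nrm phi) -> inner g h <= M * nrm h.
Proof.
move=> g2 Hh M0 gM; apply/ler_addgt0Pr => e e0.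
have c0 : 0 < nrm g + M + 1 by rewrite ltr_wpDl// addr_ge0// nrm_ge0.
have [phi [vp pP]] := H_approx Hh (divr_gt0 e0 c0).
have p2 := testV_L2 vp; have h2 := H_L2 Hh.
have -> : inner g h = inner g (h - phi) + inner g phi.
  by rewrite innerBr// subrK.
have h1 := gM _ vp.
have h3 : inner g (h - phi) <= nrm g * nrm (h - phi).
  exact: le_trans (ler_norm _) (inner_CS g2 (L2B h2 p2)).
have h4 : nrm phi <= nrm h + nrm (h - phi).
  by have := nrmD h2 (L2B p2 h2); rewrite addrC subrK (nrmBC p2 h2).
have h5 : (nrm g + M + 1) * nrm (h - phi) <= e by rewrite mulrC -ler_pdivlMr// ltW.
have h6 := nrm_ge0 (h - phi).
have h7 : M * nrm phi <= M * (nrm h + nrm (h - phi)) by exact: ler_wpM2l.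
lra.
Qed.

(** Duality: by density of the test fields, the bound may be tested on [g] itself. It gives norm
    bounds for fields known only through their inner products. *)
Lemma nrm_le_of_testV g (M : R) : H g -> 0 <= M ->
  (forall phi, testV phi -> inner g phi <= M * nrm phi) -> nrm g <= M.
Proof.
move=> Hg M0 gM; have := inner_le_of_testV (H_L2 Hg) Hg M0 gM.
rewrite -sqr_nrm expr2; have := nrm_ge0 g; rewrite le0r => /predU1P[->//|g0].
by rewrite ler_pM2r.
Qed.

Lemma inner_testV_eq f g h : L2 f -> L2 g -> H h ->
  (forall phi, testV phi -> inner f phi = inner g phi) -> inner f h = inner g h.
Proof.
move=> f2 g2 Hh fg; have h2 := H_L2 Hh.
have H0 f' g' : L2 f' -> L2 g' -> (forall phi, testV phi -> inner f' phi = inner g' phi) ->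
    inner f' h <= inner g' h.
  move=> f'2 g'2 e; rewrite -subr_le0 -innerBl// -(mul0r (nrm h)).
  apply: inner_le_of_testV => //; first exact: L2B.
  move=> phi vp; rewrite mul0r innerBl ?e ?subrr//; exact: testV_L2.
by apply/eqP; rewrite eq_le !H0// => phi vp; rewrite fg.
Qed.

Lemma fhat_le f i p : L2 f -> `|fhat f i p| <= nrm f.
Proof.
move=> f2; rewrite -(@ler_pXn2r _ 2) ?nnegrE ?nrm_ge0// real_normK ?num_real// sqr_nrm.
apply: le_trans (field_bessel f2 (ps := [:: p]) isT).
by rewrite big_seq1 (bigD1 i)//= lerDl sumr_ge0// => j _; exact: sqr_ge0.
Qed.

Lemma H_fhat0 g i b : H g -> fhat g i (0, b) = 0.
Proof.
move=> Hg; apply/eqP; rewrite -normr_le0; apply/ler_addgt0Pr => e e0; rewrite add0r.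
have [phi [vp pP]] := H_approx Hg e0; have [ks [_ _ _ z]] := testV_hat vp.
have p2 := testV_L2 vp; have g2 := H_L2 Hg.
have -> : fhat g i (0, b) = fhat (g - phi) i (0, b) by rewrite fhatB// z subr0.
by apply: le_trans (fhat_le _ _ (L2B g2 p2)) (ltW pP).
Qed.

Lemma H_solenoidal g : H g -> solenoidal (fhat g).
Proof.
move=> Hg p; apply/eqP; rewrite -normr_le0; apply/ler_addgt0Pr => e e0; rewrite add0r.
pose c : R := \sum_(j < d) `|(p.1 0 j)%:~R| + 1.
have c0 : 0 < c by rewrite /c ltr_wpDl// sumr_ge0.
have [phi [vp pP]] := H_approx Hg (divr_gt0 e0 c0); have [ks [_ _ z _]] := testV_hat vp.
have p2 := testV_L2 vp; have g2 := H_L2 Hg.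
have -> : \sum_(j < d) (p.1 0 j)%:~R * fhat g j p = \sum_(j < d) (p.1 0 j)%:~R * fhat (g - phi) j p.
  under [RHS]eq_bigr do rewrite fhatB// mulrBr.
  by rewrite sumrB z subr0.
apply: le_trans (ler_norm_sum _ _ _) _.
apply: (@le_trans _ _ (\sum_(j < d) `|(p.1 0 j)%:~R| * nrm (g - phi))).
  by apply: ler_sum => j _; rewrite normrM ler_wpM2l// fhat_le//; exact: L2B.
rewrite -mulr_suml; apply: (@le_trans _ _ (c * nrm (g - phi))).
  by rewrite ler_wpM2r ?nrm_ge0// lerDl.
by rewrite mulrC -ler_pdivlMr// ltW.
Qed.

Definition trunc ks u := tfield (kfull ks) (fhat u).

Lemma trunc_testV ks u : ksym ks -> H u -> testV (trunc ks u).
Proof.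
move=> ss Hu; apply: testV_tfield => //.
- by move=> i; apply: fhat_parity; exact: H_L2.
- exact: H_solenoidal.
- by move=> i b; exact: H_fhat0.
Qed.

Lemma fhat_trunc ks u i p : ksym ks -> L2 u ->
  fhat (trunc ks u) i p = (p \in kfull ks)%:R * fhat u i p.
Proof. by move=> ss u2; apply: fhat_tfield; [exact: kfull_sym|exact: fhat_parity]. Qed.

Lemma L2_trunc ks u : L2 (trunc ks u). Proof. exact: L2_tfield. Qed.

Lemma truncB ks u v : L2 u -> L2 v -> trunc ks (u - v) = trunc ks u - trunc ks v.
Proof.
move=> u2 v2; apply/funext => i; apply/funext => x.
transitivity (\sum_(p <- kfull ks) fhat (u - v) i p * cs p x) => //.
rewrite -[RHS]/(tpoly _ (fhat u i) x - tpoly _ (fhat v i) x) /tpoly -sumrB; apply: eq_bigr => p _.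
by rewrite -mulrBl fhatB.
Qed.

(* Best approximation: among trigonometric fields with frequencies in [ks],
   the truncated Fourier series is closest to [u]. *)
Lemma nrm_trunc_le ks u phi : ksym ks -> L2 u -> (forall i, istrig ks (phi i)) ->
  nrm (u - trunc ks u) <= nrm (u - phi).
Proof.
move=> ss u2 tp; have p2 : L2 phi by move=> i; exact: istrig_L2 (tp i).
have t2 := L2_trunc ks u; have sk := kfull_sym ss.
rewrite -(@ler_pXn2r _ 2) ?nnegrE ?nrm_ge0// !sqr_nrm.
have E psi : psi = tfield (kfull ks) (fhat psi) -> L2 psi ->
    inner (u - psi) (u - psi) = inner u u - \sum_(p <- kfull ks) \sum_(i < d) fhat u i p ^+ 2
      + \sum_(p <- kfull ks) \sum_(i < d) (fhat u i p - fhat psi i p) ^+ 2.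
  move=> pE psi2; have d2 := L2B u2 psi2.
  rewrite innerBl// !innerBr// (innerC psi u).
  have e1 : inner u psi = \sum_(p <- kfull ks) \sum_(i < d) fhat psi i p * fhat u i p.
    by rewrite {1}pE inner_tfield.
  have e2 : inner psi psi = \sum_(p <- kfull ks) \sum_(i < d) fhat psi i p * fhat psi i p.
    by rewrite {2}pE inner_tfield.
  have e3 : \sum_(p <- kfull ks) \sum_(i < d) (fhat u i p - fhat psi i p) ^+ 2 =
      \sum_(p <- kfull ks) \sum_(i < d) fhat u i p ^+ 2 -
      (\sum_(p <- kfull ks) \sum_(i < d) fhat psi i p * fhat u i p +
       \sum_(p <- kfull ks) \sum_(i < d) fhat psi i p * fhat u i p) +
      \sum_(p <- kfull ks) \sum_(i < d) fhat psi i p * fhat psi i p.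
    rewrite -big_split -sumrB -big_split /=; apply: eq_bigr => p _.
    rewrite -big_split -sumrB -big_split /=; apply: eq_bigr => i _; ring.
  rewrite e1 e2 e3; ring.
have tt : trunc ks u = tfield (kfull ks) (fhat (trunc ks u)).
  by apply: istrig_field => i; apply: istrig_tpoly => //; exact: fhat_parity.
rewrite (E _ (istrig_field tp) p2) (E _ tt t2).
rewrite lerD2l [leLHS]big_seq big1 ?sumr_ge0//.
- by move=> p _; apply: sumr_ge0 => i _; exact: sqr_ge0.
- move=> p pp; rewrite big1// => i _.
  by rewrite fhat_trunc// pp mul1r subrr expr0n.
Qed.

(** A test field close to [u] exists by definition of [H], and truncation at any set containing its
    frequencies does at least as well. *)
Lemma trunc_approx u ps (e : R) : H u -> 0 < e -> exists ks, [/\ ksym ks,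
  {subset ps <= kfull ks} & forall ks', ksym ks' -> {subset ks <= ks'} ->
    nrm (u - trunc ks' u) <= e].
Proof.
move=> Hu e0; have [phi [vp pP]] := H_approx Hu e0.
have [ks [ss tp _ _]] := testV_hat vp.
exists (undup (ks ++ kclose ps)); split.
- exact: kunion_sym ss (kclose_sym ps).
- move=> p pp; rewrite mem_kfull mem_undup mem_cat; apply/orP; right.
  by have := sub_mclose pp; rewrite mem_kfull.
- move=> ks' ss' sub; apply: le_trans (ltW pP); apply: nrm_trunc_le => //.
    exact: H_L2.
  move=> i; apply: istrig_sub (tp i) => // k kk; apply: sub.
  by rewrite mem_undup mem_cat kk.
Qed.

End solenoidal_space.

(** * The Leray projector, mode by mode, and comparison of the norms *)

Section leray.
Context (R : realType) (d : nat).
Implicit Types (f g h phi u v w : field R d) (p q : mode d)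
  (ps : seq (mode d)) (ks : seq 'rV[int]_d) (k : 'rV[int]_d) (s : R).

Lemma sqr_freq_gt0 k : k != 0 -> 0 < \sum_(j < d) (k 0 j)%:~R ^+ 2 :> R.
Proof.
move=> k0; rewrite lt0r sumr_ge0 ?andbT => [|j _]; last exact: sqr_ge0.
apply: contra_neq k0 => /eqP; rewrite psumr_eq0 => [/allP h|j _]; last exact: sqr_ge0.
apply/rowP => j; rewrite mxE; have := h j (mem_index_enum j).
by rewrite sqrf_eq0 intr_eq0 => /eqP.
Qed.

(** At each mode the coefficient vector is projected orthogonally to [k]; the mean is discarded. *)
Definition leray_coef g (i : 'I_d) p : R := if p.1 == 0 then 0 else
  fhat g i p - (p.1 0 i)%:~R *
    ((\sum_(j < d) (p.1 0 j)%:~R * fhat g j p) / \sum_(j < d) (p.1 0 j)%:~R ^+ 2).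

Lemma leray_coef_le g p :
  \sum_(i < d) leray_coef g i p ^+ 2 <= \sum_(i < d) fhat g i p ^+ 2.
Proof.
rewrite /leray_coef; have [p0|p0] := eqVneq p.1 0.
  by rewrite big1 ?sumr_ge0// => i _; rewrite ?expr0n ?sqr_ge0.
have K0 := sqr_freq_gt0 p0.
set K := \sum_(j < d) _ ^+ 2 in K0 *; set S := \sum_(j < d) _ * _.
have -> : \sum_(i < d) (fhat g i p - (p.1 0 i)%:~R * (S / K)) ^+ 2 =
    \sum_(i < d) fhat g i p ^+ 2 - 2 * (S / K) * S + (S / K) ^+ 2 * K.
  have eS : 2 * (S / K) * S = \sum_(i < d) 2 * (S / K) * ((p.1 0 i)%:~R * fhat g i p).
    by rewrite -mulr_sumr.
  have eK : (S / K) ^+ 2 * K = \sum_(i < d) (S / K) ^+ 2 * (p.1 0 i)%:~R ^+ 2.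
    by rewrite -mulr_sumr.
  rewrite eS eK -sumrB -big_split /=; apply: eq_bigr => i _; ring.
rewrite (_ : _ + _ = \sum_(i < d) fhat g i p ^+ 2 - S ^+ 2 / K); last first.
  by field; rewrite gt_eqF.
by rewrite gerBl divr_ge0 ?sqr_ge0// ltW.
Qed.

Lemma leray_exists g : L2 g ->
  exists G, H G /\ forall phi, H phi -> inner (g - G) phi = 0.
Proof.
move=> g2.
have pa i : parity (leray_coef g i).
  move=> p; rewrite /leray_coef /= oppr_eq0; case: eqP => _; first by rewrite mulr0.
  have e1 : \sum_(j < d) ((- p.1) 0 j)%:~R * fhat g j (mopp p) =
      - (par R p.2 * \sum_(j < d) (p.1 0 j)%:~R * fhat g j p).
    rewrite mulr_sumr -sumrN; apply: eq_bigr => j _.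
    by rewrite fhat_parity// mxE mulrNz; ring.
  have e2 : \sum_(j < d) ((- p.1) 0 j)%:~R ^+ 2 = \sum_(j < d) (p.1 0 j)%:~R ^+ 2 :> R.
    by apply: eq_bigr => j _; rewrite mxE mulrNz sqrrN.
  by rewrite e1 e2 fhat_parity// mxE mulrNz; ring.
have sa : solenoidal (leray_coef g).
  move=> p; rewrite /leray_coef; have [p0|p0] := eqVneq p.1 0.
    by rewrite big1// => j _; rewrite mulr0.
  have K0 := sqr_freq_gt0 p0.
  under eq_bigr do rewrite mulrBr mulrA -expr2.
  by rewrite sumrB -mulr_suml mulrC divfK ?subrr// gt_eqF.
have a0 i b : leray_coef g i (0, b) = 0 by rewrite /leray_coef eqxx.
have [G [G2 Gh GM Gc]] := @field_riesz_fischer R d (leray_coef g) (inner g g) pa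
  ltac:(by move=> ps us; apply: le_trans (field_bessel g2 us); apply: ler_sum => p _; exact: leray_coef_le).
have HG : H G.
  apply: H_closed => // e e0; have [n nP] := Gc e e0.
  exists (tfield (exhaust d n) (leray_coef g)); split.
    by apply/testV_H/testV_tfield => //; exact: kclose_sym.
  by rewrite nrmBC//; exact: L2_tfield.
exists G; split => // phi Hp.
have d2 := L2B g2 G2.
rewrite (inner_testV_eq d2 (@L2_0 R d) Hp) ?inner0l// => {Hp}phi vp.
rewrite inner0l; have [ks [ss tp sv z]] := testV_hat vp.
rewrite (istrig_field tp) inner_tfield// big1// => p _.
have [p0|p0] := eqVneq p.1 0.
  by rewrite big1// => i _; case: p p0 => k b /= ->; rewrite z mul0r.
have K0 := sqr_freq_gt0 p0.
(* The coefficient vector of [g - G] is parallel to [k], while that of a divergence-free field is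
   orthogonal to it. *)
transitivity ((\sum_(j < d) (p.1 0 j)%:~R * fhat phi j p) *
    ((\sum_(j < d) (p.1 0 j)%:~R * fhat g j p) / \sum_(j < d) (p.1 0 j)%:~R ^+ 2)).
  rewrite mulr_suml; apply: eq_bigr => i _.
  by rewrite fhatB// Gh /leray_coef (negPf p0); ring.
by rewrite sv mul0r.
Qed.

Lemma leray_spec g : L2 g ->
  H (leray g) /\ forall phi, H phi -> inner (leray g) phi = inner g phi.
Proof.
move=> g2; have [G GP] := leray_exists g2.
have [Hl lP] : [set p | H p /\ forall phi, H phi -> inner (g - p) phi = 0] (leray g).
  by apply: xgetPex; exists G.
split => // phi Hp; apply/esym/eqP; rewrite -subr_eq0 -innerBl ?lP//; exact: H_L2.
Qed.

Lemma leray_H g : L2 g -> H (leray g). Proof. by move=> /leray_spec[]. Qed.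

Lemma inner_leray g phi : L2 g -> H phi -> inner (leray g) phi = inner g phi.
Proof. by move=> /leray_spec[_]; apply. Qed.

(** [leray] is a choice of representative, so its linearity is used only inside inner products; the
    norm bound then follows by duality. *)
Lemma leray_contract f g : L2 f -> L2 g -> nrm (leray f - leray g) <= nrm (f - g).
Proof.
move=> f2 g2; have Hf := leray_H f2; have Hg := leray_H g2.
apply: nrm_le_of_testV; [exact: HB|exact: nrm_ge0|] => phi vp.
have Hp := testV_H vp; have p2 := H_L2 Hp.
rewrite innerBl ?inner_leray -?innerBl//; try exact: H_L2.
by apply: le_trans (ler_norm _) (inner_CS _ _) => //; exact: L2B.
Qed.

Lemma Vnorm_ge0 s g : (0 <= Vnorm s g)%E.
Proof.
apply: le_ereal_inf_tmp => _ [F /fraclap_reprP[_ F2 _] <-].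
by rewrite L2normE// lee_fin nrm_ge0.
Qed.

Lemma Vnorm_lt s g (M : R) : (Vnorm s g < M%:E)%E -> exists F,
  [/\ L2 g, L2 F, forall i p, fhat F i p = kap R p.1 `^ s * fhat g i p & nrm F < M].
Proof.
move=> /ereal_inf_lt[_ [F /fraclap_reprP[g2 F2 Fh] <-]]; rewrite L2normE// lte_fin => nF.
by exists F.
Qed.

Lemma Vnorm_le_nrm s g F : L2 g -> L2 F ->
  (forall i p, fhat F i p = kap R p.1 `^ s * fhat g i p) -> (Vnorm s g <= (nrm F)%:E)%E.
Proof.
move=> g2 F2 Fh; rewrite -L2normE//; apply: ereal_inf_lbound.
by exists F => //; apply/fraclap_reprP.
Qed.

Lemma VnormD s f g : L2 f -> L2 g -> (Vnorm s (f + g)%R <= Vnorm s f + Vnorm s g)%E.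
Proof.
move=> f2 g2; have := Vnorm_ge0 s f; have := Vnorm_ge0 s g.
case ef: (Vnorm s f) => [a| |]; case eg: (Vnorm s g) => [b| |] // _ _; rewrite ?leey//.
apply/lee_addgt0Pr => e e0; have e2 : 0 < e / 2 by rewrite divr_gt0.
have [F [_ F2 Fh nF]] : exists F, [/\ L2 f, L2 F,
    forall i p, fhat F i p = kap R p.1 `^ s * fhat f i p & nrm F < a + e / 2].
  by apply: Vnorm_lt; rewrite ef lte_fin ltrDl.
have [G [_ G2 Gh nG]] : exists F, [/\ L2 g, L2 F,
    forall i p, fhat F i p = kap R p.1 `^ s * fhat g i p & nrm F < b + e / 2].
  by apply: Vnorm_lt; rewrite eg lte_fin ltrDl.
apply: (@le_trans _ _ (nrm (F + G))%:E).
  apply: Vnorm_le_nrm; [exact: L2D|exact: L2D|] => i p.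
  by rewrite !fhatD// Fh Gh mulrDr.
by rewrite -!EFinD lee_fin; have := nrmD F2 G2; lra.
Qed.

Lemma VnormN s g : L2 g -> Vnorm s (- g) = Vnorm s g.
Proof.
have H f : L2 f -> (Vnorm s (- f)%R <= Vnorm s f)%E.
  move=> f2; have := Vnorm_ge0 s f; case ef: (Vnorm s f) => [a| |]//; rewrite ?leey// => _.
  apply/lee_addgt0Pr => e e0.
  have [F [_ F2 Fh nF]] : exists F, [/\ L2 f, L2 F,
      forall i p, fhat F i p = kap R p.1 `^ s * fhat f i p & nrm F < a + e].
    by apply: Vnorm_lt; rewrite ef lte_fin ltrDl.
  apply: (@le_trans _ _ (nrm (- F))%:E).
    apply: Vnorm_le_nrm; [exact: L2N|exact: L2N|] => i p.
    have e1 h : L2 h -> fhat (- h) i p = - fhat h i p.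
      move=> h2; rewrite -scaleN1r -[_ *: _]addr0 fhat_lin//; last exact: L2_0.
      by rewrite mulN1r [X in _ + X](_ : _ = 0) ?addr0// /fhat /hat; exact: ip0l.
    by rewrite !e1// Fh mulrN.
  by rewrite nrmN// -EFinD lee_fin ltW.
move=> g2; apply/eqP; rewrite eq_le H//=.
by have := H _ (L2N g2); rewrite opprK.
Qed.

Lemma VnormBC s f g : L2 f -> L2 g -> Vnorm s (f - g) = Vnorm s (g - f).
Proof. by move=> f2 g2; rewrite -opprB VnormN//; exact: L2B. Qed.

Lemma kap_ge1 k : k != 0 -> 1 <= kap R k.
Proof.
move=> k0; have [i ki] : exists i, k 0 i != 0.
  apply/existsP; apply: contraR k0; rewrite negb_exists => /forallP h.
  by apply/eqP/rowP => i; rewrite mxE; apply/eqP; have := h i; rewrite negbK.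
apply: le_trans (kap_ge R k i); rewrite -[1]/(1%:~R) ler_int.
by have : 0 < `|k 0 i| by rewrite normr_gt0.
Qed.

(** Fields of [H] have zero mean, and [kap k >= 1] at every other frequency. *)
Lemma Vnorm_mono s s' g : H g -> s <= s' -> (Vnorm s g <= Vnorm s' g)%E.
Proof.
move=> Hg ss; have g2 := H_L2 Hg; have := Vnorm_ge0 s' g.
case e: (Vnorm s' g) => [M| |]//; rewrite ?leey// lee_fin => M0.
apply/Vnorm_le => // ps us.
have h : (Vnorm s' g <= M%:E)%E by rewrite e.
apply: le_trans ((proj1 (Vnorm_le s' g2 M0) h) ps us).
apply: ler_sum => p _; apply: ler_sum => i _; have [p0|p0] := eqVneq p.1 0.
  by case: p p0 => k b /= ->; rewrite H_fhat0// !mulr0.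
rewrite !exprMn ler_wpM2r ?sqr_ge0// lerXn2r ?nnegrE ?powR_ge0//.
by rewrite ler_powR// kap_ge1.
Qed.

(** Poincare's inequality. After reduction to [s = 0], each truncation of [g] is bounded by a
    partial sum with weights [kap ^ 0 = 1], and truncations converge in [H]. *)
Lemma nrm_le_Vnorm s g : H g -> 0 <= s -> ((nrm g)%:E <= Vnorm s g)%E.
Proof.
move=> Hg s0; apply: le_trans (Vnorm_mono Hg s0); have g2 := H_L2 Hg.
have := Vnorm_ge0 0 g; case e: (Vnorm 0 g) => [M| |]//; rewrite ?leey// !lee_fin => M0.
apply/ler_addgt0Pr => eta eta0.
have [ks [ss _ /(_ ks ss) h]] := trunc_approx [::] Hg eta0.
have t2 := L2_trunc ks g.
have := nrmD t2 (L2B g2 t2); rewrite addrC subrK.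
have : nrm (trunc ks g) <= M; last by have := h (fun _ x => x); lra.
rewrite -(@ler_pXn2r _ 2) ?nnegrE ?nrm_ge0// sqr_nrm.
have hM : (Vnorm 0 g <= M%:E)%E by rewrite e.
have [us _] := kfull_sym ss.
apply: le_trans ((proj1 (Vnorm_le 0 g2 M0) hM) _ us).
rewrite {2}/trunc inner_tfield// /wsum le_eqVlt; apply/orP; left; apply/eqP.
apply: eq_big_seq => p pp; apply: eq_bigr => i _.
by rewrite fhat_trunc// pp mul1r powRr0 mul1r expr2.
Qed.

End leray.

(** * The spaces V^s *)

(** [fine] sends [+oo] to 0, so this is the norm only where [Vnorm] is finite, in particular on
    [V^s] by [VnormE]. *)
HB.lock Definition vn (R : realType) (d : nat) (s : R) (u : field R d) : R :=
  fine (Vnorm s u).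

Section sobolev_space.
Context (R : realType) (d : nat).
Implicit Types (f g h phi u v w : field R d) (p q : mode d)
  (ps : seq (mode d)) (ks : seq 'rV[int]_d) (k : 'rV[int]_d) (s : R).

(* Wrapping [V] in an inductive keeps the conversion test from unfolding it,
   which is very costly on terms such as [V s (u - v)]. *)
Variant inV s u : Prop := InV of V s u.

Lemma inV_V s u : inV s u -> V s u. Proof. by case. Qed.

Lemma V_H s u : inV s u -> H u. Proof. by case; case. Qed.

Lemma V_approx s u (e : R) : inV s u -> 0 < e ->
  exists phi, testV phi /\ (Vnorm s (u - phi)%R < e%:E)%E.
Proof. by case=> -[_]; apply. Qed.

Lemma V_intro s u : H u -> (forall e : R, 0 < e ->
  exists phi, testV phi /\ (Vnorm s (u - phi)%R < e%:E)%E) -> inV s u.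
Proof. by []. Qed.

Lemma vn_ge0 s u : 0 <= vn s u. Proof. by rewrite vn.unlock fine_ge0// Vnorm_ge0. Qed.

Lemma testV_Vnorm_lty s phi : testV phi -> (Vnorm s phi < +oo)%E.
Proof.
move=> vp; have [ks [ss tp _ _]] := testV_hat vp; have p2 := testV_L2 vp.
pose F := tfield (kfull ks) (fun i p => kap R p.1 `^ s * fhat phi i p).
apply: (@le_lt_trans _ _ (nrm F)%:E); last exact: ltry.
apply: Vnorm_le_nrm => //; first exact: L2_tfield.
move=> i p; rewrite fhat_tfield; last 2 first.
- exact: kfull_sym.
- by move=> q; rewrite kap_opp fhat_parity// mulrCA.
rewrite mem_kfull; have [pk|pk] := boolP (p.1 \in ks); first by rewrite mul1r.
by rewrite mul0r /fhat (hat_istrig ss (tp i))// mulr0.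
Qed.

Lemma testV_B f g : testV f -> testV g -> testV (f - g).
Proof. by move=> vf vg; rewrite addrC -scaleN1r; exact: testV_lin. Qed.

Lemma testV_V s phi : testV phi -> inV s phi.
Proof.
move=> vp; apply: V_intro => [|e e0]; first exact: testV_H.
exists phi; split => //; apply: (@le_lt_trans _ _ (nrm (0 : field R d))%:E).
  rewrite subrr; apply: Vnorm_le_nrm; [exact: L2_0|exact: L2_0|] => i p.
  by rewrite [fhat _ _ _](_ : _ = 0) ?mulr0// /fhat /hat; exact: ip0l.
by rewrite nrm0 lte_fin.
Qed.

Lemma V_L2 s u : inV s u -> L2 u. Proof. by move=> /V_H /H_L2. Qed.

Lemma VnormE s u : inV s u -> Vnorm s u = (vn s u)%:E.
Proof.
move=> Vu; have Hu := V_H Vu; rewrite vn.unlock fineK// ge0_fin_numE ?Vnorm_ge0//.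
have [phi [vp h]] := V_approx Vu ltr01; have p2 := testV_L2 vp; have u2 := H_L2 Hu.
have := VnormD s (L2B u2 p2) p2; rewrite subrK => /le_lt_trans; apply.
by apply: lte_add_pinfty; [apply: lt_trans h (ltry _)|exact: testV_Vnorm_lty].
Qed.

Lemma V_B s u v : inV s u -> inV s v -> inV s (u - v).
Proof.
move=> Vu Vv; have Hu := V_H Vu; have Hv := V_H Vv.
apply: V_intro => [|e e0]; first exact: HB.
have e2 : 0 < e / 2 by rewrite divr_gt0.
have [phi [vf h1]] := V_approx Vu e2; have [psi [vs h2]] := V_approx Vv e2.
exists (phi - psi); split; first exact: testV_B.
have u2 := H_L2 Hu; have v2 := H_L2 Hv; have f2 := testV_L2 vf; have s2 := testV_L2 vs.
rewrite (_ : _ - _ = (u - phi) + (psi - v)); last by rewrite opprB addrACA [RHS]addrACA (addrC (- v)).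
apply: le_lt_trans (VnormD s (L2B u2 f2) (L2B s2 v2)) _.
by rewrite (VnormBC s s2 v2) (splitr e) EFinD lteD.
Qed.

Lemma V_mono s s' u : inV s' u -> s <= s' -> inV s u.
Proof.
move=> Vu ss; have Hu := V_H Vu; apply: V_intro => // e e0.
have [phi [vp h]] := V_approx Vu e0.
exists phi; split => //; apply: le_lt_trans h; apply: Vnorm_mono => //.
by apply: HB => //; exact: testV_H.
Qed.

Lemma vn_mono s s' u : inV s' u -> s <= s' -> vn s u <= vn s' u.
Proof.
by move=> Vu ss; rewrite -lee_fin -!VnormE ?Vnorm_mono//; [exact: V_H Vu|exact: V_mono Vu ss].
Qed.

Lemma nrm_le_vn s u : inV s u -> 0 <= s -> nrm u <= vn s u.
Proof. by move=> Vu s0; rewrite -lee_fin -VnormE//; apply: nrm_le_Vnorm => //; exact: V_H Vu. Qed.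

Lemma wsum_le_vn s ps u : inV s u -> uniq ps -> wsum s ps u <= vn s u ^+ 2.
Proof.
move=> Vu us; apply: (proj1 (Vnorm_le s (V_L2 Vu) (vn_ge0 s u))) => //.
by rewrite VnormE.
Qed.

Lemma vn_le_wsum s u (M : R) : inV s u -> 0 <= M ->
  (forall ps, uniq ps -> wsum s ps u <= M ^+ 2) -> vn s u <= M.
Proof.
by move=> Vu M0 h; rewrite -lee_fin -VnormE//; apply/Vnorm_le => //; exact: V_L2 Vu.
Qed.

Lemma vn_triangle s u v w : inV s u -> inV s v -> inV s w ->
  vn s (u - w) <= vn s (u - v) + vn s (v - w).
Proof.
move=> Vu Vv Vw; rewrite -lee_fin EFinD -!VnormE; try exact: V_B.
rewrite -(subrKA v); apply: VnormD; apply: L2B.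
- exact: V_L2 Vu.
- exact: V_L2 Vv.
- exact: V_L2 Vv.
- exact: V_L2 Vw.
Qed.

Lemma vn_subC s u v : inV s u -> inV s v -> vn s (u - v) = vn s (v - u).
Proof. by move=> Vu Vv; rewrite vn.unlock VnormBC//; [exact: V_L2 Vu|exact: V_L2 Vv]. Qed.

Lemma vn_subr_le s u v : inV s u -> inV s v -> vn s u <= vn s v + vn s (u - v).
Proof.
move=> Vu Vv; rewrite -lee_fin EFinD -!VnormE//; last exact: V_B.
have v2 := V_L2 Vv; have u2 := V_L2 Vu.
by have := VnormD s v2 (L2B u2 v2); rewrite addrC subrK.
Qed.

Lemma wsum_trunc_le s ps ks u : ksym ks -> L2 u -> wsum s ps (trunc ks u) <= wsum s ps u.
Proof.
move=> ss u2; apply: ler_sum => p _; apply: ler_sum => i _; rewrite fhat_trunc//.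
by case: (_ \in _); rewrite ?mul1r// mul0r mulr0 expr0n sqr_ge0.
Qed.

Lemma vn_trunc_le s ks u : ksym ks -> inV s u -> vn s (trunc ks u) <= vn s u.
Proof.
move=> ss Vu; apply: vn_le_wsum; [|exact: vn_ge0|].
  by apply/testV_V/trunc_testV => //; exact: V_H Vu.
move=> ps us; apply: le_trans (wsum_le_vn Vu us); apply: wsum_trunc_le => //.
exact: V_L2 Vu.
Qed.

Lemma nrm_trunc_bound ks u : ksym ks -> L2 u -> nrm (trunc ks u) <= nrm u.
Proof.
move=> ss u2; have [us _] := kfull_sym ss.
rewrite -(@ler_pXn2r _ 2) ?nnegrE ?nrm_ge0// !sqr_nrm.
apply: le_trans (field_bessel u2 us); rewrite {2}/trunc inner_tfield; last exact: L2_trunc.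
rewrite le_eqVlt; apply/orP; left; apply/eqP.
by apply: eq_big_seq => p pp; apply: eq_bigr => i _; rewrite fhat_trunc// pp mul1r expr2.
Qed.

(** Once [ks] contains the frequencies of a test field [phi] near [u], the coefficients of
    [trunc ks u - u] vanish inside [ks] and are, up to sign, those of [u - phi] outside. *)
Lemma V_trunc s u (e : R) : inV s u -> 0 < e -> exists ks0, ksym ks0 /\
  forall ks, ksym ks -> {subset ks0 <= ks} -> vn s (trunc ks u - u) < e.
Proof.
move=> Vu e0; have Hu := V_H Vu; have [phi [vp h]] := V_approx Vu e0.
have [ks0 [ss0 tp _ _]] := testV_hat vp; exists ks0; split => // ks ss sub.
have u2 := H_L2 Hu; have p2 := testV_L2 vp.
have Vp : inV s (u - phi) by apply: V_B => //; exact: testV_V.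
have Vt : inV s (trunc ks u - u).
  by apply: V_B => //; apply/testV_V/trunc_testV.
apply: (@le_lt_trans _ _ (vn s (u - phi))); last by rewrite -lte_fin -VnormE.
apply: vn_le_wsum => //; first exact: vn_ge0.
move=> ps us; apply: le_trans (wsum_le_vn Vp us).
apply: ler_sum => p _; apply: ler_sum => i _.
rewrite !fhatB ?fhat_trunc//; last exact: L2_trunc.
have [pk|pk] := boolP (p \in kfull ks); first by rewrite mul1r subrr mulr0 expr0n sqr_ge0.
have z : fhat phi i p = 0.
  by apply: (hat_istrig ss0 (tp i)); apply: contra pk; rewrite mem_kfull; exact: sub.
by rewrite mul0r sub0r mulrN sqrrN z subr0.
Qed.

(** Finiteness of the norm says that the infimum runs over a nonempty set, so the choice in
    [fraclap] is a genuine representative. *)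
Lemma fraclap_spec (al : R) u : inV (2 * al) u -> L2 (fraclap al u) /\
  forall i p, fhat (fraclap al u) i p = kap R p.1 `^ (2 * al) * fhat u i p.
Proof.
move=> Vu; have : (Vnorm (2 * al) u < (vn (2 * al) u + 1)%:E)%E.
  by rewrite VnormE// lte_fin ltrDl.
have e : 2 * al / 2 = al by field.
have := fraclap_reprP (2 * al) u (fraclap al u); rewrite e.
move=> [toP _] /ereal_inf_lt[y [F]]; rewrite e => rF _ _.
have : fraclap_repr al u (fraclap al u) by apply: xgetPex; exists F.
by move=> /toP[].
Qed.

Lemma stokes_spec (al : R) u : inV (2 * al) u -> exists F, [/\ L2 F,
  forall i p, fhat F i p = kap R p.1 `^ (2 * al) * fhat u i p, H (stokes al u)
  & forall phi, H phi -> inner (stokes al u) phi = inner F phi].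
Proof.
move=> /fraclap_spec[F2 Fh]; exists (fraclap al u).
by have [HF iF] := leray_spec F2; split.
Qed.

Lemma stokes_H (al : R) u : inV (2 * al) u -> H (stokes al u).
Proof. by move=> /stokes_spec[F []]. Qed.

Lemma nrm_stokes_le (al : R) u : inV (2 * al) u -> nrm (stokes al u) <= vn (2 * al) u.
Proof.
move=> Vu; have [F [F2 Fh HS iS]] := stokes_spec Vu.
move: (stokes al u) HS iS => S HS iS.
apply/ler_addgt0Pr => e e0; apply: nrm_le_of_testV => //.
  by rewrite addr_ge0 ?vn_ge0// ltW.
move=> phi vp; rewrite iS; last exact: testV_H.
(* [F] and a nearly optimal representative [G] have the same coefficients, hence the same pairing
   with test fields. *)
have : (Vnorm (2 * al) u < (vn (2 * al) u + e)%:E)%E.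
  by rewrite VnormE// lte_fin ltrDl.
move=> /Vnorm_lt[G [_ G2 Gh nG]].
have -> : inner F phi = inner G phi.
  have [ks [ss tp _ _]] := testV_hat vp.
  rewrite (istrig_field tp) !inner_tfield//; apply: eq_bigr => p _; apply: eq_bigr => i _.
  by rewrite Fh Gh.
apply: le_trans (ler_norm _) _; apply: le_trans (inner_CS G2 (testV_L2 vp)) _.
by rewrite ler_wpM2r ?nrm_ge0// ltW.
Qed.

(** Against a truncation of [w], the pairing is exactly the weighted sum, as
    [kap ^ (2 al) = (kap ^ al)^2]. Replacing the truncation by [w] costs at most
    [nrm D * nrm (w - trunc ks w)]. *)
Lemma stokes_coercive (al : R) u v : 0 <= al -> inV (2 * al) u -> inV (2 * al) v ->
  vn al (u - v) ^+ 2 <= inner (stokes al u - stokes al v) (u - v).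
Proof.
move=> al0 Vu Vv; have [F [F2 Fh HSu iSu]] := stokes_spec Vu.
have [G [G2 Gh HSv iSv]] := stokes_spec Vv.
move: (stokes al u) (stokes al v) HSu HSv iSu iSv => Su Sv HSu HSv iSu iSv.
have Vw := V_B Vu Vv; set w := u - v in Vw *.
have Hw := V_H Vw; have w2 := H_L2 Hw; have u2 := V_L2 Vu; have v2 := V_L2 Vv.
have D2 := L2B F2 G2.
have -> : inner (Su - Sv) w = inner (F - G) w.
  by rewrite innerBl ?iSu ?iSv -?innerBl//; exact: H_L2.
set D := F - G in D2 *.
have Va : inV al w by apply: V_mono Vw _; rewrite ler_peMl ?ler1n.
suff key ps : uniq ps -> wsum al ps w <= inner D w.
  have I0 : 0 <= inner D w by have := key [::] isT; rewrite /wsum big_nil.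
  rewrite -(sqr_sqrtr I0) lerXn2r ?nnegrE ?sqrtr_ge0 ?vn_ge0//.
  by apply: vn_le_wsum => // ps us; rewrite sqr_sqrtr// key.
move=> us; apply/ler_addgt0Pr => e e0.
have c0 : 0 < nrm D + 1 by rewrite ltr_wpDl ?nrm_ge0.
have [ks [ss sub /(_ ks ss (fun _ x => x)) h]] := trunc_approx ps Hw (divr_gt0 e0 c0).
have t2 := L2_trunc ks w.
apply: (@le_trans _ _ (inner D (trunc ks w))).
  apply: (@le_trans _ _ (wsum al (kfull ks) w)).
    apply: ler_sum_uniq_subset => //; first by have [] := kfull_sym ss.
    by move=> p; apply: sumr_ge0 => i _; exact: sqr_ge0.
  rewrite /trunc inner_tfield// le_eqVlt; apply/orP; left; apply/eqP.
  apply: eq_bigr => p _; apply: eq_bigr => i _.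
  rewrite /D fhatB// Fh Gh /w fhatB// -mulrBr.
  have -> : kap R p.1 `^ (2 * al) = kap R p.1 `^ al ^+ 2.
    by rewrite mulrC powRrM powR_mulrn// powR_ge0.
  ring.
have -> : inner D w = inner D (trunc ks w) + inner D (w - trunc ks w).
  by rewrite innerBr// addrC subrK.
have := inner_CS D2 (L2B w2 t2); rewrite ler_norml => /andP[h1 _].
have h2 : nrm D * nrm (w - trunc ks w) <= e.
  apply: (@le_trans _ _ ((nrm D + 1) * nrm (w - trunc ks w))).
    by rewrite ler_wpM2r ?nrm_ge0// lerDl.
  by rewrite mulrC -ler_pdivlMr.
lra.
Qed.

(** Meant for the interpolation error [Ih w - w], which lies in L2 but is not known to be in [H].
    Against test fields it may be exchanged for a representative with the same coefficients and norm
    close to [M]. *)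
Lemma inner_le_Vnorm0 g w (M : R) : L2 g -> H w -> (Vnorm 0 g <= M%:E)%E ->
  `|inner g w| <= M * nrm w.
Proof.
move=> g2 Hw gM; have M0 : 0 <= M by rewrite -lee_fin (le_trans (Vnorm_ge0 0 g)).
have h u : H u -> inner g u <= M * nrm u.
  move=> Hu; apply: inner_le_of_testV => // phi vp.
  have p2 := testV_L2 vp; apply/ler_addgt0Pr => e e0.
  have c0 : 0 < nrm phi + 1 by rewrite ltr_wpDl ?nrm_ge0.
  have : (Vnorm 0 g < (M + e / (nrm phi + 1))%:E)%E.
    by apply: le_lt_trans gM _; rewrite lte_fin ltrDl divr_gt0.
  move=> /Vnorm_lt[G [_ G2 Gh nG]].
  have -> : inner g phi = inner G phi.
    have [ks [ss tp _ _]] := testV_hat vp.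
    rewrite (istrig_field tp) !inner_tfield//; apply: eq_bigr => p _; apply: eq_bigr => i _.
    by rewrite Gh powRr0 mul1r.
  apply: le_trans (ler_norm _) _; apply: le_trans (inner_CS G2 p2) _.
  apply: (@le_trans _ _ ((M + e / (nrm phi + 1)) * nrm phi)).
    by rewrite ler_wpM2r ?nrm_ge0// ltW.
  rewrite mulrDl lerD2l mulrAC ler_pdivrMr// ler_pM2l// lerDl//.
rewrite ler_norml h// andbT lerNl -mulN1r -innerZr//; last exact: H_L2.
apply: le_trans (h _ (HZ (-1) Hw)) _.
by rewrite scaleN1r nrmN//; exact: H_L2.
Qed.

End sobolev_space.

Lemma weighted_CS (R : realFieldType) (I : Type) (s : seq I) (x y w : I -> R) :
  (forall i, 0 < w i) ->
  (\sum_(i <- s) x i * y i) ^+ 2 <=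
  (\sum_(i <- s) x i ^+ 2 * w i) * (\sum_(i <- s) y i ^+ 2 / w i).
Proof.
move=> w0; rewrite mulrC; apply: quadratic_discriminant => [|t].
  by apply: sumr_ge0 => i _; rewrite mulr_ge0 ?sqr_ge0// ltW.
rewrite !mulr_sumr -!big_split /=; apply: sumr_ge0 => i _.
rewrite (_ : _ + _ = (y i + t * x i * w i) ^+ 2 / w i); last by field; rewrite gt_eqF.
by rewrite divr_ge0 ?sqr_ge0// ltW.
Qed.

(** * The nonlinear term *)

Section trilinear.
Context (R : realType) (d : nat).
Let mu : probability (d.-tuple R) R := torus_measure R d.
Implicit Types (f g h : d.-tuple R -> R) (phi psi u v w : field R d) (p q : mode d)
  (ps : seq (mode d)) (ks : seq 'rV[int]_d) (k : 'rV[int]_d) (s : R) (a b : mode d -> R).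

Lemma L2_bounded_cs p q : (fun x => cs p x * cs q x) \in Lfun mu 2%:E.
Proof.
apply: (@bounded_Lfun2M _ _ _ mu (cs p) (cs q) 1); last exact: Lfun2_cs.
  exact: measurable_cs.
exact: cs_le1.
Qed.

Lemma ip_csM f p q : f \in Lfun mu 2%:E -> ip mu f (fun x => cs p x * cs q x) =
  2^-1 * ((if p.2 || q.2 then 1 else -1) * hat f (p.1 + q.1, p.2 == q.2) +
          (if p.2 && ~~ q.2 then -1 else 1) * hat f (p.1 - q.1, p.2 == q.2)).
Proof.
move=> f2; have L r : cs r \in Lfun mu 2%:E by exact: Lfun2_cs.
transitivity (ip mu f (fun x =>
    2^-1 * ((if p.2 || q.2 then 1 else -1) * cs (p.1 + q.1, p.2 == q.2) x +
            (if p.2 && ~~ q.2 then -1 else 1) * cs (p.1 - q.1, p.2 == q.2) x))).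
  by congr ip; apply/funext => x; rewrite csM.
rewrite ipC ipZl//; last by apply: Lfun2_lin => //; exact: Lfun2Z.
rewrite ip_linl//; last exact: Lfun2Z.
by rewrite ipZl// /hat !(ipC mu f).
Qed.

Lemma ip_tpolyM f ps a b : f \in Lfun mu 2%:E ->
  ip mu f (fun x => tpoly ps a x * tpoly ps b x) =
  \sum_(p <- ps) \sum_(q <- ps) a p * b q * ip mu f (fun x => cs p x * cs q x).
Proof.
move=> f2.
have -> : (fun x => tpoly ps a x * tpoly ps b x) =
    (fun x => \sum_(p <- ps) \sum_(q <- ps) a p * b q * (cs p x * cs q x)).
  apply/funext => x; rewrite /tpoly mulr_suml; apply: eq_bigr => p _.
  by rewrite mulr_sumr; apply: eq_bigr => q _; ring.
have L p q : (fun x => a p * b q * (cs p x * cs q x)) \in Lfun mu 2%:E.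
  by apply: Lfun2Z; exact: L2_bounded_cs.
rewrite ip_sumr//; last by move=> p; exact: Lfun2_sum.
apply: eq_bigr => p _; rewrite ip_sumr//; apply: eq_bigr => q _.
by rewrite ipC ipZl ?(ipC mu f)//; exact: L2_bounded_cs.
Qed.

(* The weights split as 2 / (W p * W q) <= W p ^- 2 + W q ^- 2, after which
   Bessel's inequality applies along each row and each column. *)
Lemma double_sum_le f ps (W : mode d -> R) (c : mode d -> mode d -> R)
    (m : mode d -> mode d -> mode d) a b :
  f \in Lfun mu 2%:E -> uniq ps -> (forall p, 0 < W p) ->
  (forall p q, c p q ^+ 2 = 1) -> (forall p, injective (m p)) ->
  (forall q, injective (m ^~ q)) ->
  (\sum_(p <- ps) \sum_(q <- ps) a p * b q * (c p q * hat f (m p q))) ^+ 2 <=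
  ip mu f f * (\sum_(p <- ps) (W p) ^- 2) *
  ((\sum_(p <- ps) a p ^+ 2 * W p) * (\sum_(p <- ps) b p ^+ 2 * W p)).
Proof.
move=> f2 ups W0 c2 ml mr.
pose L := [seq (p, q) | p <- ps, q <- ps].
have LE (F : mode d -> mode d -> R) :
    \sum_(r <- L) F r.1 r.2 = \sum_(p <- ps) \sum_(q <- ps) F p q.
  by rewrite /L big_allpairs_dep.
rewrite -(LE (fun p q => a p * b q * (c p q * hat f (m p q)))).
have := @weighted_CS R _ L (fun r => a r.1 * b r.2)
  (fun r => c r.1 r.2 * hat f (m r.1 r.2)) (fun r => W r.1 * W r.2)
  (fun r => mulr_gt0 (W0 _) (W0 _)).
move=> /le_trans; apply.
rewrite (LE (fun p q => (a p * b q) ^+ 2 * (W p * W q))).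
rewrite (LE (fun p q => (c p q * hat f (m p q)) ^+ 2 / (W p * W q))).
have -> : \sum_(p <- ps) \sum_(q <- ps) (a p * b q) ^+ 2 * (W p * W q) =
    (\sum_(p <- ps) a p ^+ 2 * W p) * (\sum_(p <- ps) b p ^+ 2 * W p).
  rewrite mulr_suml; apply: eq_bigr => p _; rewrite mulr_sumr.
  by apply: eq_bigr => q _; rewrite exprMn; ring.
rewrite mulrC ler_wpM2r//.
  by apply: mulr_ge0; apply: sumr_ge0 => p _; rewrite mulr_ge0 ?sqr_ge0// ltW.
have bl p : \sum_(q <- ps) hat f (m p q) ^+ 2 <= ip mu f f.
  rewrite -(big_map (m p) predT (fun r => hat f r ^+ 2)); apply: bessel => //.
  by rewrite map_inj_uniq.
have br q : \sum_(p <- ps) hat f (m p q) ^+ 2 <= ip mu f f.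
  rewrite -(big_map (m ^~ q) predT (fun r => hat f r ^+ 2)); apply: bessel => //.
  by rewrite map_inj_uniq.
apply: (@le_trans _ _ (\sum_(p <- ps) \sum_(q <- ps)
    (2^-1 * (hat f (m p q) ^+ 2 * (W p) ^- 2) + 2^-1 * (hat f (m p q) ^+ 2 * (W q) ^- 2)))).
  apply: ler_sum => p _; apply: ler_sum => q _; rewrite exprMn c2 mul1r.
  rewrite -mulrDr -mulrDr mulrCA ler_wpM2l ?sqr_ge0// -subr_ge0.
  rewrite (_ : _ - _ = 2^-1 * ((W p)^-1 - (W q)^-1) ^+ 2); last first.
    by field; rewrite !gt_eqF.
  by rewrite mulr_ge0 ?sqr_ge0.
under eq_bigr do rewrite big_split /= -!mulr_sumr -mulr_suml.
rewrite big_split /= -!mulr_sumr exchange_big /=.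
under [X in _ + _ * X]eq_bigr do rewrite -mulr_suml.
have w2 p : 0 <= (W p) ^- 2 by rewrite invr_ge0 sqr_ge0.
have h1 : \sum_(p <- ps) (\sum_(q <- ps) hat f (m p q) ^+ 2) * (W p) ^- 2 <=
    ip mu f f * \sum_(p <- ps) (W p) ^- 2.
  by rewrite mulr_sumr; apply: ler_sum => p _; exact: ler_wpM2r.
have h2 : \sum_(q <- ps) (\sum_(p <- ps) hat f (m p q) ^+ 2) * (W q) ^- 2 <=
    ip mu f f * \sum_(p <- ps) (W p) ^- 2.
  by rewrite mulr_sumr; apply: ler_sum => p _; exact: ler_wpM2r.
lra.
Qed.

(** The product-to-sum formula turns the product of modes [p] and [q] into modes at the sum and at
    the difference of their frequencies. Each gives a double sum whose mode map is injective in
    either variable, and the average of the two is squared by convexity. *)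
Lemma trilinear_le f ps (W : mode d -> R) a b : f \in Lfun mu 2%:E -> uniq ps ->
  (forall p, 0 < W p) ->
  ip mu f (fun x => tpoly ps a x * tpoly ps b x) ^+ 2 <=
  ip mu f f * (\sum_(p <- ps) (W p) ^- 2) *
  ((\sum_(p <- ps) a p ^+ 2 * W p) * (\sum_(p <- ps) b p ^+ 2 * W p)).
Proof.
move=> f2 ups W0; rewrite ip_tpolyM//.
pose c1 p q : R := if p.2 || q.2 then 1 else -1.
pose c2 p q : R := if p.2 && ~~ q.2 then -1 else 1.
pose m1 p q : mode d := (p.1 + q.1, p.2 == q.2).
pose m2 p q : mode d := (p.1 - q.1, p.2 == q.2).
have eqb_inj (b0 b1 b2 : bool) : (b0 == b1) = (b0 == b2) -> b1 = b2.
  by case: b0; case: b1; case: b2.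
have h1 := @double_sum_le f ps W c1 m1 a b f2 ups W0.
have h2 := @double_sum_le f ps W c2 m2 a b f2 ups W0.
have {}h1 := h1 ltac:(by move=> p q; rewrite /c1; case: ifP; rewrite ?sqrrN expr1n)
  ltac:(by move=> p [k b1] [k' b2] [/addrI -> /eqb_inj ->])
  ltac:(by move=> q [k b1] [k' b2] [/addIr -> ]; rewrite ![_ == q.2]eq_sym => /eqb_inj ->).
have {}h2 := h2 ltac:(by move=> p q; rewrite /c2; case: ifP; rewrite ?sqrrN expr1n)
  ltac:(by move=> p [k b1] [k' b2] [/addrI /oppr_inj -> /eqb_inj ->])
  ltac:(by move=> q [k b1] [k' b2] [/addIr -> ]; rewrite ![_ == q.2]eq_sym => /eqb_inj ->).
set X1 := \sum_(p <- ps) _ in h1; set X2 := \sum_(p <- ps) _ in h2.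
have -> : \sum_(p <- ps) \sum_(q <- ps) a p * b q * ip mu f (fun x => cs p x * cs q x) =
    2^-1 * (X1 + X2).
  rewrite /X1 /X2 -big_split mulr_sumr; apply: eq_bigr => p _ /=.
  rewrite -big_split mulr_sumr; apply: eq_bigr => q _ /=.
  by rewrite ip_csM// -/(c1 p q) -/(c2 p q) -/(m1 p q) -/(m2 p q); ring.
apply: (@le_trans _ _ (2^-1 * (X1 ^+ 2 + X2 ^+ 2))); last by lra.
rewrite -subr_ge0 (_ : _ - _ = (2^-1 * (X1 - X2)) ^+ 2); last by field.
exact: sqr_ge0.
Qed.

End trilinear.

(** * Calculus of trigonometric functions and skew-symmetry of advection *)

Section trig_calculus.
Context (R : realType) (d : nat).
Let mu : probability (d.-tuple R) R := torus_measure R d.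
Implicit Types (f g h : d.-tuple R -> R) (phi psi u v w : field R d) (p q : mode d)
  (ps : seq (mode d)) (ks : seq 'rV[int]_d) (k : 'rV[int]_d) (s : R).

Definition trig f := exists ks, ksym ks /\ istrig ks f.

Lemma trig_join f g : trig f -> trig g -> exists ks, [/\ ksym ks, istrig ks f & istrig ks g].
Proof.
move=> [ks1 [s1 t1]] [ks2 [s2 t2]]; have ss := kunion_sym s1 s2.
exists (undup (ks1 ++ ks2)); split => //.
- by apply: istrig_sub t1 => // k kk; rewrite mem_undup mem_cat kk.
- by apply: istrig_sub t2 => // k kk; rewrite mem_undup mem_cat kk orbT.
Qed.

Lemma trig_lin (c : R) f g : trig f -> trig g -> trig (fun x => c * f x + g x).
Proof.
move=> tf tg; have [ks [ss t1 t2]] := trig_join tf tg.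
by exists ks; split => //; exact: istrig_lin.
Qed.

Lemma trig0 : trig (fun=> 0).
Proof.
exists [::]; split => //; apply/funext => x; rewrite /tpoly big_allpairs_dep big_nil//.
Qed.

Lemma trig_cs p : trig (cs p).
Proof.
exists (kclose [:: p]); split; first exact: kclose_sym.
by apply: istrig_cs; [exact: kclose_sym|rewrite mem_undup mem_cat mem_head].
Qed.

Lemma trig_ext f g : f =1 g -> trig f -> trig g.
Proof. by move=> /funext ->. Qed.

Lemma trigZ (c : R) f : trig f -> trig (fun x => c * f x).
Proof. by move=> tf; apply: trig_ext (trig_lin c tf trig0) => x; rewrite addr0. Qed.

Lemma trigD f g : trig f -> trig g -> trig (fun x => f x + g x).
Proof. by move=> tf tg; apply: trig_ext (trig_lin 1 tf tg) => x; rewrite mul1r. Qed.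

Lemma trig_sum (I : Type) (r : seq I) (F : I -> d.-tuple R -> R) :
  (forall i, trig (F i)) -> trig (fun x => \sum_(i <- r) F i x).
Proof.
move=> tF; elim: r => [|i r ih].
  by apply: trig_ext trig0 => x; rewrite big_nil.
by apply: trig_ext (trigD (tF i) ih) => x; rewrite big_cons.
Qed.

Lemma trigM f g : trig f -> trig g -> trig (fun x => f x * g x).
Proof.
move=> [ks1 [_ t1]] [ks2 [_ t2]].
apply: (@trig_ext (fun x => \sum_(p <- kfull ks1) \sum_(q <- kfull ks2)
    hat f p * hat g q * (cs p x * cs q x))).
  move=> x; rewrite [in RHS]t1 [in RHS]t2 /tpoly mulr_suml; apply: eq_bigr => p _.
  by rewrite mulr_sumr; apply: eq_bigr => q _; ring.
apply: trig_sum => p; apply: trig_sum => q; apply: trigZ.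
apply: (@trig_ext (fun x => 2^-1 *
  ((if p.2 || q.2 then 1 else -1) * cs (p.1 + q.1, p.2 == q.2) x
 + (if p.2 && ~~ q.2 then -1 else 1) * cs (p.1 - q.1, p.2 == q.2) x))).
  by move=> x; rewrite csM.
by apply: trigZ; apply: trig_lin; [|apply: trigZ]; exact: trig_cs.
Qed.

Lemma trig_L2 f : trig f -> f \in Lfun mu 2%:E.
Proof. by move=> [ks [_ /istrig_L2]]. Qed.

Lemma trig_measurable f : trig f -> measurable_fun setT f.
Proof. by move=> /trig_L2 /(Lfun2_measurable (P := mu)). Qed.

Lemma trig_partial j f : trig f -> trig (partial j f).
Proof.
move=> [ks [ss tf]]; exists ks; split => //; rewrite (partial_istrig j tf).
by apply: istrig_tpoly => //; apply/dcoef_parity/hat_parity/(istrig_L2 tf).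
Qed.

Lemma trig_is_derive j f (x : d.-tuple R) : trig f ->
  is_derive (tnth x j) 1 (fun r => f (subst_coord x j r)) (partial j f x).
Proof.
move=> [ks [ss tf]]; rewrite /partial derive1E {1 2}tf.
have h := is_derive_tpoly j (kfull ks) (hat f) x (tnth x j).
by apply: DeriveDef; case: h.
Qed.

Lemma partialM j f g (x : d.-tuple R) : trig f -> trig g ->
  partial j (fun y => f y * g y) x = partial j f x * g x + f x * partial j g x.
Proof.
move=> tf tg; have df := trig_is_derive j x tf; have dg := trig_is_derive j x tg.
rewrite {1}/partial derive1E.
apply: etrans; first exact: (@derive_val _ _ _ _ _ _ _ (is_deriveM df dg)).
by rewrite /GRing.scale /= subst_coord_id; ring.
Qed.

Lemma partial_lin j (c : R) f g (x : d.-tuple R) : trig f -> trig g ->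
  partial j (fun y => c * f y + g y) x = c * partial j f x + partial j g x.
Proof.
move=> tf tg; have df := trig_is_derive j x tf; have dg := trig_is_derive j x tg.
rewrite {1}/partial derive1E.
exact: (@derive_val _ _ _ _ _ _ _ (is_deriveD (is_deriveZ c df) dg)).
Qed.

(** The mean is the coefficient at frequency 0, where differentiation multiplies by zero. *)
Lemma Rintegral_partial j f : trig f -> (\int[mu]_x partial j f x)%R = 0.
Proof.
move=> [ks [ss tf]]; rewrite Rintegral_hat (hat_partial j _ ss tf).
by rewrite /dcoef /= mxE !mulr0 mul0r.
Qed.

Lemma testV_trig phi i : testV phi -> trig (phi i).
Proof. by move=> /testV_hat[ks [ss tp _ _]]; exists ks. Qed.

Lemma trig_advection u v i : testV u -> testV v -> trig (advection u v i).
Proof.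
move=> vu vv; apply: trig_sum => j.
by apply: trigM; [|apply: trig_partial]; exact: testV_trig.
Qed.

Lemma L2_advection u v : testV u -> testV v -> L2 (advection u v).
Proof. by move=> vu vv i; apply: trig_L2; exact: trig_advection. Qed.

(** As [u] is divergence-free, twice the integrand of each component is [sum_j d_j (u_j w_i^2)], a
    sum of derivatives of trigonometric polynomials. *)
Lemma advection_skew u w : testV u -> testV w -> inner (advection u w) w = 0.
Proof.
move=> vu vw; have tu j := testV_trig j vu; have tw j := testV_trig j vw.
rewrite innerE; [|exact: L2_advection|exact: testV_L2].
rewrite big1// => i _.
have t3 j : trig (fun x => u j x * (w i x * w i x)).
  by apply: trigM => //; exact: trigM.
have Z : (\int[mu]_x \sum_(j < d) partial j (fun y => u j y * (w i y * w i y)) x)%R = 0.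
  rewrite /Rintegral; under eq_integral do rewrite -sumEFin.
  have L1 j : mu.-integrable setT (EFin \o partial j (fun y => u j y * (w i y * w i y))).
    apply/Lfun1_integrable; apply: Lfun_subset12; first exact: fin_num_measure.
    exact/trig_L2/trig_partial.
  rewrite integral_sum// -sum_fine//; last by move=> j _; apply: integrable_fin_num => //;
    exact: L1.
  by rewrite big1// => j _; exact: Rintegral_partial.
have E x : \sum_(j < d) partial j (fun y => u j y * (w i y * w i y)) x =
    2 * (advection u w i x * w i x).
  under eq_bigr => j _ do rewrite (partialM j x (tu j) (trigM (tw i) (tw i))) (partialM j x (tw i) (tw i)).
  rewrite big_split /= -mulr_suml -/(divergence u x).
  have [_ -> _] := vu; rewrite mul0r add0r /advection mulr_suml mulr_sumr.
  by apply: eq_bigr => j _; ring.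
have : ip mu (fun x => 2 * advection u w i x) (w i) = 0.
  by rewrite -[RHS]Z; apply: eq_Rintegral => x _; rewrite E mulrA.
rewrite ipZl; [|by apply/trig_L2/trig_advection|exact/trig_L2].
by move=> /eqP; rewrite mulf_eq0 pnatr_eq0 => /eqP.
Qed.

Lemma advectionBl u u' v : advection (u - u') v = advection u v - advection u' v.
Proof.
apply/funext => i; apply/funext => x.
rewrite -[RHS]/(advection u v i x - advection u' v i x) /advection -sumrB.
by apply: eq_bigr => j _; rewrite -mulrBl.
Qed.

Lemma advectionBr u v v' : testV v -> testV v' ->
  advection u (v - v') = advection u v - advection u v'.
Proof.
move=> vv vv'; apply/funext => i; apply/funext => x.
rewrite -[RHS]/(advection u v i x - advection u v' i x) /advection -sumrB.
apply: eq_bigr => j _; rewrite -mulrBr; congr (_ * _).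
have := partial_lin j (-1) x (testV_trig i vv') (testV_trig i vv).
rewrite mulN1r addrC => <-; congr (partial j _ x); apply/funext => y.
by rewrite mulN1r addrC.
Qed.

End trig_calculus.

(** * Estimates for the advection of test fields *)

Section advection_bounds.
Context (R : realType) (d : nat).
Let mu : probability (d.-tuple R) R := torus_measure R d.
Implicit Types (f g h : d.-tuple R -> R) (phi psi u v w : field R d) (p q : mode d)
  (ps : seq (mode d)) (ks : seq 'rV[int]_d) (k : 'rV[int]_d) (s al N S : R).

(** The embedding of [V^(2 alpha)] into bounded functions, by Cauchy-Schwarz on the Fourier sum with
    weights [W_k^2] at [N = 1]. The factor 2 comes from [W_k <= 2 * kap k ^ (2 al)] at nonzero
    frequencies. *)
Lemma testV_sup_le al S phi j (x : d.-tuple R) : 0 <= al -> 0 <= S ->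
  (forall ps, uniq ps -> \sum_(p <- ps) (wt al 1 p.1) ^- 2 <= S) -> testV phi ->
  `|phi j x| <= 2 * Num.sqrt S * vn (2 * al) phi.
Proof.
move=> al0 S0 hS vp; have [ks [ss tp _ z]] := testV_hat vp; have [us _] := kfull_sym ss.
have w0 k : 0 < wt al 1 k :> R by apply: lt_le_trans (wt_ge1 _ _ _).
have c0 : 0 <= 2 * Num.sqrt S * vn (2 * al) phi.
  by rewrite !mulr_ge0 ?sqrtr_ge0 ?vn_ge0.
rewrite -(@ler_pXn2r _ 2) ?nnegrE// real_normK ?num_real//.
rewrite (_ : phi j x = \sum_(p <- kfull ks) fhat phi j p * cs p x); last by rewrite {1}tp.
apply: le_trans (@weighted_CS _ _ _ _ _ (fun p => wt al 1 p.1 ^+ 2) _) _.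
  by move=> p; rewrite exprn_gt0.
have h1 : \sum_(p <- kfull ks) fhat phi j p ^+ 2 * wt al 1 p.1 ^+ 2 <= 2 ^+ 2 * vn (2 * al) phi ^+ 2.
  have := wsum_le_vn (testV_V (2 * al) vp) us => /(ler_wpM2l (sqr_ge0 2)); apply: le_trans.
  rewrite /wsum mulr_sumr; apply: ler_sum => p _.
  rewrite (bigD1 j)//= mulrDr -[leLHS]addr0 lerD//; last first.
    by rewrite mulr_ge0 ?sqr_ge0// sumr_ge0// => i _; exact: sqr_ge0.
  have [p0|p0] := eqVneq p.1 0.
    by case: p p0 => k b /= ->; rewrite z expr0n mul0r mulr_ge0 ?sqr_ge0.
  set K := kap R p.1 `^ (2 * al).
  have K1 : 1 <= K by rewrite -(powRr0 (kap R p.1)) /K ler_powR ?kap_ge1// mulr_ge0.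
  rewrite (_ : 2 ^+ 2 * (K * fhat phi j p) ^+ 2 = fhat phi j p ^+ 2 * (2 * K) ^+ 2); last by ring.
  rewrite ler_wpM2l ?sqr_ge0// lerXn2r ?nnegrE ?mulr_ge0 ?powR_ge0 ?(ltW (w0 _))//.
  by rewrite /wt divr1 -/K; lra.
have h2 : \sum_(p <- kfull ks) cs p x ^+ 2 / wt al 1 p.1 ^+ 2 <= S.
  apply: le_trans (hS _ us); apply: ler_sum => p _.
  rewrite -[leRHS]mul1r ler_wpM2r ?invr_ge0 ?sqr_ge0//.
  by rewrite -[_ ^+ 2]real_normK ?num_real// expr_le1 ?cs_le1.
apply: le_trans (ler_pM _ _ h1 h2) _.
- by apply: sumr_ge0 => p _; rewrite mulr_ge0 ?sqr_ge0.
- by apply: sumr_ge0 => p _; rewrite divr_ge0 ?sqr_ge0.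
- by rewrite !exprMn (sqr_sqrtr S0) mulrAC.
Qed.

Definition dfield j phi : field R d := fun i => partial j (phi i).

Lemma L2_dfield j phi : testV phi -> L2 (dfield j phi).
Proof. by move=> vp i; apply/trig_L2/trig_partial; exact: testV_trig. Qed.

Lemma freq_le_kap k j : `|2 * pi * (k 0 j)%:~R| <= kap R k.
Proof.
rewrite normrM ger0_norm ?mulr_ge0 ?pi_ge0// /kap ler_wpM2l ?mulr_ge0 ?pi_ge0//.
rewrite -sqrtr_sqr /kabs ler_wsqrtr// (bigD1 j)//= lerDl sumr_ge0// => i _.
exact: sqr_ge0.
Qed.

Lemma nrm_dfield_le j phi : testV phi -> nrm (dfield j phi) <= vn 1 phi.
Proof.
move=> vp; have [ks [ss tp _ _]] := testV_hat vp; have [us _] := kfull_sym ss.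
have D2 := L2_dfield j vp; have p2 := testV_L2 vp.
rewrite -(@ler_pXn2r _ 2) ?nnegrE ?nrm_ge0 ?vn_ge0// sqr_nrm.
apply: le_trans (wsum_le_vn (testV_V 1 vp) us).
have e : dfield j phi = tfield (kfull ks) (fun i => dcoef j (fhat phi i)).
  by apply/funext => i; exact: partial_istrig (tp i).
rewrite {2}e inner_tfield// /wsum !big_kfull; apply: ler_sum => k _.
have hd i b : fhat (dfield j phi) i (k, b) = dcoef j (fhat phi i) (k, b).
  exact: (hat_partial j (k, b) ss (tp i)).
rewrite -!big_split /=; apply: ler_sum => i _; rewrite !hd /dcoef /par /=.
move: (kap R k) (kap_ge0 R k) (freq_le_kap k j) => K K0 h.
rewrite !powRr1// !exprMn.
rewrite -(@ler_pXn2r _ 2) ?nnegrE// real_normK ?num_real// in h.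
set t := fhat phi i (k, true); set f := fhat phi i (k, false); set c := 2 * pi * _ in h *.
have ht : c ^+ 2 * t ^+ 2 <= K ^+ 2 * t ^+ 2 by rewrite ler_wpM2r ?sqr_ge0.
have hf : c ^+ 2 * f ^+ 2 <= K ^+ 2 * f ^+ 2 by rewrite ler_wpM2r ?sqr_ge0.
nra.
Qed.

Lemma nrm_sum_le (I : Type) (r : seq I) (F : I -> field R d) : (forall i, L2 (F i)) ->
  nrm (\sum_(i <- r) F i) <= \sum_(i <- r) nrm (F i).
Proof.
move=> F2; suff: L2 (\sum_(i <- r) F i) /\ nrm (\sum_(i <- r) F i) <= \sum_(i <- r) nrm (F i) by case.
elim: r => [|i r [ih2 ih]]; first by rewrite !big_nil nrm0; split => //; exact: L2_0.
rewrite !big_cons; split; first exact: L2D.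
by apply: le_trans (nrmD (F2 i) ih2) _; rewrite lerD2l.
Qed.

Lemma nrm_advection_le phi psi (M : R) : testV phi -> testV psi -> 0 <= M ->
  (forall j x, `|phi j x| <= M) -> nrm (advection phi psi) <= M * d%:R * vn 1 psi.
Proof.
move=> vp vs M0 pM.
have Fj j : L2 (fun i x => phi j x * dfield j psi i x).
  move=> i; apply: (@bounded_Lfun2M _ _ _ mu _ _ M) => //.
    by apply: trig_measurable; exact: testV_trig.
  exact: L2_dfield.
have -> : advection phi psi = \sum_(j < d) (fun i x => phi j x * dfield j psi i x).
  apply/funext => i; apply/funext => x; rewrite /advection !fct_sumE.
  by [].
apply: le_trans (nrm_sum_le _ Fj) _.
apply: (@le_trans _ _ (\sum_(j < d) M * vn 1 psi)); last first.
  by rewrite sumr_const card_ord -[leLHS]mulr_natr mulrAC.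
apply: ler_sum => j _; apply: (@le_trans _ _ (M * nrm (dfield j psi))); last first.
  by rewrite ler_wpM2l// nrm_dfield_le.
have D2 := L2_dfield j vs.
rewrite -(@ler_pXn2r _ 2) ?nnegrE ?mulr_ge0 ?nrm_ge0// exprMn !sqr_nrm !innerE//.
rewrite mulr_sumr; apply: ler_sum => i _.
have D2i := D2 i.
rewrite /ip -RintegralZl//; last exact: Lfun2_intM.
apply: le_Rintegral => //.
- exact: (Lfun2_intM (Fj j i) (Fj j i)).
- have := integrableZl measurableT (M ^+ 2) (Lfun2_intM D2i D2i).
  by apply: eq_integrable => // x _ /=; rewrite EFinM.
- move=> x _; rewrite -!expr2 exprMn ler_wpM2r ?sqr_ge0//.
  by rewrite -[leLHS]real_normK ?num_real// lerXn2r ?nnegrE.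
Qed.

Lemma trilinear_wt_le ks al N S f g h : ksym ks -> 0 < N -> f \in Lfun mu 2%:E ->
  istrig ks g -> istrig ks h ->
  (forall ps, uniq ps -> \sum_(p <- ps) (wt al N p.1) ^- 2 <= S) ->
  ip mu f (fun x => g x * h x) ^+ 2 <= ip mu f f * S *
    ((\sum_(p <- kfull ks) hat g p ^+ 2 * wt al N p.1) *
     (\sum_(p <- kfull ks) hat h p ^+ 2 * wt al N p.1)).
Proof.
move=> ss N0 f2 tg th hS; have [us _] := kfull_sym ss.
have w0 p : 0 < wt al N p.1 :> R by apply: lt_le_trans (wt_ge1 _ _ _).
have -> : (fun x => g x * h x) = (fun x => tpoly (kfull ks) (hat g) x * tpoly (kfull ks) (hat h) x).
  by rewrite -tg -th.
apply: le_trans (trilinear_le _ _ f2 us w0) _.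
rewrite ler_wpM2r//; last by rewrite ler_wpM2l ?ip_ge0// hS.
by apply: mulr_ge0; apply: sumr_ge0 => p _; rewrite mulr_ge0 ?sqr_ge0// ltW.
Qed.

(** By Bessel, the constant 1 in the weight yields the L2 norm and its power part the [V^al]
    norm. *)
Lemma wt_sum_le ks al N w : 0 < N -> testV w -> uniq (kfull ks) ->
  \sum_(i < d) \sum_(p <- kfull ks) fhat w i p ^+ 2 * wt al N p.1 <=
  nrm w ^+ 2 + N `^ (- (2 * al)) * vn al w ^+ 2.
Proof.
move=> N0 vw us; rewrite exchange_big /=.
have h1 := field_bessel (testV_L2 vw) us; rewrite -sqr_nrm in h1.
have h2 := wsum_le_vn (testV_V al vw) us.
apply: (@le_trans _ _ (\sum_(p <- kfull ks) \sum_(i < d) fhat w i p ^+ 2 +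
   N `^ (- (2 * al)) * wsum al (kfull ks) w)); last first.
  by rewrite lerD// ler_wpM2l// powR_ge0.
rewrite /wsum mulr_sumr -big_split /= le_eqVlt; apply/orP; left; apply/eqP.
apply: eq_bigr => p _; rewrite mulr_sumr -big_split /=; apply: eq_bigr => i _.
rewrite /wt powRM ?kap_ge0 ?invr_ge0 ?(ltW N0)//.
rewrite -[N^-1]powR_inv1 ?(ltW N0)// -powRrM mulN1r.
have -> : kap R p.1 `^ (2 * al) = kap R p.1 `^ al ^+ 2.
  by rewrite mulrC powRrM powR_mulrn// powR_ge0.
ring.
Qed.

(** In [trilinear_wt_le] the gradient of [u] is the factor measured in plain L2, and both copies of
    [w] carry weights. The factor [d * d] counts the pairs of component and direction. *)
Lemma advection_interp al N S u w : 0 < N -> 0 <= S ->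
  (forall ps, uniq ps -> \sum_(p <- ps) (wt al N p.1) ^- 2 <= S) ->
  testV u -> testV w ->
  `|inner (advection w u) w| <= (d * d)%:R * vn 1 u * Num.sqrt S *
     (nrm w ^+ 2 + N `^ (- (2 * al)) * vn al w ^+ 2).
Proof.
move=> N0 S0 hS vu vw; have [ks [ss tw _ _]] := testV_hat vw; have [us _] := kfull_sym ss.
set Y := nrm w ^+ 2 + _.
have w0 p : 0 < wt al N p.1 :> R by apply: lt_le_trans (wt_ge1 _ _ _).
have Yi i : 0 <= \sum_(p <- kfull ks) fhat w i p ^+ 2 * wt al N p.1 <= Y.
  rewrite sumr_ge0 /= => [|p _]; last by rewrite mulr_ge0 ?sqr_ge0// ltW.
  apply: le_trans (wt_sum_le al N0 vw us); rewrite (bigD1 i)//= lerDl.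
  by apply: sumr_ge0 => j _; apply: sumr_ge0 => p _; rewrite mulr_ge0 ?sqr_ge0// ltW.
have Y0 : 0 <= Y.
  by rewrite addr_ge0 ?sqr_ge0// mulr_ge0 ?powR_ge0 ?sqr_ge0.
have e : inner (advection w u) w =
    \sum_(i < d) \sum_(j < d) ip mu (dfield j u i) (fun x => w j x * w i x).
  rewrite innerE; [|exact: L2_advection|exact: testV_L2].
  apply: eq_bigr => i _; rewrite /advection ip_suml; last 2 first.
  - by move=> j; apply: trig_L2; apply: trigM; [|apply: trig_partial]; exact: testV_trig.
  - by apply: trig_L2; exact: testV_trig.
  by apply: eq_bigr => j _; apply: eq_Rintegral => x _; rewrite /dfield; ring.
have b i j : `|ip mu (dfield j u i) (fun x => w j x * w i x)| <= vn 1 u * Num.sqrt S * Y.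
  have D2 := L2_dfield j vu.
  rewrite -(@ler_pXn2r _ 2) ?nnegrE ?mulr_ge0 ?sqrtr_ge0 ?vn_ge0// real_normK ?num_real//.
  apply: le_trans (trilinear_wt_le ss N0 (D2 i) (tw j) (tw i) hS) _.
  rewrite exprMn exprMn (sqr_sqrtr S0).
  have h1 : ip mu (dfield j u i) (dfield j u i) <= vn 1 u ^+ 2.
    apply: (@le_trans _ _ (nrm (dfield j u) ^+ 2)).
      rewrite sqr_nrm innerE// (bigD1 i)//= lerDl sumr_ge0// => l _; exact: ip_ge0.
    by rewrite lerXn2r ?nnegrE ?nrm_ge0 ?vn_ge0// nrm_dfield_le.
  have /andP[Yi0 Yi1] := Yi i; have /andP[Yj0 Yj1] := Yi j.
  apply: ler_pM; rewrite ?mulr_ge0 ?ip_ge0//; first by rewrite ler_wpM2r.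
  by rewrite expr2; apply: ler_pM.
rewrite e; apply: le_trans (ler_norm_sum _ _ _) _.
apply: (@le_trans _ _ (\sum_(i < d) \sum_(j < d) vn 1 u * Num.sqrt S * Y)).
  apply: ler_sum => i _; apply: le_trans (ler_norm_sum _ _ _) _.
  by apply: ler_sum => j _; exact: b.
rewrite !sumr_const card_ord -mulrnA -[leLHS]mulr_natl le_eqVlt; apply/orP; left; apply/eqP.
ring.
Qed.

End advection_bounds.

(** * Existence of [B] as a limit over test fields *)

Section nonlinear_term.
Context (R : realType) (d : nat).
Implicit Types (phi psi u v w a b : field R d) (ks : seq 'rV[int]_d) (s al N S K : R).

(** Continuity of advection at regularity [s], the property that makes the limit defining [B s]
    exist. *)
Definition adv_bound s K := forall phi psi, testV phi -> testV psi ->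
  nrm (advection phi psi) <= K * vn s phi * vn s psi.

Lemma adv_bound_exists al : (0 < d)%N -> d%:R < 4 * al -> 1 <= 2 * al ->
  exists2 K : R, 0 < K & adv_bound (2 * al) K.
Proof.
move=> d0 da al1; have [S S0 hS] := lattice_sum d0 da.
have al0 : 0 <= al by lra.
have hS1 (ps : seq (mode d)) : uniq ps -> \sum_(p <- ps) (wt al 1 p.1) ^- 2 <= S.
  by move=> us; have := hS 1 (lexx 1) ps us; rewrite expr1n mulr1.
exists (2 * Num.sqrt S * d%:R); first by rewrite !mulr_gt0 ?sqrtr_gt0 ?ltr0n.
move=> phi psi vp vs.
have M0 : 0 <= 2 * Num.sqrt S * vn (2 * al) phi by rewrite !mulr_ge0 ?sqrtr_ge0 ?vn_ge0.
apply: le_trans (nrm_advection_le vp vs M0 _) _.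
  by move=> j x; apply: testV_sup_le => //; exact: ltW.
rewrite -!mulrA ler_wpM2l// ler_wpM2l ?sqrtr_ge0// mulrCA ler_wpM2l// ler_wpM2l ?vn_ge0//.
by apply: vn_mono al1; exact: testV_V.
Qed.

Lemma nrm_leray_le g : L2 g -> nrm (leray g : field R d) <= nrm g.
Proof.
move=> g2; apply: nrm_le_of_testV; [exact: leray_H|exact: nrm_ge0|] => phi vp.
rewrite inner_leray//; last exact: testV_H.
by apply: le_trans (ler_norm _) (inner_CS _ _) => //; exact: testV_L2.
Qed.

(** Bilinearity moves one argument at a time: each difference has norm at most [2 * del], and
    [del <= 1] bounds the other factor by [vn s b + 1] or [vn s a + 1]. *)
Lemma adv_close s K a b phi psi phi' psi' (del : R) : 0 <= K -> adv_bound s K ->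
  inV s a -> inV s b -> testV phi -> testV psi -> testV phi' -> testV psi' ->
  del <= 1 -> vn s (phi - a) <= del -> vn s (psi - b) <= del ->
  vn s (phi' - a) <= del -> vn s (psi' - b) <= del ->
  nrm (leray (advection phi psi) - leray (advection phi' psi')) <=
  del * (2 * K * (vn s a + vn s b + 2)).
Proof.
move=> K0 hK Va Vb v1 v2 v3 v4 d1 h1 h2 h3 h4.
have V1 := testV_V s v1; have V2 := testV_V s v2; have V3 := testV_V s v3; have V4 := testV_V s v4.
apply: le_trans (leray_contract (L2_advection v1 v2) (L2_advection v3 v4)) _.
have -> : advection phi psi - advection phi' psi' =
    advection (phi - phi') psi + advection phi' (psi - psi').
  by rewrite advectionBl advectionBr// subrKA.
have v13 := testV_B v1 v3; have v24 := testV_B v2 v4.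
apply: le_trans (nrmD (L2_advection v13 v2) (L2_advection v3 v24)) _.
have b1 := hK _ _ v13 v2; have b2 := hK _ _ v3 v24.
have n1 : vn s (phi - phi') <= del + del.
  apply: le_trans (vn_triangle V1 Va V3) _; apply: lerD => //.
  by rewrite vn_subC.
have n2 : vn s (psi - psi') <= del + del.
  apply: le_trans (vn_triangle V2 Vb V4) _; apply: lerD => //.
  by rewrite vn_subC.
have n3 : vn s psi <= vn s b + 1 by apply: le_trans (vn_subr_le V2 Vb) _;
  rewrite lerD2l (le_trans h2).
have n4 : vn s phi' <= vn s a + 1 by apply: le_trans (vn_subr_le V3 Va) _;
  rewrite lerD2l (le_trans h3).
have c1 : vn s (phi - phi') * vn s psi <= (del + del) * (vn s b + 1).
  by apply: ler_pM => //; exact: vn_ge0.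
have c2 : vn s phi' * vn s (psi - psi') <= (vn s a + 1) * (del + del).
  by apply: ler_pM => //; exact: vn_ge0.
have e1 := ler_wpM2l K0 c1; have e2 := ler_wpM2l K0 c2.
rewrite mulrA in e1; rewrite mulrA in e2.
apply: le_trans (lerD (le_trans b1 e1) (le_trans b2 e2)) _.
rewrite le_eqVlt; apply/orP; left; apply/eqP; ring.
Qed.

Lemma nrm_triangle_lt u v w (x y z : R) : L2 u -> L2 v -> L2 w ->
  nrm (u - v) <= x -> nrm (v - w) <= y -> x + y < z -> nrm (u - w) < z.
Proof.
move=> u2 v2 w2 ux vy xyz; apply: le_lt_trans xyz.
exact: le_trans (nrm_triangle u2 v2 w2) (lerD ux vy).
Qed.

Lemma V_seq s a : inV s a -> exists F : nat -> field R d, forall n,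
  testV (F n) /\ vn s (F n - a) <= n.+1%:R^-1.
Proof.
move=> Va; suff H n : exists phi, testV phi /\ vn s (phi - a) <= n.+1%:R^-1.
  by have [F FP] := choice H; exists F.
have n0 : 0 < n.+1%:R^-1 :> R by rewrite invr_gt0.
have [phi [vp h]] := V_approx Va n0.
exists phi; split => //; have Vp := testV_V s vp.
by rewrite vn_subC//; rewrite VnormE ?lte_fin in h; [exact: ltW|exact: V_B].
Qed.

(** Approximating sequences give a Cauchy sequence by [adv_close]; the same estimate compares any
    nearby pair with the sequence, so the limit does not depend on the approximation. *)
Lemma B_exists s K a b : 0 <= K -> adv_bound s K -> inV s a -> inV s b ->
  exists c, H c /\ forall e : R, 0 < e -> exists2 del : R, 0 < del &
    forall phi psi, testV phi -> testV psi ->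
      vn s (phi - a) < del -> vn s (psi - b) < del ->
      nrm (leray (advection phi psi) - c) < e.
Proof.
move=> K0 hK Va Vb; have [F FP] := V_seq Va; have [G GP] := V_seq Vb.
have vF n : testV (F n) by have [] := FP n.
have vG n : testV (G n) by have [] := GP n.
pose c n := leray (advection (F n) (G n)).
have Hc n : H (c n) by apply: leray_H; exact: L2_advection.
(* The constant of [adv_close], increased by 1 so that it can be divided by. *)
pose Q := 2 * K * (vn s a + vn s b + 2) + 1.
have Q0 : 0 < Q by rewrite /Q ltr_wpDl// !mulr_ge0// !addr_ge0 ?vn_ge0.
have QP x : 0 <= x -> x * (2 * K * (vn s a + vn s b + 2)) <= x * Q.
  by move=> x0; rewrite ler_wpM2l// lerDl.
have small (x : R) : 0 < x -> exists m : nat, forall n, (m <= n)%N -> n.+1%:R^-1 <= x.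
  move=> x0; exists (Num.bound x^-1) => n mn.
  rewrite invf_ple ?posrE// ltW//.
  have /archi_boundP/lt_le_trans : 0 <= x^-1 by rewrite invr_ge0 ltW.
  by apply; rewrite ler_nat; apply: leq_trans mn _.
have inv1 n : n.+1%:R^-1 <= 1 :> R by rewrite invf_le1// ler1n.
have close phi psi n (del : R) : testV phi -> testV psi -> del <= 1 -> n.+1%:R^-1 <= del ->
    vn s (phi - a) <= del -> vn s (psi - b) <= del ->
    nrm (leray (advection phi psi) - c n) <= del * Q.
  move=> vp vs d1 nd h1 h2.
  have d0 : 0 <= del by apply: le_trans (vn_ge0 _ _) h1.
  apply: le_trans (QP _ d0); apply: (adv_close K0 hK Va Vb) => //.
    by apply: le_trans nd; have [] := FP n.
  by apply: le_trans nd; have [] := GP n.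
have [l l2 lP] : exists2 l, L2 l & forall e : R, 0 < e -> exists m : nat,
    forall n, (m <= n)%N -> nrm (c n - l) <= e.
  apply: field_complete => [n|e e0]; first exact: H_L2.
  have x0 : 0 < Num.min 1 (e / Q) by rewrite lt_min ltr01 divr_gt0.
  have [m mP] := small _ x0; exists m => n n' mn mn'.
  apply: (@le_trans _ _ (Num.min 1 (e / Q) * Q)).
    apply: close => //; first by rewrite ge_min lexx.
    - exact: mP.
    - by apply: le_trans (mP _ mn); have [] := FP n.
    - by apply: le_trans (mP _ mn); have [] := GP n.
  by rewrite -ler_pdivlMr// ge_min lexx orbT.
have Hl : H l.
  apply: H_closed => // e e0; have [m mP] := lP e e0; exists (c m); split => //.
  by rewrite nrmBC//; [exact: mP|exact: H_L2].
exists l; split => // e e0.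
have x0 : 0 < Num.min 1 (e / 2 / Q) by rewrite lt_min ltr01 !divr_gt0.
exists (Num.min 1 (e / 2 / Q)) => // phi psi vp vs h1 h2.
have [m1 m1P] := small _ x0; have [m2 m2P] := lP (e / 4) ltac:(by rewrite divr_gt0).
pose n := maxn m1 m2.
have b1 : nrm (leray (advection phi psi) - c n) <= Num.min 1 (e / 2 / Q) * Q.
  apply: close => //; [by rewrite ge_min lexx|by apply: m1P; exact: leq_maxl|exact: ltW|exact: ltW].
have b2 : Num.min 1 (e / 2 / Q) * Q <= e / 2 by rewrite -ler_pdivlMr// ge_min lexx orbT.
have b3 : nrm (c n - l) <= e / 4 by apply: m2P; exact: leq_maxr.
have HA : L2 (leray (advection phi psi)) by apply/H_L2/leray_H; exact: L2_advection.
apply: (nrm_triangle_lt HA (H_L2 (Hc n)) l2 (le_trans b1 b2) b3).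
by rewrite [ltRHS](splitr e) ltrD2l ltr_pM2l// ltf_pV2 ?posrE// ltr_nat.
Qed.

Lemma B_spec s K a b : 0 <= K -> adv_bound s K -> inV s a -> inV s b ->
  H (B s a b) /\ forall e : R, 0 < e -> exists2 del : R, 0 < del &
    forall phi psi, testV phi -> testV psi ->
      vn s (phi - a) < del -> vn s (psi - b) < del ->
      nrm (leray (advection phi psi) - B s a b) < e.
Proof.
move=> K0 hK Va Vb; have [c [Hc cP]] := B_exists K0 hK Va Vb.
have [HB BP] : [set c | H c /\ forall e : R, 0 < e -> exists2 del : R, 0 < del &
    forall phi psi, testV phi -> testV psi ->
      (Vnorm s (phi - a)%R < del%:E)%E -> (Vnorm s (psi - b)%R < del%:E)%E ->
      (L2norm (leray (advection phi psi) - c)%R < e%:E)%E] (B s a b).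
  apply: xgetPex; exists c; split => // e e0; have [del del0 dP] := cP e e0.
  exists del => // phi psi vp vs.
  rewrite (VnormE (V_B (testV_V s vp) Va)) (VnormE (V_B (testV_V s vs) Vb)) !lte_fin => h1 h2.
  rewrite L2normE ?lte_fin ?dP//; apply: L2B; apply: H_L2 => //.
  by apply: leray_H; exact: L2_advection.
split => // e e0; have [del del0 dP] := BP e e0; exists del => // phi psi vp vs h1 h2.
have := dP _ _ vp vs.
rewrite (VnormE (V_B (testV_V s vp) Va)) (VnormE (V_B (testV_V s vs) Vb)) !lte_fin => /(_ h1 h2).
rewrite L2normE ?lte_fin//; apply: L2B; apply: H_L2 => //.
by apply: leray_H; exact: L2_advection.
Qed.

End nonlinear_term.

(** * Energy estimate for the nonlinear difference *)

Section nonlinear_energy.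
Context (R : realType) (d : nat).
Implicit Types (phi psi u v w a b : field R d) (ks : seq 'rV[int]_d) (s al N S K : R).

Lemma B_trunc s K u (e : R) : 0 <= K -> adv_bound d s K -> inV s u -> 0 < e ->
  exists ks0, ksym ks0 /\ forall ks, ksym ks -> {subset ks0 <= ks} ->
    exists L : field R d, [/\ H L,
      forall phi, H phi -> inner L phi = inner (advection (trunc ks u) (trunc ks u)) phi,
      nrm L <= nrm (advection (trunc ks u) (trunc ks u)) & nrm (L - B s u u) < e].
Proof.
move=> K0 hK Vu e0; have [_ /(_ e e0)[del del0 dP]] := B_spec K0 hK Vu Vu.
have [ks0 [ss0 h]] := V_trunc Vu del0; exists ks0; split => // ks ss sub.
have vt := trunc_testV ss (V_H Vu); have A2 := L2_advection vt vt.
exists (leray (advection (trunc ks u) (trunc ks u))); split.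
- exact: leray_H.
- by move=> phi Hp; exact: inner_leray.
- exact: nrm_leray_le.
- by apply: dP => //; exact: h.
Qed.

Lemma B_H s K u : 0 <= K -> adv_bound d s K -> inV s u -> H (B s u u).
Proof. by move=> K0 hK Vu; have [] := B_spec K0 hK Vu Vu. Qed.

Lemma nrm_B_le s K u : 0 <= K -> adv_bound d s K -> inV s u ->
  nrm (B s u u) <= K * vn s u ^+ 2.
Proof.
move=> K0 hK Vu; have HBu := B_H K0 hK Vu; apply/ler_addgt0Pr => e e0.
have [ks [ss /(_ ks ss (fun _ x => x)) [L [HL _ h2 h]]]] := B_trunc K0 hK Vu e0.
have vt := trunc_testV ss (V_H Vu).
have L2L := H_L2 HL; have B2 := H_L2 HBu.
have h3 : nrm (B s u u) <= nrm L + nrm (L - B s u u).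
  rewrite (nrmBC L2L B2); have := nrmD L2L (L2B B2 L2L).
  by rewrite addrC subrK.
apply: le_trans h3 _; apply: lerD (ltW h).
apply: le_trans h2 _; apply: le_trans (hK _ _ vt vt) _.
rewrite -mulrA ler_wpM2l// -expr2 lerXn2r ?nnegrE ?vn_ge0//.
exact: vn_trunc_le.
Qed.

(** The difference telescopes into the advection of [u] by [u - v] and the advection of [u - v] by
    [v]; the latter is skew. *)
Lemma inner_advection_diff u v : testV u -> testV v ->
  inner (advection u u - advection v v) (u - v) = inner (advection (u - v) u) (u - v).
Proof.
move=> vu vv; have vw := testV_B vu vv.
have -> : advection u u - advection v v = advection (u - v) u + advection v (u - v).
  by rewrite advectionBl advectionBr// subrKA.
rewrite innerDl ?advection_skew ?addr0//; first exact: L2_advection.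
  exact: L2_advection.
exact: testV_L2.
Qed.

Lemma inner_B_diff s K al N S u v : 0 <= K -> adv_bound d s K -> inV s u -> inV s v ->
  1 <= s -> al <= s -> 0 < N -> 0 <= S ->
  (forall ps : seq (mode d), uniq ps -> \sum_(p <- ps) (wt al N p.1) ^- 2 <= S) ->
  `|inner (B s u u - B s v v) (u - v)| <= (d * d)%:R * vn 1 u * Num.sqrt S *
     (nrm (u - v) ^+ 2 + N `^ (- (2 * al)) * vn al (u - v) ^+ 2).
Proof.
move=> K0 hK Vu Vv s1 als N0 S0 hS.
have HBu := B_H K0 hK Vu; have HBv := B_H K0 hK Vv.
set Y := (d * d)%:R * _ * _ * _.
have Vw := V_B Vu Vv; have Hu := V_H Vu; have Hv := V_H Vv; have Hw := V_H Vw.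
have u2 := H_L2 Hu; have v2 := H_L2 Hv; have w2 := H_L2 Hw.
apply/ler_addgt0Pr => e e0.
(* Collects the factors of the three truncation errors: that of [u - v] is multiplied by the norm of
   the [B] difference, those of the two [B] terms by at most the norm of [u - v]. The 1 keeps [c]
   positive. *)
pose c := nrm (B s u u - B s v v) + 2 * nrm (u - v) + 1.
have c0 : 0 < c by rewrite /c ltr_wpDl// addr_ge0 ?nrm_ge0// mulr_ge0 ?nrm_ge0.
have ec0 : 0 < e / c by rewrite divr_gt0.
have [ks1 [ss1 h1]] := B_trunc K0 hK Vu ec0.
have [ks2 [ss2 h2]] := B_trunc K0 hK Vv ec0.
have [ks3 [ss3 _ h3]] := trunc_approx [::] Hw ec0.
(* One set of frequencies beyond all three thresholds: on it [trunc ks (u - v) = trunc ks u - trunc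
   ks v], and the cancellation applies. *)
pose ks := undup (undup (ks1 ++ ks2) ++ ks3).
have ss : ksym ks by apply: kunion_sym ss3; exact: kunion_sym.
have i1 : {subset ks1 <= ks} by move=> k kk; rewrite !(mem_undup, mem_cat) kk.
have i2 : {subset ks2 <= ks} by move=> k kk; rewrite !(mem_undup, mem_cat) kk orbT.
have i3 : {subset ks3 <= ks} by move=> k kk; rewrite !(mem_undup, mem_cat) kk !orbT.
have [Lu [HLu iLu _ {}h1]] := h1 _ ss i1; have [Lv [HLv iLv _ {}h2]] := h2 _ ss i2.
have {}h3 := h3 _ ss i3; have Lu2 := H_L2 HLu; have Lv2 := H_L2 HLv.
have wE : trunc ks (u - v) = trunc ks u - trunc ks v by exact: truncB.
have vtu := trunc_testV ss Hu; have vtv := trunc_testV ss Hv; have vtw := trunc_testV ss Hw.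
have Au := L2_advection vtu vtu; have Av := L2_advection vtv vtv.
have tH := testV_H vtw; have tw2 := testV_L2 vtw.
have I3 : inner (Lu - Lv) (trunc ks (u - v)) =
    inner (advection (trunc ks (u - v)) (trunc ks u)) (trunc ks (u - v)).
  by rewrite (innerBl Lu2 Lv2 tw2) iLu// iLv// -innerBl// wE inner_advection_diff.
have b3 : `|inner (advection (trunc ks (u - v)) (trunc ks u)) (trunc ks (u - v))| <= Y.
  apply: le_trans (advection_interp N0 S0 hS vtu vtw) _.
  apply: ler_pM.
  - by rewrite !mulr_ge0 ?vn_ge0 ?sqrtr_ge0.
  - by rewrite addr_ge0 ?sqr_ge0// mulr_ge0 ?powR_ge0 ?sqr_ge0.
  - rewrite ler_wpM2r ?sqrtr_ge0// ler_wpM2l//.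
    by apply: vn_trunc_le => //; exact: V_mono Vu s1.
  - apply: lerD; first by rewrite lerXn2r ?nnegrE ?nrm_ge0//; exact: nrm_trunc_bound.
    rewrite ler_wpM2l ?powR_ge0// lerXn2r ?nnegrE ?vn_ge0//.
    by apply: vn_trunc_le => //; exact: V_mono Vw als.
rewrite -I3 in b3.
have nw := nrm_trunc_bound ss w2.
clearbody Y; clear iLu iLv I3.
rewrite /c in ec0 c0 h1 h2 h3 *; clear c.
move: (u - v) (trunc ks (u - v)) (B s u u) (B s v v) HBu HBv h1 h2 h3 c0 ec0 b3 nw tw2 w2
  {Vw Hw vtw wE tH} => w t Bu Bv HBu HBv h1 h2 h3 c0 ec0 b3 nw tw2 w2.
have Bu2 := H_L2 HBu; have Bv2 := H_L2 HBv.
have D2 := L2B Bu2 Bv2; have E1 := L2B Lu2 Bu2; have E2 := L2B Lv2 Bv2.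
have dec : inner (Bu - Bv) w = inner (Bu - Bv) (w - t) - inner (Lu - Bu) t + inner (Lv - Bv) t
    + inner (Lu - Lv) t.
  by rewrite (innerBr w2 tw2 D2) !innerBl//; ring.
have q1 := inner_CS D2 (L2B w2 tw2).
have q2 := inner_CS E1 tw2; have q3 := inner_CS E2 tw2.
set X := nrm (Bu - Bv) in q1 c0 ec0 h1 h2 h3; set n := nrm w in nw c0 ec0 h1 h2 h3.
set del := e / _ in ec0 h1 h2 h3.
have n0 : 0 <= n by exact: nrm_ge0.
have X0 : 0 <= X by exact: nrm_ge0.
have r1 : X * nrm (w - t) <= X * del by rewrite ler_wpM2l.
have r2 : nrm (Lu - Bu) * nrm t <= del * n by apply: ler_pM => //; rewrite ?nrm_ge0// ltW.
have r3 : nrm (Lv - Bv) * nrm t <= del * n by apply: ler_pM => //; rewrite ?nrm_ge0// ltW.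
have r4 : del * (X + 2 * n + 1) = e by rewrite /del mulfVK// gt_eqF.
rewrite dec.
apply: le_trans (ler_normD _ _) _; apply: le_trans (lerD (ler_normD _ _) b3) _.
apply: le_trans (lerD (lerD (ler_normB _ _) q3) (lexx Y)) _.
apply: le_trans (lerD (lerD (lerD q1 q2) r3) (lexx Y)) _.
apply: le_trans (lerD (lerD (lerD r1 r2) (lexx _)) (lexx Y)) _.
by rewrite -r4; move: (ltW ec0) => d0; lra.
Qed.

End nonlinear_energy.

(** * Exponential decay *)

Lemma Rintegral_le_ae (R : realType) (g : R -> R) (s t c : R) : s <= t ->
  (@lebesgue_measure R).-integrable `[s, t] (EFin \o g) ->
  {ae (@lebesgue_measure R), forall r, s < r < t -> g r <= c} ->
  (\int[@lebesgue_measure R]_(r in `[s, t]) g r)%R <= c * (t - s).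
Proof.
move=> st ig gc; set leb := @lebesgue_measure R.
have mo : measurable `]s, t[ by exact: measurable_itv.
have sub : `]s, t[ `<=` `[s, t] by apply: subset_itv_oo_cc.
have igo : leb.-integrable `]s, t[ (EFin \o g) by exact: integrableS ig.
have mg : measurable_fun `]s, t[ g by apply/measurable_EFinP; exact: measurable_int igo.
have mgc : measurable_fun `[s, t] g by apply/measurable_EFinP; exact: measurable_int ig.
have icc : leb.-integrable `[s, t] (EFin \o cst c).
  apply: continuous_compact_integrable; first exact: segment_compact.
  by apply: continuous_subspaceT => x; exact: cvg_cst.
have ic : leb.-integrable `]s, t[ (EFin \o cst c) by exact: integrableS icc.
have ig2 : leb.-integrable `[s, t[ (EFin \o g).
  by apply: integrableS ig => //; apply: subset_itvl; rewrite bnd_simp.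
rewrite -(Rintegral_itv_bndo_bndc ig2) -(Rintegral_itv_obnd_cbnd igo).
have -> : c * (t - s) = (\int[leb]_(r in `]s, t[) c)%R.
  rewrite Rintegral_cst// [X in fine X](lebesgue_measure_itv `]s, t[) /= lte_fin.
  have [lt|ge] := ltP s t; first by [].
  have -> : t = s by apply/eqP; rewrite eq_le st ge.
  by rewrite subrr.
rewrite -subr_ge0 -RintegralB//.
have mcg : measurable_fun `]s, t[ (fun r => c - g r).
  by apply: measurable_funB.
(* The integrand is nonnegative only almost everywhere; its positive part has the same integral and
   is nonnegative everywhere. *)
have -> : (\int[leb]_(r in `]s, t[) (c - g r) = \int[leb]_(r in `]s, t[) Num.max (c - g r) 0)%R.
  congr fine; apply: ae_eq_integral => //.
  - exact/measurable_EFinP.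
  - by apply/measurable_EFinP/measurable_maxr.
  - have [A [mA A0 sA]] := gc; exists A; split => // r /= h; apply: sA => /= gr.
    apply: h; rewrite in_itv /= => /gr h.
    by congr EFin; apply/esym/max_idPl; rewrite subr_ge0.
by apply: fine_ge0; apply: integral_ge0 => r _; rewrite lee_fin le_max lexx orbT.
Qed.

(* Sum the increments over [n] equal steps: the total error is O(1/n). *)
Lemma le_of_quadratic_step (R : realType) (g : R -> R) (a b c : R) : a <= b ->
  (forall s t, a <= s -> s <= t -> t <= b -> g t <= g s + c * (t - s) ^+ 2) -> g b <= g a.
Proof.
move=> ab gq; have c0 : 0 <= `|c| by [].
have H (n : nat) : g b <= g a + `|c| * (b - a) ^+ 2 / n.+1%:R.
  pose x (k : nat) := a + (b - a) * (k%:R / n.+1%:R).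
  have n0 : 0 < n.+1%:R :> R by [].
  have xn : x n.+1 = b by rewrite /x divff ?gt_eqF// mulr1 addrC subrK.
  have dx k : x k.+1 - x k = (b - a) / n.+1%:R.
    by rewrite /x -(natr1 k); field; rewrite gt_eqF.
  have ba : 0 <= b - a by rewrite subr_ge0.
  have xm k : x k <= x k.+1 by rewrite -subr_ge0 dx divr_ge0.
  have xa k : a <= x k by rewrite /x lerDl mulr_ge0// divr_ge0.
  have xb k : (k <= n.+1)%N -> x k <= b.
    move=> kn; rewrite -xn /x lerD2l ler_wpM2l// ler_pM2r ?invr_gt0//.
    by rewrite ler_nat.
  have K k : (k <= n.+1)%N -> g (x k) <= g a + `|c| * ((b - a) / n.+1%:R) ^+ 2 * k%:R.
    elim: k => [_|k ih kn].
      by rewrite /x mul0r mulr0 addr0 mulr0 addr0.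
    have := gq (x k) (x k.+1) (xa k) (xm k) (xb _ kn); rewrite dx => /le_trans; apply.
    set D := ((b - a) / n.+1%:R) ^+ 2 in ih *.
    have -> : `|c| * D * k.+1%:R = `|c| * D * k%:R + `|c| * D by rewrite -(natr1 k) mulrDr mulr1.
    rewrite addrA; apply: lerD; first exact: ih (ltnW kn).
    by rewrite ler_wpM2r ?sqr_ge0// ler_norm.
  have := K n.+1 (leqnn _); rewrite xn => /le_trans; apply.
  rewrite lerD2l le_eqVlt; apply/orP; left; apply/eqP; field.
  by rewrite gt_eqF.
apply/ler_addgt0Pr => e e0.
pose m := Num.bound (`|c| * (b - a) ^+ 2 / e).
apply: le_trans (H m) _; rewrite lerD2l ler_pdivrMr// [leRHS]mulrC -ler_pdivrMr//.
have /archi_boundP h : 0 <= `|c| * (b - a) ^+ 2 / e by rewrite divr_ge0 ?(ltW e0)// mulr_ge0// sqr_ge0.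
by apply: le_trans (ltW h) _; rewrite ler_nat.
Qed.

Lemma expR_quadratic_le (R : realType) (x : R) : 0 <= x -> expR x <= 1 + x + x ^+ 2 * expR x.
Proof.
move=> x0; have e0 := expR_gt0 x.
have h : expR x - 1 <= x * expR x.
  have := expR_ge1Dx (- x); rewrite expRN => h.
  have := ler_wpM2r (ltW e0) h; rewrite mulVf ?gt_eqF// mulrDl mul1r; lra.
have := ler_wpM2l x0 h; rewrite mulrA -expr2; lra.
Qed.

Lemma ae_imp (R : realType) (P Q : R -> Prop) (s t : R) :
  {ae (@lebesgue_measure R), forall r, s < r < t -> P r} ->
  (forall r, s < r < t -> (s < r < t -> P r) -> Q r) ->
  {ae (@lebesgue_measure R), forall r, s < r < t -> Q r}.
Proof.
move=> [A [mA A0 sA]] PQ; exists A; split => // r /= h; apply: sA => /= pr.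
by apply: h => rs; exact: PQ.
Qed.

Section decay.
Context (R : realType) (d : nat).
Let leb := @lebesgue_measure R.

(* [D] is the time derivative of [w] at time [r]; its bound [K] makes [w]
   Lipschitz in time with values in [H]. *)
Definition dissipative (t0 lam : R) (w : R -> field R d) := forall T : R, t0 < T ->
  exists2 K : R, 0 <= K & forall phi s t, testV phi -> t0 <= s -> s <= t -> t <= T ->
    exists g : R -> R, [/\ leb.-integrable `[s, t] (EFin \o g),
      inner (w t) phi - inner (w s) phi = (\int[leb]_(r in `[s, t]) g r)%R
    & {ae leb, forall r, s < r < t -> exists D : field R d, [/\ L2 D, g r = inner D phi,
        nrm D <= K & inner D (w r) <= - lam * nrm (w r) ^+ 2]}].

(* The derivative is only tested against [testV], so [D] cannot be paired with
   [w] directly: w r is first approximated in [H] by a test field, and the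
   Lipschitz bound replaces w x by w r at the cost of an O((r - s)^2) error. *)
Lemma dissipative_decay (t0 lam : R) (w : R -> field R d) : 0 < lam ->
  (forall t, t0 <= t -> H (w t)) -> dissipative t0 lam w ->
  forall t, t0 <= t -> nrm (w t) <= nrm (w t0) * expR (- lam * (t - t0)).
Proof.
move=> lam0 Hw dw t t0t.
(* The horizon [t + 1] lies strictly beyond [t0], also when [t = t0]. *)
have [K K0 KP] := dw _ (ltac:(by rewrite ltr_pwDr) : t0 < t + 1).
have w2 r : t0 <= r -> L2 (w r) by move=> h; exact/H_L2/Hw.
have lip s r : t0 <= s -> s <= r -> r <= t + 1 -> nrm (w r - w s) <= K * (r - s).
  move=> ts sr rt; have tr := le_trans ts sr.
  apply: nrm_le_of_testV; [by apply: HB; exact: Hw|by rewrite mulr_ge0// subr_ge0|] => phi vp.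
  have p2 := testV_L2 vp.
  have [g [ig gE gP]] := KP phi s r vp ts sr rt.
  rewrite innerBl ?gE; [|exact: w2|exact: w2|exact: p2].
  rewrite mulrAC; apply: Rintegral_le_ae => //; apply: (ae_imp gP) => x xs h.
  have [D [D2 -> DK _]] := h xs.
  by apply: le_trans (ler_norm _) _; apply: le_trans (inner_CS D2 p2) _; rewrite ler_wpM2r ?nrm_ge0.
pose M := nrm (w t0) + K * (t + 1 - t0).
have M0 : 0 <= M by rewrite addr_ge0 ?nrm_ge0// mulr_ge0//; lra.
have wM r : t0 <= r -> r <= t -> nrm (w r) <= M.
  move=> tr rt; have := lip t0 r (lexx _) tr ltac:(lra).
  have := nrmD (w2 _ (lexx t0)) (L2B (w2 _ tr) (w2 _ (lexx t0))); rewrite addrC subrK => h1 h2.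
  apply: le_trans h1 _; rewrite lerD2l; apply: le_trans h2 _.
  by rewrite ler_wpM2l//; lra.
(* [K^2] is the cost of replacing [w x] by [w r] in the pairing with [D]; [2 * lam * M * K] that of
   replacing [nrm (w x) ^+ 2] by [nrm (w r) ^+ 2] in the damping term. *)
pose c1 := 2 * lam * M * K + K ^+ 2.
have c10 : 0 <= c1 by rewrite addr_ge0 ?sqr_ge0// !mulr_ge0// ltW.
have step2 s r : t0 <= s -> s <= r -> r <= t ->
    inner (w r - w s) (w r) <= (r - s) * (- lam * nrm (w r) ^+ 2 + c1 * (r - s)).
  move=> ts sr rt; have tr := le_trans ts sr.
  apply/ler_addgt0Pr => e e0.
  (* Approximating [w r] by [phi] costs [K * (r - s) * eta] twice: under the integral, and in the
     pairing with [w r - w s]. *)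
  pose eta := e / (2 * K * (r - s) + 1).
  have rs0 : 0 <= r - s by rewrite subr_ge0.
  have den0 : 0 < 2 * K * (r - s) + 1 by rewrite ltr_wpDl// !mulr_ge0.
  have eta0 : 0 < eta by rewrite divr_gt0.
  have etaE : 2 * K * (r - s) * eta <= e.
    rewrite /eta mulrCA ler_piMr ?(ltW e0)// ler_pdivrMr// mul1r lerDl//.
  have [phi [vp pP]] := H_approx (Hw _ tr) eta0; have p2 := testV_L2 vp.
  have [g [ig gE gP]] := KP phi s r vp ts sr ltac:(lra).
  have ir : inner (w r - w s) phi <= (- lam * nrm (w r) ^+ 2 + c1 * (r - s) + K * eta) * (r - s).
    rewrite innerBl ?gE; [|exact: w2|exact: w2|exact: p2].
    apply: Rintegral_le_ae => //; apply: (ae_imp gP) => x xs h.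
    have [D [D2 -> DK Dw]] := h xs; have /andP[sx xr] := xs.
    have tx : t0 <= x by lra.
    have -> : inner D phi = inner D (w x) + inner D (w r - w x) - inner D (w r - phi).
      by rewrite !(innerBr _ _ D2)//; [ring|exact: w2|exact: w2|exact: w2].
    have l1 := lip x r tx (ltW xr) ltac:(lra).
    have q1 : inner D (w r - w x) <= K * (K * (r - s)).
      apply: le_trans (ler_norm _) _; apply: le_trans (inner_CS D2 (L2B (w2 _ tr) (w2 _ tx))) _.
      apply: ler_pM; rewrite ?nrm_ge0//; apply: le_trans l1 _; rewrite ler_wpM2l//; lra.
    have q2 : - inner D (w r - phi) <= K * eta.
      apply: le_trans (ler_norm _) _; rewrite normrN.
      apply: le_trans (inner_CS D2 (L2B (w2 _ tr) p2)) _.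
      by apply: ler_pM; rewrite ?nrm_ge0// ltW.
    have q3 : nrm (w r) ^+ 2 <= nrm (w x) ^+ 2 + 2 * M * (K * (r - s)).
      have d1 : nrm (w r) <= nrm (w x) + K * (r - s).
        have := nrmD (w2 _ tx) (L2B (w2 _ tr) (w2 _ tx)); rewrite addrC subrK => /le_trans; apply.
        rewrite lerD2l; apply: le_trans l1 _; rewrite ler_wpM2l//; lra.
      have m1 := wM r tr rt; have m2 := wM x tx ltac:(lra).
      have n1 := nrm_ge0 (w r); have n2 := nrm_ge0 (w x).
      have z0 : 0 <= K * (r - s) by rewrite mulr_ge0.
      move: (nrm (w r)) (nrm (w x)) (K * (r - s)) d1 m1 m2 n1 n2 z0 => X Y Z d1 m1 m2 n1 n2 z0.
      have h1 : X ^+ 2 - Y ^+ 2 = (X - Y) * (X + Y) by ring.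
      have [le|lt] := leP X Y.
        have : X ^+ 2 <= Y ^+ 2 by rewrite lerXn2r ?nnegrE.
        have : 0 <= 2 * M * Z by rewrite !mulr_ge0.
        lra.
      have : (X - Y) * (X + Y) <= Z * (2 * M).
        by clear -d1 m1 m2 n1 n2 z0 lt; apply: ler_pM; lra.
      lra.
    have q4 := ler_wpM2l (ltW lam0) q3.
    rewrite /c1; lra.
  have l1 := lip s r ts sr ltac:(lra).
  have -> : inner (w r - w s) (w r) = inner (w r - w s) phi + inner (w r - w s) (w r - phi).
    have W2 := L2B (w2 _ tr) (w2 _ ts).
    by rewrite (innerBr (w2 _ tr) p2 W2); ring.
  have q5 : inner (w r - w s) (w r - phi) <= K * (r - s) * eta.
    apply: le_trans (ler_norm _) _.
    apply: le_trans (inner_CS (L2B (w2 _ tr) (w2 _ ts)) (L2B (w2 _ tr) p2)) _.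
    by apply: ler_pM; rewrite ?nrm_ge0// ltW.
  apply: le_trans (lerD ir q5) _; lra.
pose y r := nrm (w r) ^+ 2.
(* From [|w r|^2 - |w s|^2 = 2 <w r - w s, w r> - |w r - w s|^2], dropping the last square. *)
have step3 s r : t0 <= s -> s <= r -> r <= t ->
    y r * (1 + 2 * lam * (r - s)) <= y s + 2 * c1 * (r - s) ^+ 2.
  move=> ts sr rt; have tr := le_trans ts sr; have := step2 s r ts sr rt.
  have := inner_ge0 (w r - w s); rewrite /y !sqr_nrm.
  have a2 := w2 _ tr; have b2 := w2 _ ts.
  rewrite !(innerBl a2 b2)//; try exact: L2B.
  rewrite !(innerBr a2 b2)// (innerC (w s) (w r)); lra.
pose L := 2 * lam; pose E := expR (L * (t - t0)).
have L0 : 0 < L by rewrite mulr_gt0.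
pose c2 := (2 * c1 + M ^+ 2 * L ^+ 2 * E) * E.
(* With the integrating factor, [expR x <= 1 + x + x^2 * expR x] matches the [1 + L * (r - s)] of
   [step3] up to second order, so the product grows by [O((r - s)^2)] per step and cannot
   increase. *)
have final : expR (L * (t - t0)) * y t <= expR (L * (t0 - t0)) * y t0.
  apply: (@le_of_quadratic_step _ (fun r => expR (L * (r - t0)) * y r) t0 t c2) => // s r ts sr rt.
  have tr := le_trans ts sr; have rs0 : 0 <= r - s by rewrite subr_ge0.
  have x0 : 0 <= L * (r - s) by rewrite mulr_ge0// ltW.
  have y0 : 0 <= y r by rewrite sqr_ge0.
  have -> : expR (L * (r - t0)) = expR (L * (s - t0)) * expR (L * (r - s)).
    by rewrite -expRD; congr expR; ring.
  have e1 := expR_quadratic_le x0.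
  have eE : expR (L * (r - s)) <= E by rewrite ler_expR ler_wpM2l ?(ltW L0)//; lra.
  have eS : expR (L * (s - t0)) <= E by rewrite ler_expR ler_wpM2l ?(ltW L0)//; lra.
  have yM : y r <= M ^+ 2 by rewrite lerXn2r ?nnegrE ?nrm_ge0// wM.
  have st := step3 s r ts sr rt.
  have h1 : expR (L * (r - s)) * y r <= y s + (2 * c1 + M ^+ 2 * L ^+ 2 * E) * (r - s) ^+ 2.
    apply: le_trans (ler_wpM2r y0 e1) _.
    have h2 : (L * (r - s)) ^+ 2 * expR (L * (r - s)) * y r <= (L * (r - s)) ^+ 2 * E * M ^+ 2.
      apply: ler_pM => //; first by rewrite mulr_ge0 ?sqr_ge0// expR_ge0.
      by rewrite ler_wpM2l ?sqr_ge0.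
    rewrite /L in h2 *; lra.
  have D0 : 0 <= (2 * c1 + M ^+ 2 * L ^+ 2 * E) * (r - s) ^+ 2.
    apply: mulr_ge0; last exact: sqr_ge0.
    by apply: addr_ge0; [rewrite mulr_ge0|rewrite mulr_ge0 ?expR_ge0// mulr_ge0 ?sqr_ge0].
  rewrite -mulrA; apply: le_trans (ler_wpM2l (expR_ge0 _) h1) _.
  rewrite mulrDr lerD2l; apply: le_trans (ler_wpM2r D0 eS) _.
  rewrite le_eqVlt; apply/orP; left; apply/eqP; rewrite /c2; ring.
rewrite subrr mulr0 expR0 mul1r in final.
rewrite -(@ler_pXn2r _ 2) ?nnegrE ?mulr_ge0 ?nrm_ge0 ?expR_ge0// exprMn.
have -> : expR (- lam * (t - t0)) ^+ 2 = (expR (L * (t - t0)))^-1.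
  by rewrite -expRN expr2 -expRD /L; congr expR; ring.
by rewrite ler_pdivlMr ?expR_gt0// mulrC.
Qed.

End decay.

(** * Choice of the cut-off [N], the resulting constant, and the feedback term *)

Section energy.
Context (R : realType) (d : nat).
Implicit Types (phi psi u v w : field R d) (al nu K : R).

(** [C] is fixed before [K]: the bound [K] only makes [B] well defined and does not enter the
    estimate. *)
Lemma energy_constant al nu : (0 < d)%N -> d%:R < 4 * al -> 1 <= 2 * al -> 0 < nu ->
  exists2 C : R, 0 < C & forall K u v, 0 <= K -> adv_bound d (2 * al) K ->
    inV (2 * al) u -> inV (2 * al) v ->
    `|inner (B (2 * al) u u - B (2 * al) v v) (u - v)| <=
      nu / 2 * vn al (u - v) ^+ 2 +
      C * vn 1 u `^ (1 / (1 - d%:R / (4 * al))) * nrm (u - v) ^+ 2.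
Proof.
move=> d0 da al1 nu0; have [S S0 hS] := lattice_sum d0 da.
have al0 : 0 < al by lra.
pose c0 := (d * d)%:R * Num.sqrt S.
have c00 : 0 < c0 by rewrite mulr_gt0 ?sqrtr_gt0// ltr0n muln_gt0 d0.
pose th := 1 - d%:R / (4 * al).
have th0 : 0 < th by rewrite subr_gt0 ltr_pdivrMr ?mulr_gt0// mul1r.
have thE : 2 * al * th = 2 * al - d%:R / 2 by rewrite /th; field; rewrite gt_eqF.
(* The value of [c0 * |u|_V * N ^ (d / 2)], divided by [|u|_V ^ (1 / th)], at the cut-off [N] chosen
   below. *)
pose C := nu / 4 * (4 * c0 / nu) `^ (1 / th).
exists C; first by rewrite mulr_gt0 ?divr_gt0// powR_gt0// divr_gt0// mulr_gt0.
move=> K u v K0 hK Vu Vv; rewrite -/th.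
have Vw := V_B Vu Vv; have al2 : al <= 2 * al by lra.
have key N : 1 <= N -> `|inner (B (2 * al) u u - B (2 * al) v v) (u - v)| <=
    c0 * vn 1 u * N `^ (d%:R / 2) *
      (nrm (u - v) ^+ 2 + N `^ (- (2 * al)) * vn al (u - v) ^+ 2).
  move=> N1; have N0 : 0 < N by apply: lt_le_trans N1.
  have SN0 : 0 <= S * N ^+ d by rewrite mulr_ge0 ?exprn_ge0 ?ltW.
  have := inner_B_diff K0 hK Vu Vv al1 al2 N0 SN0 (hS N N1).
  rewrite sqrtrM ?(ltW S0)// -[N ^+ d]powR_mulrn ?(ltW N0)// -[Num.sqrt (N `^ _)]powR12_sqrt ?powR_ge0//.
  rewrite -powRrM => /le_trans; apply; rewrite le_eqVlt; apply/orP; left; apply/eqP.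
  by rewrite /c0; ring.
have na := nrm_le_vn (V_mono Vw al2) (ltW al0).
move: (B (2 * al) u u) (B (2 * al) v v) (u - v) key na {Vw} => Bu Bv w key na.
have U0 := vn_ge0 1 u.
have w0 := nrm_ge0 w; have a0 := vn_ge0 al w.
have na2 : nrm w ^+ 2 <= vn al w ^+ 2 by rewrite lerXn2r ?nnegrE.
have Ct : 0 <= C * vn 1 u `^ (1 / th) * nrm w ^+ 2.
  by rewrite mulr_ge0 ?sqr_ge0// mulr_ge0 ?powR_ge0// mulr_ge0 ?powR_ge0// divr_ge0// ltW.
have [small|big] := leP (c0 * vn 1 u) (nu / 4).
  have := key 1 (lexx 1); rewrite !powR1 !mulr1 mul1r => /le_trans; apply.
  apply: (@le_trans _ _ (nu / 4 * (nrm w ^+ 2 + vn al w ^+ 2))).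
    by rewrite ler_wpM2r// addr_ge0 ?sqr_ge0.
  have : nu / 4 * nrm w ^+ 2 <= nu / 4 * vn al w ^+ 2 by rewrite ler_wpM2l// divr_ge0// ltW.
  lra.
pose q := 4 * c0 * vn 1 u / nu.
have q1 : 1 <= q by rewrite /q ler_pdivlMr// mul1r; lra.
have q0 : 0 < q by apply: lt_le_trans q1.
(* Solves [c0 * |u|_V * N ^ (d / 2 - 2 al) = nu / 4], since [2 * al * th = 2 * al - d / 2]; the case
   assumption gives [q >= 1], hence [N >= 1]. *)
pose N := q `^ (2 * al * th)^-1.
have at0 : 0 < 2 * al * th by rewrite !mulr_gt0.
have N1 : 1 <= N by rewrite -(powRr0 q) /N ler_powR// invr_ge0 ltW.
have N0 : 0 < N by apply: lt_le_trans N1.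
have Nq : N `^ (2 * al * th) = q by rewrite /N -powRrM mulVf ?gt_eqF// powRr1// ltW.
have cU : c0 * vn 1 u = nu / 4 * q by rewrite /q; field; rewrite gt_eqF.
have pN x y : N `^ x * N `^ y = N `^ (x + y) by rewrite powRD// (gt_eqF N0) implybT.
have e1 : c0 * vn 1 u * N `^ (d%:R / 2) = C * vn 1 u `^ (1 / th).
  have -> : c0 * vn 1 u * N `^ (d%:R / 2) = nu / 4 * (N `^ (2 * al * th) * N `^ (d%:R / 2)).
    by rewrite cU Nq mulrA.
  have NE : N `^ (2 * al) = q `^ (1 / th).
    by rewrite /N -powRrM; congr powR; field; rewrite !gt_eqF.
  have qE : q `^ (1 / th) = (4 * c0 / nu) `^ (1 / th) * vn 1 u `^ (1 / th).
    rewrite -powRM ?divr_ge0 ?mulr_ge0 ?(ltW c00) ?(ltW nu0)//; congr powR.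
    by rewrite /q; ring.
  by rewrite pN thE subrK NE qE /C; ring.
have e2 : c0 * vn 1 u * N `^ (d%:R / 2) * N `^ (- (2 * al)) = nu / 4.
  have -> : c0 * vn 1 u * N `^ (d%:R / 2) * N `^ (- (2 * al)) =
      nu / 4 * (N `^ (2 * al * th) * N `^ (d%:R / 2) * N `^ (- (2 * al))).
    by rewrite cU Nq !mulrA.
  rewrite !pN thE (_ : 2 * al - d%:R / 2 + d%:R / 2 - 2 * al = 0); last by ring.
  by rewrite powRr0 mulr1.
apply: le_trans (key N N1) _.
rewrite mulrDr addrC mulrA e2 e1 lerD2r ler_wpM2r ?sqr_ge0//.
by rewrite ler_wpM2l ?(ltW nu0)// lef_pV2 ?posrE// ler_nat.
Qed.

(** Paired with a field of [H], the projector disappears and [Ih w] splits into [w] plus the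
    interpolation error, which the hypothesis at [s = 0] controls. *)
Lemma interpolant_leray al c0 h (Ih : field R d -> field R d) w : 0 <= al -> 0 < c0 -> 0 < h ->
  interpolant al c0 h Ih -> inV al w -> exists L : field R d, [/\ leray (Ih w) = L, H L,
    nrm L <= Num.sqrt c0 * h * vn al w + nrm w &
    - inner L w <= Num.sqrt c0 * h * vn al w * nrm w - nrm w ^+ 2].
Proof.
move=> al0 c00 h0 [IL2 _ Ib] Vw; have I2 := IL2 w (inV_V Vw).
have Hw := V_H Vw; have w2 := H_L2 Hw; have D2 := L2B I2 w2.
have b0 : 0 <= Num.sqrt c0 * h * vn al w by rewrite !mulr_ge0 ?sqrtr_ge0 ?vn_ge0// ltW.
have gb : (Vnorm 0 (Ih w - w)%R <= (Num.sqrt c0 * h * vn al w)%:E)%E.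
  have := Ib 0 w (lexx 0); rewrite add0r => /(_ (inV_V Vw)).
  rewrite (VnormE Vw); have := Vnorm_ge0 0 (Ih w - w).
  case: (Vnorm 0 _) => [r| |] //.
  move=> r0 hr; rewrite lee_fin in r0; rewrite lee_fin; move: hr.
  rewrite -!EFin_expe -EFinM lee_fin => hr.
  rewrite -(@ler_pXn2r _ 2) ?nnegrE//.
  by rewrite !exprMn sqr_sqrtr ?(ltW c00).
have [HL iL] := leray_spec I2; exists (leray (Ih w)); split => //.
  apply: nrm_le_of_testV => //; first by rewrite addr_ge0 ?nrm_ge0.
  move=> phi vp; have Hp := testV_H vp; have p2 := H_L2 Hp.
  rewrite iL// -(subrK w (Ih w)) innerDl// mulrDl lerD//.
    by apply: le_trans (ler_norm _) _; exact: inner_le_Vnorm0.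
  by apply: le_trans (ler_norm _) _; exact: inner_CS.
rewrite iL// -(subrK w (Ih w)) innerDl// opprD sqr_nrm lerD2r.
by apply: le_trans (ler_norm _) _; rewrite normrN; exact: inner_le_Vnorm0.
Qed.

End energy.

(** * The energy balance at a fixed time *)

Section fixed_time.
Context (R : realType) (d : nat).
Implicit Types (phi psi u v w f : field R d) (al nu K mu : R).
Let leb := @lebesgue_measure R.

Lemma rate_aeq nu (w b s F : field R d) :
  aeq (fun i x => w i x + b i x + nu * s i x) F -> aeq w (F - b - nu *: s).
Proof.
move=> h i; have [A [mA A0 sA]] := h i; exists A; split => // x /= nx; apply: sA => /= e.
by apply: nx; rewrite -[RHS]/(F i x - b i x - nu * s i x) -e; ring.
Qed.

Lemma vn_sub_le s u v : inV s u -> inV s v -> vn s (u - v) <= vn s u + vn s v.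
Proof.
move=> Vu Vv; have Vw := V_B Vu Vv; have u2 := V_L2 Vu; have v2 := V_L2 Vv.
rewrite -lee_fin EFinD -!VnormE//.
have <- : Vnorm s (- v) = Vnorm s v by exact: VnormN.
by apply: VnormD => //; exact: L2N.
Qed.

Lemma dissipation al nu mu h c0 K sig Mu Mv (Ih : field R d -> field R d) f u v :
  1 <= 2 * al -> 0 < nu -> 0 < mu -> 0 < h -> 0 < c0 -> mu * h ^+ 2 * c0 <= nu ->
  interpolant al c0 h Ih -> L2 f -> 0 <= K -> adv_bound d (2 * al) K ->
  inV (2 * al) u -> inV (2 * al) v -> vn (2 * al) u <= Mu -> vn (2 * al) v <= Mv ->
  `|inner (B (2 * al) u u - B (2 * al) v v) (u - v)| <=
      nu / 2 * vn al (u - v) ^+ 2 + sig * nrm (u - v) ^+ 2 ->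
  exists D : field R d, [/\ L2 D, forall phi, testV phi ->
    inner (f - B (2 * al) u u - nu *: stokes al u) phi -
    inner ((fun i x => f i x + mu * leray (Ih (u - v)) i x) - B (2 * al) v v - nu *: stokes al v) phi
      = inner D phi,
    nrm D <= K * Mu ^+ 2 + K * Mv ^+ 2 + nu * (Mu + Mv) +
             mu * (Num.sqrt c0 * h * (Mu + Mv) + (Mu + Mv)) &
    inner D (u - v) <= (sig - mu / 2) * nrm (u - v) ^+ 2].
Proof.
move=> al1 nu0 mu0 h0 c00 muh Ihi f2 K0 hK Vu Vv uM vM.
have al0 : 0 <= al by lra.
have al2 : al <= 2 * al by lra.
have HBu := B_H K0 hK Vu; have HBv := B_H K0 hK Vv.
have nBu := nrm_B_le K0 hK Vu; have nBv := nrm_B_le K0 hK Vv.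
have HSu := stokes_H Vu; have HSv := stokes_H Vv.
have nSu := nrm_stokes_le Vu; have nSv := nrm_stokes_le Vv.
have Sco := stokes_coercive al0 Vu Vv.
have Vw2 := V_B Vu Vv; have Vw := V_mono Vw2 al2.
have [L [-> HL nL iL]] := interpolant_leray al0 c00 h0 Ihi Vw.
have w2 := V_L2 Vw.
have aM : vn al (u - v) <= Mu + Mv.
  by apply: le_trans (vn_mono Vw2 al2) _; apply: le_trans (vn_sub_le Vu Vv) _; exact: lerD.
have nw := le_trans (nrm_le_vn Vw al0) aM.
have a0 := vn_ge0 al (u - v); have n0 := nrm_ge0 (u - v).
have u0 := vn_ge0 (2 * al) u; have v0 := vn_ge0 (2 * al) v.
move: (vn al (u - v)) a0 aM nL iL Sco => a a0 aM nL iL Sco.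
move: (vn (2 * al) u) u0 uM nBu nSu => U U0 uM nBu nSu.
move: (vn (2 * al) v) v0 vM nBv nSv => V0 v0 vM nBv nSv.
move: (u - v) w2 nw n0 nL iL Sco => w w2 nw n0 nL iL Sco {Vw Vw2}.
move: (B (2 * al) u u) (B (2 * al) v v) HBu HBv nBu nBv => Bu Bv HBu HBv nBu nBv.
move: (stokes al u) (stokes al v) HSu HSv nSu nSv Sco => Su Sv HSu HSv nSu nSv Sco Bw.
have Bu2 := H_L2 HBu; have Bv2 := H_L2 HBv; have Su2 := H_L2 HSu; have Sv2 := H_L2 HSv.
have L2L := H_L2 HL.
have B2 := L2B Bu2 Bv2; have S2 := L2B Su2 Sv2.
have nS2 := L2Z nu S2; have mL2 := L2Z mu L2L.
(* The difference of the two right-hand sides, in which the forcing cancels. *)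
exists (- (Bu - Bv) - nu *: (Su - Sv) - mu *: L); split.
- by apply: L2B => //; apply: L2B => //; exact: L2N.
- move=> phi vp; have p2 := testV_L2 vp.
  rewrite -innerBl//; last 2 first.
  + by apply: L2B; [exact: L2B|exact: L2Z].
  + by apply: L2B; [apply: L2B => //; exact: (L2D f2 mL2)|exact: L2Z].
  congr inner; apply/funext => i; apply/funext => x.
  rewrite -[LHS]/(f i x - Bu i x - nu * Su i x - (f i x + mu * L i x - Bv i x - nu * Sv i x)).
  rewrite -[RHS]/(- (Bu i x - Bv i x) - nu * (Su i x - Sv i x) - mu * L i x).
  ring.
- apply: le_trans (nrmB (L2B (L2N B2) nS2) mL2) _; apply: lerD; last first.
    rewrite nrmZ// ger0_norm ?(ltW mu0)// ler_wpM2l ?(ltW mu0)//.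
    apply: le_trans nL _; apply: lerD => //; rewrite ler_wpM2l//.
    by rewrite mulr_ge0 ?sqrtr_ge0// ltW.
  apply: le_trans (nrmB (L2N B2) nS2) _; apply: lerD; last first.
    rewrite nrmZ// ger0_norm ?(ltW nu0)// ler_wpM2l ?(ltW nu0)//.
    by apply: le_trans (nrmB Su2 Sv2) _; apply: lerD; [exact: le_trans nSu uM|exact: le_trans nSv vM].
  rewrite nrmN//; apply: le_trans (nrmB Bu2 Bv2) _; apply: lerD.
    by apply: le_trans nBu _; rewrite ler_wpM2l// lerXn2r ?nnegrE// (le_trans U0).
  by apply: le_trans nBv _; rewrite ler_wpM2l// lerXn2r ?nnegrE// (le_trans v0).
rewrite (innerBl (L2B (L2N B2) nS2) mL2 w2) (innerBl (L2N B2) nS2 w2).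
have -> : inner (- (Bu - Bv)) w = - inner (Bu - Bv) w.
  by rewrite -scaleN1r innerZl// mulN1r.
rewrite (innerZl nu S2 w2) (innerZl mu L2L w2).
have h1 : - inner (Bu - Bv) w <= nu / 2 * a ^+ 2 + sig * nrm w ^+ 2.
  by apply: le_trans Bw; rewrite -normrN ler_norm.
have h2 := ler_wpM2l (ltW nu0) Sco.
have h3 := ler_wpM2l (ltW mu0) iL.
have b2 : mu * (Num.sqrt c0 * h * a) ^+ 2 <= nu * a ^+ 2.
  rewrite !exprMn sqr_sqrtr ?(ltW c00)//.
  rewrite (_ : mu * (c0 * h ^+ 2 * a ^+ 2) = mu * h ^+ 2 * c0 * a ^+ 2); last by ring.
  by rewrite ler_wpM2r ?sqr_ge0.
move: (Num.sqrt c0 * h * a) h3 b2 => b h3 b2.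
(* Young's inequality spends half of the feedback damping; by [b2] the remaining [mu / 2 * b^2] uses
   the half of the dissipation that the nonlinear term left over. *)
have h4 : mu * (b * nrm w) <= mu / 2 * b ^+ 2 + mu / 2 * nrm w ^+ 2.
  rewrite -mulrDr -subr_ge0 (_ : _ - _ = mu / 2 * (b - nrm w) ^+ 2); last by field.
  by rewrite mulr_ge0 ?sqr_ge0// divr_ge0// ltW.
move: (inner _ w) (inner _ w) (inner _ w) h1 h2 h3 => x1 x2 x3 h1 h2 h3.
lra.
Qed.

End fixed_time.

(** * From the two evolution equations to dissipativity of the difference *)

Section evolution.
Context (R : realType) (d : nat).
Implicit Types (phi psi : field R d) (u v w : R -> field R d) (f : field R d).
Let leb := @lebesgue_measure R.

(** The norm is a continuous function of time by the triangle inequality, so it attains its maximum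
    on the compact interval. *)
Lemma in_C_bounded s T u : 0 <= T -> in_C s 0 T u ->
  exists M : R, forall t, 0 <= t <= T -> inV s (u t) /\ vn s (u t) <= M.
Proof.
move=> T0 uC; have Vu t : 0 <= t <= T -> inV s (u t) by move=> tT; have [/InV] := uC t tT.
have cu : {within `[0, T], continuous (fun t => vn s (u t))}.
  apply/subspace_continuousP => t; rewrite /= in_itv /= => tT.
  have [_ /fine_cvgP[_ /cvgrPdist_lt h]] := uC t tT.
  apply/cvgrPdist_lt => e e0; have {}h := h e e0.
  move: h; rewrite !near_withinE; apply: filterS => r h rT; have {}h := h rT.
  move: rT; rewrite /= in_itv /= => rT.
  have Vr := Vu r rT; have Vt := Vu t tT.
  have h1 := vn_subr_le Vr Vt; have h2 := vn_subr_le Vt Vr.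
  have h3 : vn s (u r - u t) < e.
    apply: le_lt_trans h; rewrite vn.unlock /= sub0r normrN ger0_norm//.
    exact: fine_ge0 (Vnorm_ge0 _ _).
  rewrite (vn_subC Vt Vr) in h2; rewrite -[X in `|X|]/(vn s (u t) - vn s (u r)) ltr_norml.
  apply/andP; split; lra.
have [c cT cM] := EVT_max T0 cu.
exists (vn s (u c)) => t tT; split; first exact: Vu.
by apply: cM; rewrite in_itv.
Qed.

Lemma time_derivative_interval (t0 s t : R) w wd phi : time_derivative t0 w wd -> testV phi ->
  t0 <= s -> s <= t ->
  leb.-integrable `[s, t] (EFin \o (fun r => inner (wd r) phi)) /\
  inner (w t) phi - inner (w s) phi = (\int[leb]_(r in `[s, t]) inner (wd r) phi)%R.
Proof.
move=> dw vp ts st; have [i1 e1] := dw phi vp t (le_trans ts st); have [_ e2] := dw phi vp s ts.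
have i3 : leb.-integrable `[s, t] (EFin \o (fun r => inner (wd r) phi)).
  by apply: integrableS i1 => //; apply: subset_itvr; rewrite bnd_simp.
split => //; rewrite {}e1 {}e2.
have io : leb.-integrable `]s, t] (EFin \o (fun r => inner (wd r) phi)).
  by apply: integrableS i3 => //; apply: subset_itvr; rewrite bnd_simp.
rewrite -(Rintegral_itv_obnd_cbnd io).
rewrite -(@Rintegral_itvB R (fun r => inner (wd r) phi) (BLeft t0) (BRight t) s i1) ?bnd_simp//.
ring.
Qed.

Lemma in_Loo_bounded s (t0 T : R) v : in_Loo s t0 T v ->
  exists M : R, {ae leb, forall r, t0 < r < T -> inV s (v r) /\ vn s (v r) <= M}.
Proof.
move=> [_ aV [M aM]]; exists M.
have FF : Filter (nbhs (almost_everywhere leb)) := ae_filter_ringOfSetsType _.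
apply: filterS2 aV aM => r hV hM rT.
have Vr := InV (hV rT); split => //.
by rewrite -lee_fin -VnormE// hM.
Qed.

Lemma difference_dissipative (al nu mu h c0 K sig t0 : R)
    (Ih : field R d -> field R d) f (u0 v0 : field R d) u v :
  1 <= 2 * al -> 0 < nu -> 0 < mu -> 0 < h -> 0 < c0 -> mu * h ^+ 2 * c0 <= nu ->
  interpolant al c0 h Ih -> L2 f -> 0 <= K -> adv_bound d (2 * al) K -> 0 <= t0 ->
  classical_u al nu f u0 u -> classical_v al nu mu t0 Ih f v0 u v ->
  (forall t, t0 <= t -> inV (2 * al) (u t) -> inV (2 * al) (v t) ->
    `|inner (B (2 * al) (u t) (u t) - B (2 * al) (v t) (v t)) (u t - v t)| <=
      nu / 2 * vn al (u t - v t) ^+ 2 + sig * nrm (u t - v t) ^+ 2) ->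
  (forall t, t0 <= t -> L2 (u t)) -> (forall t, t0 <= t -> L2 (v t)) ->
  dissipative t0 (mu / 2 - sig) (fun t => u t - v t).
Proof.
move=> al1 nu0 mu0 h0 c00 muh Ihi f2 K0 hK t00 [uT [_ [wu [du au]]]]
  [vT _ [_ [wv [dv av]]]] Bw u2 v2.
move=> T t0T; have T0 : 0 < T by exact: le_lt_trans t0T.
have [uC _] := uT T T0; have [Mu uM] := in_C_bounded (ltW T0) uC.
have [vL _] := vT T t0T; have [Mv vM] := in_Loo_bounded vL.
(* The bounds obtained above carry no sign; absolute values make the Lipschitz constant
   nonnegative. *)
pose M1 := `|Mu|; pose M2 := `|Mv|.
exists (K * M1 ^+ 2 + K * M2 ^+ 2 + nu * (M1 + M2) +
             mu * (Num.sqrt c0 * h * (M1 + M2) + (M1 + M2))).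
  have m1 : 0 <= M1 := normr_ge0 _; have m2 : 0 <= M2 := normr_ge0 _.
  have := ltW nu0; have := ltW mu0; have := ltW h0; have := sqrtr_ge0 c0 => ? ? ? ?.
  by do ?[apply: addr_ge0|apply: mulr_ge0].
move=> phi s t vp ts st tT; have p2 := testV_L2 vp.
have [iu eu] := time_derivative_interval du vp (le_trans t00 ts) st.
have [iv ev] := time_derivative_interval dv vp ts st.
have mi : measurable (`[s, t]%classic : set R) by exact: measurable_itv.
exists (fun r => inner (wu r) phi - inner (wv r) phi); split.
- exact: (@integrableB _ _ R (@lebesgue_measure R) _ mi _ _ iu iv).
- have tt := le_trans ts st.
  rewrite (innerBl (u2 _ tt) (v2 _ tt) p2) (innerBl (u2 _ ts) (v2 _ ts) p2).
  rewrite (@RintegralB _ _ R (@lebesgue_measure R) _ _ _ mi iu iv) -eu -ev; ring.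
- have FF : Filter (nbhs (almost_everywhere leb)) := ae_filter_ringOfSetsType _.
  apply: filterS3 vM au av => r hv hu hw /andP[sr rt].
  have tr : t0 < r by exact: le_lt_trans ts sr.
  have rT : r < T by exact: lt_le_trans rt tT.
  have r0 : 0 < r by exact: le_lt_trans tr.
  have [Vv vMr] := hv (ltac:(by rewrite tr rT)).
  have [Vu uMr] := uM r (ltac:(by rewrite !ltW)).
  have {}hu := rate_aeq (hu r0); have {}hw := rate_aeq (hw tr).
  rewrite (inner_aeq _ hu) (inner_aeq _ hw).
  have [D [D2 DE Dn Dw]] := dissipation al1 nu0 mu0 h0 c00 muh Ihi f2 K0 hK Vu Vv
    (le_trans uMr (ler_norm _)) (le_trans vMr (ler_norm _)) (Bw r (ltW tr) Vu Vv).
  exists D; split => //; first exact: DE.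
  by rewrite opprB.
Qed.

End evolution.

Theorem theorem4p1 (R : realType) (d : nat) (alpha nu : R) :
  (2 <= d <= 8)%N ->
  d%:R / 4 + 1 / 2 <= alpha ->
  0 < nu ->
  let theta : R := 1 - d%:R / (4 * alpha) in
  exists C : R, 0 < C /\
  forall (mu h c0 : R) (Ih : field R d -> field R d) (f : field R d)
         (t0 : R) (u0 v0 : field R d) (u v : R -> field R d),
    0 < mu -> 0 < h -> 0 < c0 ->
    interpolant alpha c0 h Ih ->
    H f ->
    0 <= t0 ->
    V (2 * alpha) u0 -> V (2 * alpha) v0 ->
    classical_u alpha nu f u0 u ->
    classical_v alpha nu mu t0 Ih f v0 u v ->
    ((2 * C)%:E * ereal_sup [set poweR (Vnorm 1 (u t)) (1 / theta) | t in `[t0, +oo[]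
       < mu%:E)%E ->
    mu * h ^+ 2 * c0 <= nu ->
    exists M lambda : R, [/\ 0 < M, 0 < lambda &
      forall t : R, t0 <= t ->
        (L2norm (u t - v t)%R <= (M * expR (- lambda * (t - t0)))%:E)%E].
Proof.
move=> /andP[d2 _] ald nu0 theta.
have d2r : 2 <= d%:R :> R by rewrite ler_nat.
have d0 : (0 < d)%N by lia.
have al1 : d%:R < 4 * alpha by lra.
have al2 : 1 <= 2 * alpha by lra.
have [C C0 CP] := energy_constant d0 al1 al2 nu0.
have [K K0 hK] := adv_bound_exists d0 al1 al2.
exists C; split => // mu h c0 Ih f t0 u0 v0 u v mu0 h0 c00 Ihi Hf t00 _ _ cu cv sup_lt muh.
have [uT _] := cu; have [_ [Hv _] _] := cv.
have Vu t : t0 <= t -> inV (2 * alpha) (u t).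
  move=> t0t; have T0 : 0 < t + 1 by lra.
  have [/(_ t) uC _] := uT (t + 1) T0.
  have tT : 0 <= t <= t + 1 by apply/andP; split; lra.
  by have [/InV] := uC tT.
set S := ereal_sup _ in sup_lt.
have le_S t : t0 <= t -> ((vn 1 (u t) `^ (1 / theta))%:E <= S)%E.
  move=> t0t; apply: ereal_sup_ubound; exists t; first by rewrite /= in_itv /= t0t.
  by rewrite (VnormE (V_mono (Vu t t0t) al2)).
have S0 : (0 <= S)%E by apply: le_trans (le_S _ (lexx _)); rewrite lee_fin powR_ge0.
(* An infinite supremum would make [2 * C * S] infinite, against the bound by [mu]. *)
have [sig SE] : exists sig, S = sig%:E.
  move: S0 sup_lt; case: (S) => [r| |]// _; first by exists r.
  by rewrite gt0_muley ?lte_fin ?mulr_gt0// ltNge leey.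
rewrite {}SE in le_S sup_lt.
rewrite -EFinM lte_fin in sup_lt.
(* The lower bound assumed on [mu] is exactly the positivity of this decay rate. *)
have lam0 : 0 < mu / 2 - C * sig by lra.
have Hw t : t0 <= t -> H (u t - v t) by move=> tt; apply: HB; [exact: V_H (Vu t tt)|exact: Hv].
have dis : dissipative t0 (mu / 2 - C * sig) (fun t => u t - v t).
  apply: (difference_dissipative al2 nu0 mu0 h0 c00 muh Ihi (H_L2 Hf) (ltW K0) hK t00 cu cv).
  - move=> t tt Vut Vvt; apply: le_trans (CP K (u t) (v t) (ltW K0) hK Vut Vvt) _.
    rewrite lerD2l ler_wpM2r ?sqr_ge0// ler_wpM2l ?(ltW C0)//.
    by rewrite -lee_fin; exact: le_S.
  - by move=> t tt; exact: V_L2 (Vu t tt).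
  - by move=> t tt; exact/H_L2/Hv.
(* Adding 1 keeps [M] positive when the two solutions agree at [t0]. *)
exists (nrm (u t0 - v t0) + 1), (mu / 2 - C * sig); split => //.
  by rewrite ltr_wpDl ?nrm_ge0.
move=> t tt; rewrite L2normE; last exact/H_L2/Hw.
rewrite lee_fin; apply: le_trans (dissipative_decay lam0 Hw dis tt) _.
by rewrite ler_wpM2r ?expR_ge0// lerDl.
Qed.
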